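(* Let $G\subset\mathbb{C}$ be a continuum (connected compact set, not a single point) with $\tilde{\mathbb{C}}\setminus G$ connected, and let $R>1$ be such that $f$ and $g$ are analytic in $G_{R}$, with Faber expansions $f(z)=\sum_{k=0}^{\infty}a_{k}(f)F_{k}(z)$, $g(z)=\sum_{k=0}^{\infty}a_{k}(g)F_{k}(z)$ for $z\in G_{R}$. Suppose that for each $h\in\{f,g,fg\}$ the function $H$ associated with $h$ (see context) extends continuously to $\overline{\mathbb{D}_{1}}$. Let $1<r<R$. (i) There is a constant $C$ depending on $f,g,r$ but not on $n$ such that for all $z\in\overline{G_{r}}$ and $n\in\mathbb{N}$, $$|\mathcal{B}_{n}(fg;G)(z)-\mathcal{B}_{n}(f;G)(z)\,\mathcal{B}_{n}(g;G)(z)|\le\frac{C}{n}.$$ (ii) There is a constant $C$ depending on $f,g,r$ but not on $n$ such that for all $z\in\overline{G_{r}}$ and $n\in\mathbb{N}$, $$\Big|\mathcal{B}_{n}(fg;G)(z)-\mathcal{B}_{n}(f;G)(z)\,\mathcal{B}_{n}(g;G)(z)-\sum_{k=2}^{\infty}\frac{k(k-1)}{2n}[F_{k-1}(z)-F_{k}(z)]\,[a_{k}(fg)-f(z)a_{k}(g)-g(z)a_{k}(f)]\Big|\le\frac{C}{n^{2}}.$$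
   Context: Let $G\subset\mathbb{C}$ be compact with $\tilde{\mathbb{C}}\setminus G$ connected ($\tilde{\mathbb{C}}$ the extended plane). Let $\Psi$ be the unique conformal map of $\tilde{\mathbb{C}}\setminus\overline{\mathbb{D}_{1}}$ onto $\tilde{\mathbb{C}}\setminus G$ with $\Psi(\infty)=\infty$, $\Psi'(\infty)>0$, where $\mathbb{D}_{1}=\{|w|<1\}$, and $\Phi=\Psi^{-1}$. The Faber polynomials $F_{n}$ of $G$ are defined by $\frac{\Psi'(w)}{\Psi(w)-z}=\sum_{n=0}^{\infty}\frac{F_{n}(z)}{w^{n+1}}$, $z\in G$, $|w|>1$. For $R>1$, $\Gamma_{R}=\{\Psi(w):|w|=R\}=\{z:|\Phi(z)|=R\}$ and $G_{R}$ is the interior of $\Gamma_{R}$ (so $G\subset\overline{G_{r}}$ for $1<r<R$). For $h$ analytic on $G_{R}$, the Faber coefficients are $a_{n}(h)=\frac{1}{2\pi i}\int_{|u|=1}\frac{h(\Psi(u))}{u^{n+1}}du$, $n\ge0$. The function associated with $h$ is $H(w)=\frac{1}{2\pi i}\int_{|u|=1}\frac{h(\Psi(u))}{u-w}du$, $w\in\mathbb{D}_{1}$. The Bernstein-Faber polynomials are $$\mathcal{B}_{n}(h;G)(z)=\sum_{p=0}^{n}\binom{n}{p}\Delta_{1/n}^{p}H(0)\,F_{p}(z),\qquad \Delta_{t}^{p}H(0)=\sum_{k=0}^{p}(-1)^{p-k}\binom{p}{k}H(kt),$$ which requires $H$ to be continuous up to $w=1$.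
   Formalization: The integrals over |u|=1 defining a_n(h) and H are taken over |u|=(1+R)/2 instead, since Ψ is only given for |w|>1 and need not extend to |u|=1; by Cauchy's theorem the values agree whenever the integrals over |u|=1 make sense. *)

(* Defs.v *)
(* The complex plane is  C := (R[i])^o  for an
   arbitrary  R : realType  (R[i] = complex numbers over R, from
   mathcomp-real-closed; the ^o alias gives it its normed-module structure
   over itself, so  derivable f z 1  is complex differentiability). *)
From mathcomp Require Import all_boot all_order all_algebra.
From mathcomp Require Import all_classical all_reals all_analysis.
From mathcomp Require Import complex.
Set Implicit Arguments. Unset Strict Implicit. Unset Printing Implicit Defensive.
Import Order.TTheory GRing.Theory Num.Theory ComplexField.
Import numFieldNormedType.Exports.
Local Open Scope ring_scope.
Local Open Scope classical_set_scope.
Local Open Scope complex_scope.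

Notation Cplx R := ((R[i])^o).

Definition expi {R : realType} (t : R) : Cplx R := (cos t +i* sin t).

Definition cint02pi {R : realType} (phi : R -> Cplx R) : Cplx R :=
  (Rintegral lebesgue_measure `[0%R, (2 * pi)%R] (fun t => complex.Re (phi t))) +i*
  (Rintegral lebesgue_measure `[0%R, (2 * pi)%R] (fun t => complex.Im (phi t))).

(* (1 / (2 pi i)) \oint_{|u| = rho} phi(u) du ,
   parametrized by u = rho e^{it}, du = i rho e^{it} dt *)
Definition circle_int {R : realType} (phi : Cplx R -> Cplx R) (rho : R) : Cplx R :=
  ((2 * pi)^-1)%:C * cint02pi (fun t => phi (rho%:C * expi t) * (rho%:C * expi t)).

(* Psi is the normalized exterior conformal map onto the complement of G:
   holomorphic and injective on |w| > 1, with image C \ G, and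
   Psi(infty) = infty, Psi'(infty) = lim_{w -> oo} Psi(w)/w = c > 0. *)
Definition exterior_conformal_map {R : realType} (G : set (Cplx R))
    (Psi : Cplx R -> Cplx R) : Prop :=
  [/\ (forall w : Cplx R, 1 < `|w| -> derivable Psi w 1),
      (forall w1 w2 : Cplx R, 1 < `|w1| -> 1 < `|w2| -> Psi w1 = Psi w2 -> w1 = w2),
      Psi @` [set w : Cplx R | 1 < `|w|] = ~` G &
      exists c : R, (0 < c)%R /\
        forall eps : R, (0 < eps)%R -> exists M : R, forall w : Cplx R,
          M%:C < `|w| -> `|Psi w / w - c%:C| < eps%:C].

Definition faber_polynomials {R : realType} (G : set (Cplx R))
    (Psi : Cplx R -> Cplx R) (F : nat -> {poly R[i]}) : Prop :=
  forall (z w : Cplx R), G z -> 1 < `|w| ->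
    series (fun n => ((F n).[z] / w ^+ n.+1 : Cplx R)) @ \oo
      --> ('D_1 Psi w / (Psi w - z) : Cplx R).

(* G_rho = interior of Gamma_rho = {Psi(w) : |w| = rho}
         = G  union  {Psi(w) : 1 < |w| < rho} *)
Definition level_domain {R : realType} (G : set (Cplx R))
    (Psi : Cplx R -> Cplx R) (rho : R) : set (Cplx R) :=
  G `|` Psi @` [set w : Cplx R | 1 < `|w| < rho%:C].

Definition faber_coef {R : realType} (Psi : Cplx R -> Cplx R)
    (h : Cplx R -> Cplx R) (rho : R) (n : nat) : Cplx R :=
  circle_int (fun u => h (Psi u) / u ^+ n.+1) rho.

Definition assoc_fun {R : realType} (Psi : Cplx R -> Cplx R)
    (h : Cplx R -> Cplx R) (rho : R) (w : Cplx R) : Cplx R :=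
  circle_int (fun u => h (Psi u) / (u - w)) rho.

(* The contour radius used for a_n(h) and H: any rho in (1, R) gives the same
   value (Cauchy); we fix rho = (1 + R)/2. *)
Definition contour_radius {R : realType} (Rr : R) : R := ((1 + Rr) / 2)%R.

Definition fwd_diff {R : realType} (H : Cplx R -> Cplx R) (t : R) (p : nat)
    : Cplx R :=
  \sum_(k < p.+1) ((-1) ^+ (p - k) * 'C(p, k)%:R * H ((k%:R * t)%R)%:C).

Definition bernstein_faber {R : realType} (F : nat -> {poly R[i]})
    (H : Cplx R -> Cplx R) (n : nat) (z : Cplx R) : Cplx R :=
  \sum_(p < n.+1) ('C(n, p)%:R * fwd_diff H (n%:R^-1)%R p * (F p).[z]).

(* Main.v *)
(* The Faber polynomial F_n(z) equals the integral over |w| = s of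
   w^n Psi'(w)/(Psi(w) - z): for z in G both sides are Laurent coefficients of
   the same function, and both are polynomials in z, so they agree inside the
   level curve of s because G is infinite. Hence |F_n| <= A s^n on the closed
   G_r whenever s > r, while the coefficients a_n(h) are O(rho^-n) for every
   rho < R. Dixon's argument yields Cauchy's formula for h with the kernel
   Psi'/(Psi - z), so that h = sum_k a_k(h) F_k on G_r; moreover
   H(x) = sum_k a_k(h) x^k on [0, 1].
   By linearity B_n(h) = sum_j a_j(h) B_n(e_j), where e_j stands for w^j. The
   coefficient of F_p in B_n(e_j) is an occupancy probability (see
   [bern_coef]): with q = j(j-1)/2 it is
   1 - q/n + O(j^4/n^2) for p = j, q/n + O(j^4/n^2) for p = j-1, and
   O(j^4/n^2) for all other p together. Summing against the geometric decay
   of a_j F_j gives B_n(h) = h + S(h) + O(1/n^2), where S(h) is the sum of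
   (k(k-1)/2n) a_k(h) (F_{k-1} - F_k) over k, and both claims follow from
     B_n(fg) - B_n(f) B_n(g) = d(fg) - f d(g) - g d(f) - d(f) d(g),
   d(h) = B_n(h) - h.
   Integrals over circles are compared through w = exp(zeta), which turns
   Cauchy's theorem on an annulus into Goursat's theorem on a rectangle. *)
Require Import Defs.
From mathcomp Require Import all_boot all_order all_algebra.
From mathcomp Require Import all_classical all_reals all_analysis.
From mathcomp Require Import complex.
From mathcomp Require Import ring lra.
Import Order.TTheory GRing.Theory Num.Theory ComplexField.
Import numFieldNormedType.Exports.
Local Open Scope ring_scope.
Local Open Scope classical_set_scope.
Local Open Scope complex_scope.

Set Implicit Arguments.
Unset Strict Implicit.
Unset Printing Implicit Defensive.
Import Normc.
Local Arguments normc {R} x : simpl never.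

(** * Complex numbers, limits and derivatives *)

Section ComplexModulus.
Variable R : realType.
Implicit Types (z w : Cplx R) (x y : R).

Lemma normrE_normc z : `|z| = (normc z)%:C. Proof. by []. Qed.

Lemma normc_ge0 z : 0 <= normc z.
Proof. by have := normr_ge0 (z : R[i]); rewrite normrE_normc ler0c. Qed.

Lemma normc_eq0 z : (normc z == 0) = (z == 0).
Proof. by rewrite -(inj_eq (@complexI R)) -normrE_normc normr_eq0. Qed.

Lemma normc_gt0 z : (0 < normc z) = (z != 0).
Proof. by rewrite lt_def normc_ge0 andbT normc_eq0. Qed.

Lemma normcD_le z w : normc (z + w) <= normc z + normc w.
Proof. exact: le_normcD. Qed.

Lemma normc_opp z : normc (- z) = normc z.
Proof. exact: normcN. Qed.

Lemma normc_sub z w : normc (z - w) = normc (w - z).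
Proof. by rewrite -normc_opp opprB. Qed.

Lemma normcB_le z w : normc (z - w) <= normc z + normc w.
Proof. by rewrite -(normc_opp w) normcD_le. Qed.

Lemma normcB_ge z w : normc z - normc w <= normc (z - w).
Proof. by rewrite lerBlDr (le_trans _ (normcD_le _ _))// subrK. Qed.

Lemma normcD_ge z w : normc z - normc w <= normc (z + w).
Proof. by have := normcB_ge z (- w); rewrite opprK normc_opp. Qed.

Lemma normcX z n : normc (z ^+ n) = normc z ^+ n.
Proof.
by elim: n => [|n IH]; rewrite ?expr0 ?normc1// !exprS normcM IH.
Qed.

Lemma normc_div z w : normc (z / w) = normc z / normc w.
Proof. by rewrite normcM normcV. Qed.

Lemma normc_real x : normc (x%:C : Cplx R) = `|x|.
Proof. by rewrite /normc/= expr0n addr0 sqrtr_sqr. Qed.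

Lemma normc_nat n : normc (n%:R : Cplx R) = n%:R.
Proof. by rewrite -(rmorph_nat (real_complex R)) normc_real ger0_norm. Qed.

Lemma normc_Re z : `|complex.Re z| <= normc z.
Proof. by rewrite -lecR -normrE_normc normc_ge_Re. Qed.

Lemma normc_i : normc ('i : Cplx R) = 1.
Proof. by rewrite /normc/= expr0n expr1n add0r sqrtr1. Qed.

Lemma normc_Im z : `|complex.Im z| <= normc z.
Proof.
have := normc_Re (z * 'i); rewrite normcM normc_i mulr1.
by rewrite ReiNIm normrN.
Qed.

Lemma normc_le_ReIm z : normc z <= `|complex.Re z| + `|complex.Im z|.
Proof.
rewrite {1}(complexE z) (le_trans (normcD_le _ _))//.
by rewrite normcM normc_i mul1r !normc_real.
Qed.

Lemma normc_expi x : normc (expi x : Cplx R) = 1.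
Proof. by rewrite /normc/= cos2Dsin2 sqrtr1. Qed.

Lemma expi0 : expi 0 = 1 :> Cplx R.
Proof. by rewrite /expi cos0 sin0. Qed.

Lemma expi2pi : expi (2 * pi) = 1 :> Cplx R.
Proof. by rewrite /expi mulr_natl cos2pi sin2pi. Qed.

Lemma expiD x y : expi (x + y) = expi x * expi y :> Cplx R.
Proof. by rewrite /expi cosD sinD; simpc; congr (_ +i* _); rewrite addrC. Qed.

End ComplexModulus.

Section ComplexTopology.
Variable R : realType.
Notation C := (Cplx R).

Lemma cvgcP {T : Type} {F : set_system T} {FF : Filter F} (f : T -> C) (l : C) :
  f x @[x --> F] --> l <->
  (forall e : R, 0 < e -> \forall x \near F, normc (f x - l) < e).
Proof.
rewrite cvgrPdistC_lt; split=> h e e0.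
  have /h : 0 < e%:C :> R[i] by rewrite ltcR.
  by apply: filterS => x; rewrite normrE_normc ltcR.
case: e e0 => e e'; rewrite ltcE /= => /andP[/eqP -> e0].
apply: filterS (h e e0) => x; by rewrite -(ltcR _ e) -normrE_normc.
Qed.

Lemma contcP {T : topologicalType} (f : T -> C) (t : T) :
  {for t, continuous f} <->
  (forall e : R, 0 < e -> \forall s \near t, normc (f s - f t) < e).
Proof. exact: (@cvgcP T (nbhs t)). Qed.

Lemma nbhscP (z : C) (P : set C) :
  nbhs z P <-> exists2 d : R, 0 < d & forall w : C, normc (w - z) < d -> P w.
Proof.
apply: (iff_trans (nbhs_normP z P)); split.
  case=> -[e e'] /=; rewrite ltcE /= => /andP[/eqP -> e0] h; exists e => // w wz.
  by apply: h; rewrite /ball_ /= -normrN opprB normrE_normc ltcR.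
case=> d d0 h; exists d%:C; first by rewrite /= ltcR.
by move=> w /=; rewrite -normrN opprB normrE_normc ltcR => /h.
Qed.

Lemma ccontP (f : C -> C) (z : C) : {for z, continuous f} <->
  forall e : R, 0 < e -> exists2 d : R, 0 < d &
    forall w : C, normc (w - z) < d -> normc (f w - f z) < e.
Proof.
split => [/contcP h e e0|h]; first by have /nbhscP := h e e0.
by apply/contcP => e e0; apply/nbhscP; exact: h.
Qed.

Lemma is_cderiveP (f : C -> C) (z l : C) : is_derive z 1 f l <->
  forall e : R, 0 < e -> exists2 d : R, 0 < d &
    forall h : C, normc h < d -> normc (f (z + h) - f z - l * h) <= e * normc h.
Proof.
have E : (h^-1 *: ((f \o shift z) (h *: (1 : C)) - f z) @[h --> (0 : C)^'] --> l) <->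
   forall e : R, 0 < e -> exists2 d : R, 0 < d &
    forall h : C, normc h < d -> normc (f (z + h) - f z - l * h) <= e * normc h.
  split.
    move=> /cvgcP H e e0.
    have /nbhscP[d d0 Hd] := H e e0.
    exists d => // h hd; have [->|h0] := eqVneq h 0.
      by rewrite addr0 subrr mulr0 subrr normc0 mulr0.
    have := Hd h; rewrite subr0 => /(_ hd h0) /=.
    have -> : (h^-1 *: (f (h *: (1:C) + z) - f z) - l : C)
      = (f (z + h) - f z - l * h) / h.
      rewrite [h *: 1](_ : _ = h); last by rewrite /GRing.scale /= mulr1.
      rewrite (addrC h) /GRing.scale /=; by field.
    by rewrite normc_div ltr_pdivrMr ?normc_gt0// => /ltW.
  move=> H; apply/cvgcP => e e0.
  have [//|d d0 Hd] := H (e / 2); first by rewrite divr_gt0.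
  apply/nbhscP; exists d => // h; rewrite subr0 => hd h0.
  rewrite /= [h *: 1](_ : _ = h); last by rewrite /GRing.scale /= mulr1.
  have -> : (h^-1 *: (f (h + z) - f z) - l : C)
      = (f (z + h) - f z - l * h) / h.
    rewrite (addrC h) /GRing.scale /=; by field.
  rewrite normc_div ltr_pdivrMr ?normc_gt0//.
  rewrite (le_lt_trans (Hd h hd))// ltr_pM2r ?normc_gt0//.
  by rewrite ltr_pdivrMr// ltr_pMr// ltr1n.
split.
  by move=> [df dl]; apply/E; move: df; rewrite /derivable -dl.
move=> /E h; split; first by apply/cvg_ex; exists l.
exact: cvg_lim h.
Qed.

(* An inductive wrapper: unifying bare [derivable] goals over [R[i]] unfolds
   the whole structure hierarchy. *)
Variant holo (f : C -> C) (z : C) : Prop := Holo of derivable f z 1.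

Lemma holoP (f : C -> C) (z : C) : holo f z <->
  exists l, forall e : R, 0 < e -> exists2 d : R, 0 < d &
    forall h : C, normc h < d -> normc (f (z + h) - f z - l * h) <= e * normc h.
Proof.
split=> [[/derivableP df]|[l /is_cderiveP[df _]]]; last by constructor.
by exists ('D_1 f z); apply/is_cderiveP.
Qed.

Lemma holo_is_derive (f : C -> C) (z : C) : holo f z ->
  is_derive z 1 f ('D_1 f z).
Proof. by move=> [/derivableP]. Qed.

Lemma holo_cont (f : C -> C) (z : C) : holo f z -> {for z, continuous f}.
Proof. by move=> [/derivable1_diffP /differentiable_continuous]. Qed.

Lemma holo_comp (f g : C -> C) (z : C) :
  holo f z -> holo g (f z) -> holo (fun w => g (f w)) z.
Proof.
move=> [/derivable1_diffP df] [/derivable1_diffP dg]; constructor.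
apply: (proj2 (@derivable1_diffP R[i] C (fun w => g (f w)) z)).
exact: (@differentiable_comp R[i] C C C f g z df dg).
Qed.

Lemma holoM (f g : C -> C) (z : C) :
  holo f z -> holo g z -> holo (fun w => f w * g w) z.
Proof. by move=> [df] [dg]; constructor; exact: (derivableM df dg). Qed.

Lemma holoV (f : C -> C) (z : C) : holo f z -> f z != 0 ->
  holo (fun w => (f w)^-1) z.
Proof. by move=> [df] f0; constructor; exact: (derivableV f0 df). Qed.

Lemma holo_div (f g : C -> C) (z : C) : holo f z -> holo g z -> g z != 0 ->
  holo (fun w => f w / g w) z.
Proof. by move=> df dg g0; exact: (holoM df (holoV dg g0)). Qed.

Lemma holoB (f g : C -> C) (z : C) :
  holo f z -> holo g z -> holo (fun w => f w - g w) z.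
Proof. by move=> [df] [dg]; constructor; exact: (derivableB df dg). Qed.

Lemma holoD (f g : C -> C) (z : C) :
  holo f z -> holo g z -> holo (fun w => f w + g w) z.
Proof. by move=> [df] [dg]; constructor; exact: (derivableD df dg). Qed.

Lemma holo_cst (a z : C) : holo (fun=> a) z.
Proof. by constructor; exact: derivable_cst. Qed.

Lemma holo_id (z : C) : holo (fun w : C => w) z.
Proof. by constructor; exact: derivable_id. Qed.

Lemma holoX (f : C -> C) (z : C) n : holo f z -> holo (fun w => f w ^+ n) z.
Proof.
move=> df; elim: n => [|n IH]; first exact: holo_cst.
have -> : (fun w => f w ^+ n.+1) = (fun w => f w * f w ^+ n).
  by apply/funext => w; rewrite exprS.
exact: holoM.
Qed.

Lemma near_eq_holo (f g : C -> C) (z : C) :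
  (\forall w \near z, f w = g w) -> holo f z -> holo g z.
Proof.
by move=> fg [df]; constructor; apply: near_eq_derivable df; rewrite ?oner_eq0.
Qed.

Lemma rcontP {T : topologicalType} (u : T -> R) (t : T) :
  {for t, continuous u} <->
  (forall e : R, 0 < e -> \forall s \near t, `|u s - u t| < e).
Proof. exact: (@cvgrPdistC_lt R R T (nbhs t)). Qed.

Lemma cont_complex {T : topologicalType} (u v : T -> R) (t : T) :
  {for t, continuous u} -> {for t, continuous v} ->
  {for t, continuous (fun s => (u s +i* v s) : C)}.
Proof.
move=> /rcontP cu /rcontP cv; apply/contcP => e e0.
have e2 : 0 < e / 2 by rewrite divr_gt0.
apply: filterS2 (cu _ e2) (cv _ e2) => s us vs.
by rewrite (le_lt_trans (normc_le_ReIm _))//= (splitr e) ltrD.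
Qed.

Lemma cont_Re {T : topologicalType} (f : T -> C) (t : T) :
  {for t, continuous f} -> {for t, continuous (fun s => complex.Re (f s))}.
Proof.
move=> /contcP h; apply/rcontP => e e0; apply: filterS (h e e0) => s hs.
rewrite (le_lt_trans _ hs)// (le_trans _ (normc_Re _))//.
by case: (f s) (f t) => [a b] [c d].
Qed.

Lemma cont_Im {T : topologicalType} (f : T -> C) (t : T) :
  {for t, continuous f} -> {for t, continuous (fun s => complex.Im (f s))}.
Proof.
move=> /contcP h; apply/rcontP => e e0; apply: filterS (h e e0) => s hs.
rewrite (le_lt_trans _ hs)// (le_trans _ (normc_Im _))//.
by case: (f s) (f t) => [a b] [c d].
Qed.

Lemma cont_normc {T : topologicalType} (f : T -> C) (t : T) :
  {for t, continuous f} -> {for t, continuous (fun s => normc (f s))}.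
Proof.
move=> /contcP h; apply/rcontP => e e0; apply: filterS (h e e0) => s hs.
rewrite (le_lt_trans _ hs)// ler_norml; apply/andP; split.
  by rewrite normc_sub; have := normcB_ge (f t) (f s); lra.
exact: normcB_ge.
Qed.

Lemma cont_expi (t : R) : {for t, continuous (fun s => expi s : C)}.
Proof. by apply: cont_complex; [exact: continuous_cos|exact: continuous_sin]. Qed.

End ComplexTopology.

Section ContinuousAlgebra.
Variables (R : realType) (T : topologicalType).
Notation C := (Cplx R).
Implicit Types (f g : T -> C) (t : T).

Lemma cont_cst (a : C) t : {for t, continuous (fun _ : T => a)}.
Proof. exact: (@cst_continuous T C a t). Qed.

Lemma contD f g t : {for t, continuous f} -> {for t, continuous g} ->
  {for t, continuous (fun s => f s + g s)}.
Proof. by move=> cf cg; exact: (@continuousD R[i] C T f g t cf cg). Qed.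

Lemma contN f t : {for t, continuous f} -> {for t, continuous (fun s => - f s)}.
Proof. by move=> cf; exact: (@continuousN R[i] C T f t cf). Qed.

Lemma contB f g t : {for t, continuous f} -> {for t, continuous g} ->
  {for t, continuous (fun s => f s - g s)}.
Proof. by move=> cf cg; exact: (@continuousB R[i] C T f g t cf cg). Qed.

Lemma contM f g t : {for t, continuous f} -> {for t, continuous g} ->
  {for t, continuous (fun s => f s * g s)}.
Proof. by move=> cf cg; exact: (@continuousM R[i] T f g t cf cg). Qed.

Lemma contV f t : f t != 0 -> {for t, continuous f} ->
  {for t, continuous (fun s => (f s)^-1)}.
Proof. by move=> f0 cf; exact: (@continuousV R[i] T f t f0 cf). Qed.

Lemma contX f t n : {for t, continuous f} ->
  {for t, continuous (fun s => f s ^+ n)}.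
Proof.
move=> cf; elim: n => [|n IH]; first exact: cont_cst.
have -> : (fun s => f s ^+ n.+1) = (fun s => f s * f s ^+ n).
  by apply/funext => w; rewrite exprS.
exact: contM.
Qed.

Lemma cont_comp (h : C -> C) f t : {for t, continuous f} ->
  {for f t, continuous h} -> {for t, continuous (fun s => h (f s))}.
Proof. by move=> cf ch; exact: (continuous_comp cf ch). Qed.

End ContinuousAlgebra.

(** * Complex integrals and Goursat's theorem *)

Section ComplexIntegral.
Variable R : realType.
Notation C := (Cplx R).
Notation mu := (@lebesgue_measure R).

Definition cint (a b : R) (phi : R -> C) : C :=
  (Rintegral mu `[a, b] (fun t => complex.Re (phi t))) +i*
  (Rintegral mu `[a, b] (fun t => complex.Im (phi t))).

Local Arguments cint : simpl never.

Definition pcont (T : topologicalType) (a b : R) (phi : R -> T) :=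
  forall t, a <= t <= b -> {for t, continuous phi}.

Lemma pcont_integrable (a b : R) (u : R -> R) : pcont a b u ->
  mu.-integrable `[a, b] (EFin \o u).
Proof.
move=> cu; apply: continuous_compact_integrable; first exact: segment_compact.
apply: continuous_in_subspaceT => t; rewrite inE/= in_itv/= => tab.
exact: (cu t tab).
Qed.

Lemma pcont_Re a b (phi : R -> C) : pcont a b phi ->
  pcont a b (fun t => complex.Re (phi t)).
Proof. by move=> c t /c h; exact: cont_Re. Qed.

Lemma pcont_Im a b (phi : R -> C) : pcont a b phi ->
  pcont a b (fun t => complex.Im (phi t)).
Proof. by move=> c t /c h; exact: cont_Im. Qed.

Lemma pcontD a b (phi psi : R -> C) : pcont a b phi -> pcont a b psi ->
  pcont a b (fun t => phi t + psi t).
Proof. by move=> c d t tab; exact: (contD (c t tab) (d t tab)). Qed.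

Lemma pcontM a b (phi psi : R -> C) : pcont a b phi -> pcont a b psi ->
  pcont a b (fun t => phi t * psi t).
Proof. by move=> c d t tab; exact: (contM (c t tab) (d t tab)). Qed.

Lemma pcontB a b (phi psi : R -> C) : pcont a b phi -> pcont a b psi ->
  pcont a b (fun t => phi t - psi t).
Proof. by move=> c d t tab; exact: (contB (c t tab) (d t tab)). Qed.

Lemma pcont_cst a b (k : C) : pcont a b (fun=> k).
Proof. by move=> t _; exact: cont_cst. Qed.

Lemma pcontV a b (phi : R -> C) : (forall t, a <= t <= b -> phi t != 0) ->
  pcont a b phi -> pcont a b (fun t => (phi t)^-1).
Proof. by move=> p0 c t tab; exact: (contV (p0 t tab) (c t tab)). Qed.

Lemma pcontX a b (phi : R -> C) n : pcont a b phi ->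
  pcont a b (fun t => phi t ^+ n).
Proof. by move=> c t tab; exact: (contX (c t tab)). Qed.

Lemma eq_cint a b (phi psi : R -> C) :
  (forall t, a <= t <= b -> phi t = psi t) -> cint a b phi = cint a b psi.
Proof.
move=> e; congr (_ +i* _); apply: eq_Rintegral => t;
  by rewrite inE /= in_itv /= => /e ->.
Qed.

Lemma cintD a b (phi psi : R -> C) : pcont a b phi -> pcont a b psi ->
  cint a b (fun t => phi t + psi t) = cint a b phi + cint a b psi.
Proof.
move=> cp cq; rewrite /cint.
rewrite [RHS](_ : _ =
  (Rintegral mu `[a, b] (fun t => complex.Re (phi t)) +
   Rintegral mu `[a, b] (fun t => complex.Re (psi t))) +i*
  (Rintegral mu `[a, b] (fun t => complex.Im (phi t)) +
   Rintegral mu `[a, b] (fun t => complex.Im (psi t)))); last by [].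
rewrite -!RintegralD//; try (by apply: pcont_integrable; exact: pcont_Re);
  try (by apply: pcont_integrable; exact: pcont_Im).
by congr (_ +i* _); apply: eq_Rintegral => t _; case: (phi t) (psi t) => ? ? [].
Qed.

Lemma cintZ a b (k : C) (phi : R -> C) : pcont a b phi ->
  cint a b (fun t => k * phi t) = k * cint a b phi.
Proof.
move=> cp; case: k => x y.
have iR := pcont_integrable (pcont_Re cp).
have iI := pcont_integrable (pcont_Im cp).
have iZ (c : R) (u : R -> R) : mu.-integrable `[a, b] (EFin \o u) ->
    mu.-integrable `[a, b] (EFin \o (fun t => c * u t)).
  by move=> iu; exact: (integrableZl _ c iu).
rewrite /cint.
rewrite [RHS](_ : _ =
  (x * Rintegral mu `[a, b] (fun t => complex.Re (phi t)) -
   y * Rintegral mu `[a, b] (fun t => complex.Im (phi t))) +i*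
  (x * Rintegral mu `[a, b] (fun t => complex.Im (phi t)) +
   y * Rintegral mu `[a, b] (fun t => complex.Re (phi t)))); last by [].
rewrite -!RintegralZl// -RintegralB//; try exact: iZ.
rewrite -RintegralD//; try exact: iZ.
by congr (_ +i* _); apply: eq_Rintegral => t _; case: (phi t).
Qed.

Lemma cintN a b (phi : R -> C) : pcont a b phi ->
  cint a b (fun t => - phi t) = - cint a b phi.
Proof.
move=> cp; rewrite -mulN1r -(cintZ (-1) cp).
by apply: eq_cint => t _; rewrite mulN1r.
Qed.

Lemma cintB a b (phi psi : R -> C) : pcont a b phi -> pcont a b psi ->
  cint a b (fun t => phi t - psi t) = cint a b phi - cint a b psi.
Proof.
move=> cp cq.
have cN : pcont a b (fun t => - psi t) by move=> t tab; exact: (contN (cq t tab)).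
by rewrite -(cintN cq) -(cintD cp cN).
Qed.

Lemma cint_cst a b (k : C) : a <= b -> cint a b (fun=> k) = k * (b - a)%:C.
Proof.
move=> ab; rewrite /cint !Rintegral_cst//= lebesgue_measure_itv /= lte_fin.
have -> : (if a < b then (b%:E - a%:E)%E else 0%E) = (b - a)%:E :> \bar R.
  by case: ltgtP ab => // -> _; rewrite subrr.
by case: k => x y /=; simpc.
Qed.

Lemma cint_le a b (phi : R -> C) (M : R) : a <= b -> pcont a b phi ->
  (forall t, a <= t <= b -> normc (phi t) <= M) ->
  normc (cint a b phi) <= 2 * M * (b - a).
Proof.
move=> ab cp leM.
have aux (u : R -> R) : pcont a b u ->
    (forall t, a <= t <= b -> `|u t| <= M) ->
    `|Rintegral mu `[a, b] u| <= M * (b - a).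
  move=> cu uM; have iu := pcont_integrable cu.
  rewrite (le_trans (le_normr_Rintegral _ iu))//.
  have -> : M * (b - a) = Rintegral mu `[a, b] (fun=> M).
    rewrite Rintegral_cst//= lebesgue_measure_itv /= lte_fin.
    by case: ltgtP ab => // -> _; rewrite subrr mulr0.
  apply: le_Rintegral => //.
  - exact: integrable_norm iu.
  - by apply: pcont_integrable => t _; exact: (@cst_continuous R R M t).
have := normc_le_ReIm (cint a b phi) => /le_trans; apply.
rewrite -mulrA [2 * _](mulr_natl _ 2) mulr2n lerD//=; apply: aux.
- exact: pcont_Re.
- by move=> t tab; rewrite (le_trans (normc_Re _))// leM.
- exact: pcont_Im.
- by move=> t tab; rewrite (le_trans (normc_Im _))// leM.
Qed.

Lemma cint_split a m b (phi : R -> C) : a <= m <= b -> pcont a b phi ->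
  cint a b phi = cint a m phi + cint m b phi.
Proof.
move=> /andP[am mb] cp.
have aux (u : R -> R) : pcont a b u -> Rintegral mu `[a, b] u =
    Rintegral mu `[a, m] u + Rintegral mu `[m, b] u.
  move=> cu; have iu := pcont_integrable cu.
  rewrite -[X in _ = _ + X]Rintegral_itv_obnd_cbnd; last first.
    apply: integrableS iu => //; move=> t.
    rewrite /= !in_itv /= => /andP[mt tb].
    by rewrite tb (le_trans am (ltW mt)).
  have := @Rintegral_itvB R u (BLeft a) (BRight b) m iu.
  by rewrite !bnd_simp => /(_ am mb) <-; rewrite addrC subrK.
by rewrite /cint !aux//; [exact: pcont_Im|exact: pcont_Re].
Qed.

Lemma cint_sum a b n (phi : nat -> R -> C) :
  (forall i, (i < n)%N -> pcont a b (phi i)) ->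
  cint a b (fun t => \sum_(i < n) phi i t) = \sum_(i < n) cint a b (phi i).
Proof.
elim: n => [|n IH] c.
  rewrite big_ord0 (_ : (fun _ => _) = (fun t => 0 * 0)); last first.
    by apply/funext => t; rewrite big_ord0 mulr0.
  by rewrite (cintZ 0 (@pcont_cst a b 0)) mul0r.
have cn : pcont a b (fun t => \sum_(i < n) phi i t).
  elim: n c {IH} => [|n IH] c.
    have -> : (fun t => \sum_(i < 0) phi i t) = (fun=> 0).
      by apply/funext => t; rewrite big_ord0.
    exact: pcont_cst.
  have -> : (fun t => \sum_(i < n.+1) phi i t) =
      (fun t => \sum_(i < n) phi i t + phi n t).
    by apply/funext => t; rewrite big_ord_recr.
  by apply: pcontD; [apply: IH => i ni; apply: c; exact: ltnW|apply: c].
rewrite big_ord_recr /= -IH; last by move=> i ni; apply: c; exact: ltnW.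
rewrite -(cintD cn (c n (ltnSn n))).
by apply: eq_cint => t _; rewrite big_ord_recr.
Qed.

Lemma cint_cvg {I : Type} {F : set_system I} {FF : Filter F} a b
    (phi : I -> R -> C) (psi : R -> C) : a <= b ->
  (\forall i \near F, pcont a b (phi i)) -> pcont a b psi ->
  (forall e : R, 0 < e -> \forall i \near F,
     forall t, a <= t <= b -> normc (phi i t - psi t) <= e) ->
  cint a b (phi i) @[i --> F] --> cint a b psi.
Proof.
move=> ab cp cq h; apply/cvgcP => e e0.
have d0 : 0 < e / (2 * (b - a + 1)).
  by rewrite divr_gt0// mulr_gt0// ltr_pwDr// subr_ge0.
apply: filterS2 cp (h _ d0) => i ci hi.
rewrite -(cintB ci cq) (le_lt_trans (cint_le ab (pcontB ci cq) hi))//.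
have c0 : 0 < b - a + 1 by rewrite ltr_pwDr// subr_ge0.
rewrite (_ : _ * _ = e * ((b - a) / (b - a + 1))).
  by rewrite gtr_pMr// ltr_pdivrMr// mul1r ltrDl.
by field; rewrite gt_eqF.
Qed.

Lemma cint_FTC a b (Phi phi : R -> C) : a < b -> pcont a b phi ->
  (forall t, a <= t <= b ->
    is_derive t 1 (fun s => complex.Re (Phi s)) (complex.Re (phi t)) /\
    is_derive t 1 (fun s => complex.Im (Phi s)) (complex.Im (phi t))) ->
  cint a b phi = Phi b - Phi a.
Proof.
move=> ab cp dP.
have aux (U u : R -> R) : pcont a b u ->
    (forall t, a <= t <= b -> is_derive t 1 U (u t)) ->
    Rintegral mu `[a, b] u = U b - U a.
  move=> cu dU; rewrite /Rintegral (@continuous_FTC2 _ u U a b)//.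
  - apply: continuous_in_subspaceT => t; rewrite inE/= in_itv/= => tab.
    exact: (cu t tab).
  - have cU t : a <= t <= b -> {for t, continuous U}.
      move=> /dU[dt _]; apply: differentiable_continuous.
      by apply/derivable1_diffP.
    split.
    + move=> t; rewrite in_itv /= => /andP[at_ tb].
      by have [] := dU t; rewrite ?(ltW at_) ?(ltW tb).
    + by apply: cvg_at_right_filter; apply: cU; rewrite lexx ltW.
    + by apply: cvg_at_left_filter; apply: cU; rewrite lexx ltW.
  - move=> t; rewrite in_itv /= => /andP[at_ tb].
    by rewrite derive1E; have [] := dU t; rewrite ?(ltW at_) ?(ltW tb).
have e1 : forall t, a <= t <= b ->
    is_derive t 1 (fun s => complex.Re (Phi s)) (complex.Re (phi t)).
  by move=> t /dP[].
have e2 : forall t, a <= t <= b ->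
    is_derive t 1 (fun s => complex.Im (Phi s)) (complex.Im (phi t)).
  by move=> t /dP[].
have := aux _ _ (pcont_Re cp) e1; have := aux _ _ (pcont_Im cp) e2.
by rewrite /cint => -> ->; case: (Phi b) (Phi a) => ? ? [].
Qed.

End ComplexIntegral.
Local Arguments cint {R} a b phi : simpl never.

Section PathDerivative.
Variable R : realType.
Notation C := (Cplx R).

Definition path_derive (gam : R -> C) (t : R) (v : C) := forall e : R, 0 < e ->
  exists2 d : R, 0 < d & forall h : R, `|h| < d ->
    normc (gam (t + h) - gam t - h%:C * v) <= e * `|h|.

Lemma is_deriveRP (u : R -> R) (t l : R) : is_derive t 1 u l <->
  forall e : R, 0 < e -> exists2 d : R, 0 < d &
    forall h, `|h| < d -> `|u (t + h) - u t - l * h| <= e * `|h|.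
Proof.
have E : (h^-1 *: ((u \o shift t) (h *: (1 : R)) - u t) @[h --> (0 : R)^'] --> l) <->
   forall e : R, 0 < e -> exists2 d : R, 0 < d &
    forall h, `|h| < d -> `|u (t + h) - u t - l * h| <= e * `|h|.
  have F h : h != 0 -> h^-1 *: ((u \o shift t) (h *: (1 : R)) - u t) - l
      = (u (t + h) - u t - l * h) / h.
    by move=> h0; rewrite /= /GRing.scale /= mulr1 (addrC h); field.
  split.
    move=> /cvgrPdistC_lt H e e0.
    have /nbhs_normP[d d0 Hd] := H e e0.
    exists d => // h hd; have [->|h0] := eqVneq h 0.
      by rewrite addr0 subrr mulr0 subrr normr0 mulr0.
    have := Hd h; rewrite /ball_ /= sub0r normrN => /(_ hd h0) /=.
    by rewrite F// normf_div ltr_pdivrMr ?normr_gt0// => /ltW.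
  move=> H; apply/cvgrPdistC_lt => e e0.
  have [//|d d0 Hd] := H (e / 2); first by rewrite divr_gt0.
  apply/nbhs_normP; exists d => // h; rewrite /ball_ /= sub0r normrN => hd h0.
  rewrite F// normf_div ltr_pdivrMr ?normr_gt0//.
  rewrite (le_lt_trans (Hd h hd))// ltr_pM2r ?normr_gt0//.
  by rewrite ltr_pdivrMr// ltr_pMr// ltr1n.
split.
  by move=> [df dl]; apply/E; move: df; rewrite /derivable -dl.
move=> /E h; split; first by apply/cvg_ex; exists l.
exact: cvg_lim h.
Qed.

Lemma path_deriveP (gam : R -> C) (t : R) (v : C) : path_derive gam t v <->
  is_derive t 1 (fun s => complex.Re (gam s)) (complex.Re v) /\
  is_derive t 1 (fun s => complex.Im (gam s)) (complex.Im v).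
Proof.
split=> [H|[/is_deriveRP H1 /is_deriveRP H2]].
  split; apply/is_deriveRP => e /H[d d0 Hd]; exists d => // h /Hd.
    apply: le_trans; apply: le_trans (normc_Re _).
    case: (gam _) (gam t) v {H Hd} => [a b] [c d'] [v1 v2] /=.
    by rewrite mul0r subr0 mulrC.
  apply: le_trans; apply: le_trans (normc_Im _).
  case: (gam _) (gam t) v {H Hd} => [a b] [c d'] [v1 v2] /=.
  by rewrite mul0r addr0 mulrC.
move=> e e0; have e2 : 0 < e / 2 by rewrite divr_gt0.
have [d1 d10 Hd1] := H1 _ e2; have [d2 d20 Hd2] := H2 _ e2.
exists (Num.min d1 d2); first by rewrite lt_min d10.
move=> h; rewrite lt_min => /andP[/Hd1 h1 /Hd2 h2].
rewrite (le_trans (normc_le_ReIm _))// (splitr e) mulrDl lerD//.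
  move: h1; apply: le_trans; rewrite le_eqVlt; apply/orP; left; apply/eqP.
  congr (`| _ |); case: (gam _) (gam t) v {H1 H2 Hd1 Hd2 h2} => [a b] [c d'] [v1 v2] /=.
  by rewrite mul0r subr0 mulrC.
move: h2; apply: le_trans; rewrite le_eqVlt; apply/orP; left; apply/eqP.
congr (`| _ |); case: (gam _) (gam t) v {H1 H2 Hd1 Hd2 h1} => [a b] [c d'] [v1 v2] /=.
by rewrite mul0r addr0 mulrC.
Qed.

Lemma path_derive_comp (f : C -> C) (gam : R -> C) (t : R) (l v : C) :
  is_derive (gam t) 1 f l -> path_derive gam t v ->
  path_derive (fun s => f (gam s)) t (l * v).
Proof.
move=> /is_cderiveP Hf Hg e e0.
pose V := normc v + 1; have V0 : 0 < V by rewrite ltr_wpDl// normc_ge0.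
pose L := normc l + 1; have L0 : 0 < L by rewrite ltr_wpDl// normc_ge0.
have e1 : 0 < e / (2 * V) by rewrite divr_gt0// mulr_gt0.
have e2 : 0 < Num.min 1 (e / (2 * L)) by rewrite lt_min ltr01 divr_gt0// mulr_gt0.
have [d1 d10 H1] := Hf _ e1; have [d2 d20 H2] := Hg _ e2.
exists (Num.min d2 (d1 / V)); first by rewrite lt_min d20 divr_gt0.
move=> h; rewrite lt_min => /andP[hd2 hd1].
have hg := H2 _ hd2.
have h0 : 0 <= `|h| by [].
have hV : normc (gam (t + h) - gam t) <= V * `|h|.
  rewrite -(subrK (h%:C * v) (gam _ - _)) (le_trans (normcD_le _ _))//.
  rewrite normcM normc_real (mulrDl (normc v)) addrC (mulrC `|h|) lerD2l.
  by rewrite (le_trans hg)// ler_wpM2r// ge_min lexx.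
have := H1 (gam (t + h) - gam t); rewrite subrKC => /(_ _)/wrap[|hf].
  by rewrite (le_lt_trans hV)// mulrC -ltr_pdivlMr.
have -> : f (gam (t + h)) - f (gam t) - h%:C * (l * v) =
   (f (gam (t + h)) - f (gam t) - l * (gam (t + h) - gam t)) +
   l * (gam (t + h) - gam t - h%:C * v) by ring.
rewrite (le_trans (normcD_le _ _))// normcM (splitr e) mulrDl lerD//.
  rewrite (le_trans hf)// (le_trans (ler_wpM2l (ltW e1) hV))//.
  by rewrite mulrA ler_wpM2r// le_eqVlt; apply/orP; left; apply/eqP; field; rewrite gt_eqF.
rewrite (le_trans (ler_wpM2l (normc_ge0 _) hg))// mulrA ler_wpM2r//.
have lL : normc l <= L by rewrite lerDl.
rewrite (le_trans (ler_pM (normc_ge0 _) (ltW e2) lL (lexx _)))//.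
have mL : Num.min 1 (e / (2 * L)) <= e / (2 * L) by rewrite ge_min lexx orbT.
rewrite (le_trans (ler_wpM2l (ltW L0) mL))// le_eqVlt; apply/orP; left; apply/eqP.
by field; rewrite gt_eqF.
Qed.

Lemma path_derive_affine (k m : C) (t : R) :
  path_derive (fun s => k + s%:C * m) t m.
Proof.
move=> e e0; exists 1 => // h _.
have -> : k + (t + h)%:C * m - (k + t%:C * m) - h%:C * m = 0.
  by rewrite rmorphD /=; ring.
by rewrite normc0 mulr_ge0// ltW.
Qed.

Lemma cint_FTC_path a b (Phi phi : R -> C) : a < b -> pcont a b phi ->
  (forall t, a <= t <= b -> path_derive Phi t (phi t)) ->
  cint a b phi = Phi b - Phi a.
Proof.
by move=> ab cp dP; apply: cint_FTC => // t /dP /path_deriveP.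
Qed.

End PathDerivative.

Section Goursat.
Variable R : realType.
Notation C := (Cplx R).

Definition rectint (Q : C -> C) (a b c d : R) : C :=
  cint a b (fun x => Q (x +i* c)) - cint a b (fun x => Q (x +i* d)) +
  'i * cint c d (fun y => Q (b +i* y)) - 'i * cint c d (fun y => Q (a +i* y)).

Local Arguments rectint : simpl never.

Definition holo_rect (Q : C -> C) (a b c d : R) :=
  forall x y, a <= x <= b -> c <= y <= d -> holo Q (x +i* y).

Lemma le_refl2 (y : R) : y <= y <= y.
Proof. by rewrite lexx. Qed.

Lemma cont_horizontal (c t : R) : {for t, continuous (fun x => (x +i* c) : C)}.
Proof.
apply: cont_complex; first exact: (@cvg_id _ (nbhs t)).
exact: (@cst_continuous R R c t).
Qed.

Lemma cont_vertical (c t : R) : {for t, continuous (fun y => (c +i* y) : C)}.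
Proof.
apply: cont_complex; last exact: (@cvg_id _ (nbhs t)).
exact: (@cst_continuous R R c t).
Qed.

Section Edges.
Variables (Q : C -> C) (a b c d : R).
Hypothesis cQ : forall x y, a <= x <= b -> c <= y <= d ->
  {for (x +i* y) : C, continuous Q}.

Lemma pcont_horizontal y : c <= y <= d -> pcont a b (fun x => Q (x +i* y)).
Proof.
move=> cyd x xab.
exact: (cont_comp (cont_horizontal (c := y) (t := x)) (cQ xab cyd)).
Qed.

Lemma pcont_vertical x : a <= x <= b -> pcont c d (fun y => Q (x +i* y)).
Proof.
move=> xab y cyd.
exact: (cont_comp (cont_vertical (c := x) (t := y)) (cQ xab cyd)).
Qed.

Lemma rectint_splitx m : c <= d -> a <= m <= b ->
  rectint Q a b c d = rectint Q a m c d + rectint Q m b c d.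
Proof.
move=> cd amb; rewrite /rectint.
rewrite (@cint_split _ a m b)//; last by apply: pcont_horizontal; rewrite lexx.
rewrite (@cint_split _ a m b _ amb); last by apply: pcont_horizontal; rewrite lexx cd.
by ring.
Qed.

Lemma rectint_splity m : a <= b -> c <= m <= d ->
  rectint Q a b c d = rectint Q a b c m + rectint Q a b m d.
Proof.
move=> ab cmd; rewrite /rectint.
rewrite (@cint_split _ c m d _ cmd); last by apply: pcont_vertical; rewrite lexx ab.
rewrite (@cint_split _ c m d _ cmd); last by apply: pcont_vertical; rewrite lexx ab.
by ring.
Qed.

End Edges.

Lemma rectint_affine (k l : C) a b c d : a < b -> c < d ->
  rectint (fun z => k + l * z) a b c d = 0.
Proof.
move=> ab cd; pose P : C -> C := fun z => k * z + l / 2 * z ^+ 2.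
have dP (z : C) : is_derive z 1 P (k + l * z).
  apply/is_cderiveP => e e0; exists (e / (normc (l / 2) + 1)).
    by rewrite divr_gt0// ltr_wpDl// normc_ge0.
  move=> h; rewrite ltr_pdivlMr ?ltr_wpDl ?normc_ge0// => hd.
  have -> : P (z + h) - P z - (k + l * z) * h = l / 2 * h * h by rewrite /P; field.
  rewrite !normcM ler_wpM2r ?normc_ge0// (le_trans _ (ltW hd))// mulrC.
  by rewrite -normcM ler_wpM2l ?normc_ge0// lerDl.
have cP z : {for z, continuous (fun z : C => k + l * z)}.
  apply: holo_cont; exact: (holoD (holo_cst k z) (holoM (holo_cst l z) (holo_id z))).
have H y : cint a b (fun x => k + l * (x +i* y)) = P (b +i* y) - P (a +i* y).
  apply: (cint_FTC_path (Phi := fun x => P (x +i* y))) => //.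
    exact: (@pcont_horizontal _ a b y y (fun x y _ _ => cP _) y (le_refl2 y)).
  move=> t _; rewrite -[X in path_derive _ _ X]mulr1.
  apply: (@path_derive_comp _ P (fun x => x +i* y)) => //.
  have -> : (fun x => x +i* y) = (fun x => 0 +i* y + x%:C * 1) :> (R -> C).
    by apply/funext => x; simpc.
  exact: path_derive_affine.
have V x : 'i * cint c d (fun y => k + l * (x +i* y)) = P (x +i* d) - P (x +i* c).
  rewrite -cintZ; last first.
    exact: (@pcont_vertical _ x x c d (fun x y _ _ => cP _) x (le_refl2 x)).
  apply: (cint_FTC_path (Phi := fun y => P (x +i* y))) => //.
    apply: pcontM; first exact: pcont_cst.
    exact: (@pcont_vertical _ x x c d (fun x y _ _ => cP _) x (le_refl2 x)).
  move=> t _; rewrite mulrC.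
  apply: (@path_derive_comp _ P (fun y => x +i* y)) => //.
  have -> : (fun y => x +i* y) = (fun y => x%:C + y%:C * 'i) :> (R -> C).
    by apply/funext => y; simpc.
  exact: path_derive_affine.
by rewrite /rectint !H !V; ring.
Qed.

Lemma rectintD (Q P : C -> C) a b c d : a <= b -> c <= d ->
  (forall x y, a <= x <= b -> c <= y <= d -> {for (x +i* y) : C, continuous Q}) ->
  (forall x y, a <= x <= b -> c <= y <= d -> {for (x +i* y) : C, continuous P}) ->
  rectint (fun z => Q z + P z) a b c d = rectint Q a b c d + rectint P a b c d.
Proof.
move=> ab cd cQ cP; rewrite /rectint.
have hc : c <= c <= d by rewrite lexx.
have hd : c <= d <= d by rewrite lexx cd.
have ha : a <= a <= b by rewrite lexx.
have hb : a <= b <= b by rewrite lexx ab.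
rewrite (cintD (pcont_horizontal cQ hc) (pcont_horizontal cP hc)).
rewrite (cintD (pcont_horizontal cQ hd) (pcont_horizontal cP hd)).
rewrite (cintD (pcont_vertical cQ ha) (pcont_vertical cP ha)).
rewrite (cintD (pcont_vertical cQ hb) (pcont_vertical cP hb)).
by ring.
Qed.

Lemma rectint_le (Q : C -> C) a b c d M : a <= b -> c <= d ->
  (forall x y, a <= x <= b -> c <= y <= d -> {for (x +i* y) : C, continuous Q}) ->
  (forall x y, a <= x <= b -> c <= y <= d -> normc (Q (x +i* y)) <= M) ->
  normc (rectint Q a b c d) <= 4 * M * ((b - a) + (d - c)).
Proof.
move=> ab cd cQ MQ; rewrite /rectint.
have hc : c <= c <= d by rewrite lexx.
have hd : c <= d <= d by rewrite lexx cd.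
have ha : a <= a <= b by rewrite lexx.
have hb : a <= b <= b by rewrite lexx ab.
rewrite (le_trans (normcB_le _ _))// normcM normc_i mul1r.
have -> : 4 * M * ((b - a) + (d - c)) =
  2 * M * (b - a) + 2 * M * (b - a) + 2 * M * (d - c) + 2 * M * (d - c) by ring.
rewrite lerD//; last first.
  by apply: cint_le (pcont_vertical cQ ha) _ => // t tcd; exact: MQ.
rewrite (le_trans (normcD_le _ _))// normcM normc_i mul1r lerD//; last first.
  by apply: cint_le (pcont_vertical cQ hb) _ => // t tcd; exact: MQ.
rewrite (le_trans (normcB_le _ _))// lerD//.
  by apply: cint_le (pcont_horizontal cQ hc) _ => // t tcd; exact: MQ.
by apply: cint_le (pcont_horizontal cQ hd) _ => // t tcd; exact: MQ.
Qed.

Lemma holo_rect_cont Q a b c d : holo_rect Q a b c d ->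
  forall x y, a <= x <= b -> c <= y <= d -> {for (x +i* y) : C, continuous Q}.
Proof. by move=> h x y xab ycd; exact: holo_cont (h x y xab ycd). Qed.

Lemma rectint_local Q x0 y0 e : holo Q (x0 +i* y0) -> 0 < e ->
  exists2 del : R, 0 < del & forall a b c d, a < b -> c < d ->
    a <= x0 <= b -> c <= y0 <= d -> (b - a) + (d - c) < del ->
    holo_rect Q a b c d ->
    normc (rectint Q a b c d) <= 4 * e * ((b - a) + (d - c)) ^+ 2.
Proof.
move=> /holoP[l Hl] e0; have [del del0 H] := Hl _ e0.
exists del => // a b c d ab cd xab ycd small hQ.
set z0 : C := x0 +i* y0.
pose P : C -> C := fun z => (Q z0 - l * z0) + l * z.
have cP (z : C) : {for z, continuous P}.
  apply: holo_cont.
  exact: (holoD (holo_cst _ z) (holoM (holo_cst l z) (holo_id z))).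
have cQ := holo_rect_cont hQ.
have cE x y : a <= x <= b -> c <= y <= d ->
    {for (x +i* y) : C, continuous (fun z => Q z - P z)}.
  by move=> hx hy; exact: (contB (cQ x y hx hy) (cP (x +i* y))).
have -> : rectint Q a b c d = rectint (fun z => Q z - P z) a b c d.
  rewrite -[RHS]addr0 -(rectint_affine (Q z0 - l * z0) l ab cd).
  rewrite -(rectintD (ltW ab) (ltW cd) cE (fun x y _ _ => cP _)).
  have -> // : (fun z => Q z - P z + P z) = Q.
  by apply/funext => z; rewrite subrK.
set s := (b - a) + (d - c).
have -> : 4 * e * s ^+ 2 = 4 * (e * s) * s by ring.
apply: (rectint_le (ltW ab) (ltW cd) cE) => x y xab' ycd'.
have zs : normc ((x +i* y : C) - z0) <= s.
  rewrite (le_trans (normc_le_ReIm _))//= /s lerD// ler_norml; lra.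
have -> : Q (x +i* y) - P (x +i* y) =
    Q (z0 + ((x +i* y : C) - z0)) - Q z0 - l * ((x +i* y : C) - z0).
  by rewrite subrKC /P; ring.
rewrite (le_trans (H _ (le_lt_trans zs small)))//.
by rewrite ler_wpM2l// ltW.
Qed.

Definition rect : Type := (R * R * (R * R))%type.

Definition rint (Q : C -> C) (q : rect) := rectint Q q.1.1 q.1.2 q.2.1 q.2.2.

Definition half_step (Q : C -> C) (q : rect) : rect :=
  let: ((a, b), (c, d)) := q in
  let m := (a + b) / 2 in let n := (c + d) / 2 in
  let ok p := normc (rint Q q) <= 4 * normc (rint Q p) in
  if ok ((a, m), (c, n)) then ((a, m), (c, n))
  else if ok ((m, b), (c, n)) then ((m, b), (c, n))
  else if ok ((a, m), (n, d)) then ((a, m), (n, d)) else ((m, b), (n, d)).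

Definition good (Q : C -> C) (q : rect) :=
  [/\ q.1.1 < q.1.2, q.2.1 < q.2.2 & holo_rect Q q.1.1 q.1.2 q.2.1 q.2.2].

Lemma quarter_le (r x1 x2 x3 x4 : R) : r <= x1 + x2 + (x3 + x4) ->
  4 * x1 < r -> 4 * x2 < r -> 4 * x3 < r -> r <= 4 * x4.
Proof. lra. Qed.

Lemma half_stepP Q q : good Q q -> let p := half_step Q q in
  [/\ good Q p, normc (rint Q q) <= 4 * normc (rint Q p),
      q.1.1 <= p.1.1 /\ p.1.2 <= q.1.2, q.2.1 <= p.2.1 /\ p.2.2 <= q.2.2 &
      p.1.2 - p.1.1 = (q.1.2 - q.1.1) / 2 /\ p.2.2 - p.2.1 = (q.2.2 - q.2.1) / 2].
Proof.
case: q => -[a b] [c d] [/= ab cd hQ].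
set m := (a + b) / 2; set n := (c + d) / 2.
have am : a < m by rewrite /m; lra.
have mb : m < b by rewrite /m; lra.
have cn : c < n by rewrite /n; lra.
have nd : n < d by rewrite /n; lra.
have sub a' b' c' d' : a <= a' -> b' <= b -> c <= c' -> d' <= d ->
    holo_rect Q a' b' c' d'.
  move=> h1 h2 h3 h4 x y /andP[x1 x2] /andP[y1 y2]; apply: hQ.
    by rewrite (le_trans h1)// (le_trans x2).
  by rewrite (le_trans h3)// (le_trans y2).
have mE1 : m - a = (b - a) / 2 by rewrite /m; field.
have mE2 : b - m = (b - a) / 2 by rewrite /m; field.
have nE1 : n - c = (d - c) / 2 by rewrite /n; field.
have nE2 : d - n = (d - c) / 2 by rewrite /n; field.
have am' : a <= m by exact: ltW.
have mb' : m <= b by exact: ltW.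
have cn' : c <= n by exact: ltW.
have nd' : n <= d by exact: ltW.
have cQ := holo_rect_cont hQ.
have E : rint Q ((a, b), (c, d)) =
    rint Q ((a, m), (c, n)) + rint Q ((m, b), (c, n)) +
    (rint Q ((a, m), (n, d)) + rint Q ((m, b), (n, d))).
  rewrite /rint /= (rectint_splity cQ (m := n)) ?(ltW ab)// ?cn' ?nd'//.
  congr (_ + _); apply: rectint_splitx; rewrite ?am' ?mb'//.
    by apply: holo_rect_cont; exact: sub.
  by apply: holo_rect_cont; exact: sub.
case: ifPn => [ok1|n1]; first by split => //=; split => //; exact: sub.
case: ifPn => [ok1|n2]; first by split => //=; split => //; exact: sub.
case: ifPn => [ok1|n3]; first by split => //=; split => //; exact: sub.
split => //=; first by split => //; exact: sub.
move: n1 n2 n3; rewrite -!ltNge => n1 n2 n3.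
set r := normc (rint Q ((a, b), (c, d))).
have : r <= normc (rint Q ((a, m), (c, n))) + normc (rint Q ((m, b), (c, n))) +
    (normc (rint Q ((a, m), (n, d))) + normc (rint Q ((m, b), (n, d)))).
  by rewrite /r E !(le_trans (normcD_le _ _))// lerD// ?normcD_le.
by move=> hr; exact: quarter_le hr n1 n2 n3.
Qed.

Lemma nested_intervals (a b : nat -> R) : (forall n, a n <= b n) ->
  (forall n, a n <= a n.+1) -> (forall n, b n.+1 <= b n) ->
  exists x, forall n, a n <= x <= b n.
Proof.
move=> ab a1 b1.
have mono : {homo a : i j / (i <= j)%N >-> i <= j}.
  by apply: homo_leq => //; exact: le_trans.
have monob : {homo b : i j / (i <= j)%N >-> j <= i}.
  by apply: homo_leq => // ? ? ? h1 h2; exact: le_trans h2 h1.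
have aLb i j : a i <= b j.
  rewrite (le_trans (mono _ _ (leq_maxl i j)))//.
  by rewrite (le_trans (ab _))// monob// leq_maxr.
exists (sup (range a)) => n; apply/andP; split.
  apply: sup_upper_bound; last by exists n.
  by split; [exists (a 0%N); exists 0%N|exists (b 0%N) => _ [k _ <-]].
by apply: ge_sup; [exists (a 0%N); exists 0%N|move=> _ [k _ <-]].
Qed.

Theorem goursat Q a b c d : a < b -> c < d -> holo_rect Q a b c d ->
  rectint Q a b c d = 0.
Proof.
move=> ab cd hQ; apply/eqP/negPn/negP => n0; rewrite -normc_eq0 in n0.
have eta0 : 0 < normc (rectint Q a b c d) by rewrite lt_def n0 normc_ge0.
set eta := normc _ in n0 eta0.
pose q k := iter k (half_step Q) ((a, b), (c, d)).
have G k : good Q (q k).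
  elim: k => [|k IH]; first by split.
  by have [] := half_stepP IH.
have W k : q k.+1 = half_step Q (q k) by [].
have [x0 hx] : exists x, forall k, (q k).1.1 <= x <= (q k).1.2.
  apply: nested_intervals => k; first by have [/ltW] := G k.
    by rewrite W; have [_ _ []] := half_stepP (G k).
  by rewrite W; have [_ _ []] := half_stepP (G k).
have [y0 hy] : exists x, forall k, (q k).2.1 <= x <= (q k).2.2.
  apply: nested_intervals => k; first by have [_ /ltW] := G k.
    by rewrite W; have [_ _ _ []] := half_stepP (G k).
  by rewrite W; have [_ _ _ []] := half_stepP (G k).
pose s := (b - a) + (d - c).
have s0 : 0 < s by rewrite /s; lra.
have Hs k : ((q k).1.2 - (q k).1.1) + ((q k).2.2 - (q k).2.1) = s / 2 ^+ k.
  elim: k => [|k IH]; first by rewrite expr0 divr1.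
  have [_ _ _ _ [e1 e2]] := half_stepP (G k).
  by rewrite W e1 e2 -mulrDl IH exprSr invfM mulrA.
have Hr k : eta <= 4 ^+ k * normc (rint Q (q k)).
  elim: k => [|k IH]; first by rewrite expr0 mul1r.
  have [_ h _ _ _] := half_stepP (G k).
  rewrite (le_trans IH)// exprSr -mulrA ler_wpM2l// exprn_ge0//.
have hz : holo Q (x0 +i* y0) by apply: hQ; [exact: (hx 0%N)|exact: (hy 0%N)].
have e0 : 0 < eta / (8 * s ^+ 2) by rewrite divr_gt0// mulr_gt0// exprn_gt0.
have [del del0 Hdel] := rectint_local hz e0.
have [k hk] : exists k, s / 2 ^+ k < del.
  exists (Num.bound (s / del)); rewrite ltr_pdivrMr ?exprn_gt0// mulrC -ltr_pdivrMr//.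
  rewrite (lt_le_trans (archi_boundP _))// ?divr_ge0 ?ltW//.
  by rewrite -natrX ltr_nat; exact: ltn_expl.
have [ab' cd' hQ'] := G k.
have := Hdel _ _ _ _ ab' cd' (hx k) (hy k); rewrite Hs => /(_ hk hQ').
move=> H; have := le_trans (Hr k) (ler_wpM2l (exprn_ge0 k (ler0n R 4)) H).
rewrite [X in _ <= X -> _](_ : _ = eta / 2).
  by move=> h; move: eta0 h; lra.
rewrite exprMn exprVn -exprM mulnC exprM [2 ^+ 2](_ : _ = 4); last by ring.
have : (4 : R) ^+ k != 0 by rewrite expf_neq0// pnatr_eq0.
move: (4 ^+ k) => y yn0; have sn0 : s != 0 by rewrite gt_eqF.
by field; rewrite yn0.
Qed.

End Goursat.

(** * Integrals over circles *)

Section ComplexExponential.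
Variable R : realType.
Notation C := (Cplx R).

Definition cexp (z : C) : C := (expR (complex.Re z))%:C * expi (complex.Im z).

Lemma cexpD (z w : C) : cexp (z + w) = cexp z * cexp w.
Proof.
case: z w => [a b] [c d]; rewrite /cexp /= expRD expiD rmorphM /=; ring.
Qed.

Lemma normc_cexp (z : C) : normc (cexp z) = expR (complex.Re z).
Proof.
by rewrite /cexp normcM normc_expi mulr1 normc_real ger0_norm// expR_ge0.
Qed.

Lemma cexp_near0 (e : R) : 0 < e -> exists2 d : R, 0 < d & forall h : C,
  normc h < d -> normc (cexp h - 1 - h) <= e * normc h.
Proof.
move=> e0; have [e' [e'0 e'1 e'9]] : exists e' : R, [/\ 0 < e', e' <= 1 & 9 * e' <= e].
  exists (Num.min 1 (e / 9)); split.
  - by rewrite lt_min ltr01 divr_gt0.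
  - by rewrite ge_min lexx.
  - by rewrite -ler_pdivlMl// mulrC ge_min lexx orbT.
have /is_deriveRP/(_ _ e'0)[d1 d10 H1] := is_derive_expR (0 : R).
have /is_deriveRP/(_ _ e'0)[d2 d20 H2] := is_derive_cos (0 : R).
have /is_deriveRP/(_ _ e'0)[d3 d30 H3] := is_derive_sin (0 : R).
exists (Num.min e' (Num.min d1 (Num.min d2 d3))).
  by rewrite !lt_min e'0 d10 d20.
move=> h; rewrite !lt_min => /and4P[he h1 h2 h3].
have hx := normc_Re h; have hy := normc_Im h.
have {H1 h1} := H1 _ (le_lt_trans hx h1).
have {H2 h2} := H2 _ (le_lt_trans hy h2).
have {H3 h3} := H3 _ (le_lt_trans hy h3).
rewrite !add0r expR0 cos0 sin0 oppr0 mul0r addr0 !subr0 !mul1r.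
set x := complex.Re h in hx *; set y := complex.Im h in hy *.
set N := normc h in he hx hy *.
move=> H3 H2 H1.
have N0 : 0 <= N by exact: normc_ge0.
have -> : cexp h - 1 - h = (expR x)%:C * ((cos y - 1) +i* (sin y - y)) +
    ((expR x - 1 - x)%:C + 'i * (y * (expR x - 1))%:C).
  have hE : h = x +i* y by rewrite /x /y; case: (h).
  rewrite {2}hE /cexp -/x -/y /expi; simpc; congr (_ +i* _); ring.
have ex1 : `|expR x - 1| <= 2 * N.
  rewrite -(subrK x (expR x - 1)) (le_trans (ler_normD _ _))//.
  have : e' * `|x| <= 1 * `|x| by rewrite ler_wpM2r.
  lra.
have ex3 : `|expR x| <= 3.
  rewrite -(subrK 1 (expR x)) (le_trans (ler_normD _ _))// normr1.
  lra.
have A : normc ((cos y - 1) +i* (sin y - y) : C) <= 2 * e' * N.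
  rewrite (le_trans (normc_le_ReIm _))//=.
  have : e' * `|y| <= e' * N by rewrite ler_wpM2l// ltW.
  lra.
rewrite (le_trans (normcD_le _ _))// normcM normc_real.
have B : `|expR x| * normc ((cos y - 1) +i* (sin y - y) : C) <= 3 * (2 * e' * N).
  by rewrite ler_pM// normc_ge0.
have D : normc ((expR x - 1 - x)%:C + 'i * (y * (expR x - 1))%:C : C) <=
    e' * N + 2 * e' * N.
  rewrite (le_trans (normcD_le _ _))// normcM normc_i mul1r !normc_real normrM.
  rewrite lerD//; first by rewrite (le_trans H1)// ler_wpM2l// ltW.
  have : `|y| * `|expR x - 1| <= N * (2 * N) by rewrite ler_pM.
  move=> /le_trans; apply; rewrite mulrCA -mulrA ler_wpM2l// ler_wpM2r// ltW//.
have : 9 * e' * N <= e * N by rewrite ler_wpM2r.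
by move: B D; lra.
Qed.

Lemma is_derive_cexp (z : C) : is_derive z 1 cexp (cexp z).
Proof.
apply/is_cderiveP => e e0.
have c0 : 0 < normc (cexp z) by rewrite normc_cexp expR_gt0.
have [d d0 H] := cexp_near0 (divr_gt0 e0 c0).
exists d => // h /H hd.
have -> : cexp (z + h) - cexp z - cexp z * h = cexp z * (cexp h - 1 - h).
  by rewrite cexpD; ring.
by rewrite normcM -ler_pdivlMl// mulrA (mulrC _^-1).
Qed.

Lemma holo_cexp (z : C) : holo cexp z.
Proof. by case: (is_derive_cexp z) => dc _; constructor. Qed.

End ComplexExponential.

Section Circle.
Variable R : realType.
Notation C := (Cplx R).

Definition pol (rho t : R) : C := rho%:C * expi t.

Lemma normc_pol rho t : 0 <= rho -> normc (pol rho t) = rho.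
Proof. by move=> h; rewrite /pol normcM normc_expi mulr1 normc_real ger0_norm. Qed.

Lemma circle_intE (phi : C -> C) rho : circle_int phi rho =
  ((2 * pi)^-1)%:C * cint 0 (2 * pi) (fun t => phi (pol rho t) * pol rho t).
Proof. by []. Qed.

Lemma pi2_gt0 : 0 < 2 * pi :> R.
Proof. by rewrite mulr_gt0// pi_gt0. Qed.

Lemma circle_int_annulus (q : C -> C) (r1 r2 : R) : 0 < r1 -> r1 < r2 ->
  (forall w : C, r1 <= normc w <= r2 -> holo q w) ->
  circle_int q r1 = circle_int q r2.
Proof.
move=> r10 r12 hq; have r20 := lt_trans r10 r12.
pose Q (z : C) := q (cexp z) * cexp z.
have Qpol r y : 0 < r -> Q (ln r +i* y) = q (pol r y) * pol r y.
  by move=> r0; rewrite /Q /cexp /= lnK.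
have hQ : holo_rect Q (ln r1) (ln r2) 0 (2 * pi).
  move=> x y /andP[x1 x2] _.
  apply: (holoM (holo_comp (holo_cexp _) _) (holo_cexp _)).
  apply: hq; rewrite normc_cexp /=.
  rewrite -[X in X <= _ <= _](@lnK R r1) ?posrE// -[X in _ <= _ <= X](@lnK R r2) ?posrE//.
  by rewrite !ler_expR x1.
have := goursat (_ : ln r1 < ln r2) pi2_gt0 hQ; rewrite ltr_ln// => /(_ r12).
rewrite /rectint (_ : (fun x => Q (x +i* 0)) = (fun x => Q (x +i* (2 * pi)))); last first.
  by apply/funext => x; rewrite /Q /cexp /= expi0 expi2pi.
rewrite subrr add0r -mulrBr => /eqP; rewrite mulf_eq0 => /orP[|].
  by rewrite -normc_eq0 normc_i oner_eq0.
rewrite subr_eq0 !circle_intE => /eqP h; congr (_ * _).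
rewrite (@eq_cint _ _ _ _ (fun y => Q (ln r1 +i* y))) -?h; last first.
  by move=> t _; rewrite Qpol.
by apply: eq_cint => t _; rewrite Qpol.
Qed.

End Circle.

Section CircleCalculus.
Variable R : realType.
Notation C := (Cplx R).

Lemma cont_pol (rho t : R) : {for t, continuous (fun s => pol rho s)}.
Proof. exact: (@contM R R (fun=> rho%:C) (fun s => expi s) t (@cont_cst R R rho%:C t) (@cont_expi R t)). Qed.

Definition ccirc (q : C -> C) (rho : R) :=
  forall w : C, normc w = rho -> {for w, continuous q}.

Lemma ccircB (p q : C -> C) rho : ccirc p rho -> ccirc q rho ->
  ccirc (fun w => p w - q w) rho.
Proof. by move=> cp cq w hw; exact: (contB (cp w hw) (cq w hw)). Qed.

Lemma ccircM (p q : C -> C) rho : ccirc p rho -> ccirc q rho ->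
  ccirc (fun w => p w * q w) rho.
Proof. by move=> cp cq w hw; exact: (contM (cp w hw) (cq w hw)). Qed.

Lemma ccirc_cst (k : C) rho : ccirc (fun=> k) rho.
Proof. by move=> w _; exact: cont_cst. Qed.

Lemma ccirc_holo (q : C -> C) rho : (forall w : C, normc w = rho -> holo q w) ->
  ccirc q rho.
Proof. by move=> h w /h /holo_cont. Qed.

Lemma ccirc_pcont (q : C -> C) rho a b : 0 <= rho -> ccirc q rho ->
  pcont a b (fun t => q (pol rho t)).
Proof.
move=> r0 cq t _; apply: (cont_comp (cont_pol (rho := rho) (t := t))).
by apply: cq; rewrite normc_pol.
Qed.

Lemma pcont_pol a b rho : pcont a b (pol rho : R -> C).
Proof. by move=> t _; exact: cont_pol. Qed.

Lemma ccirc_pcontM (q : C -> C) rho a b : 0 <= rho -> ccirc q rho ->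
  pcont a b (fun t => q (pol rho t) * pol rho t).
Proof.
by move=> r0 cq; exact: (pcontM (ccirc_pcont r0 cq) (@pcont_pol a b rho)).
Qed.

Lemma eq_circle_int (p q : C -> C) rho : 0 <= rho ->
  (forall w : C, normc w = rho -> p w = q w) -> circle_int p rho = circle_int q rho.
Proof.
move=> r0 e; rewrite !circle_intE; congr (_ * _); apply: eq_cint => t _.
by rewrite e// normc_pol.
Qed.

Lemma circle_intD (p q : C -> C) rho : 0 <= rho -> ccirc p rho -> ccirc q rho ->
  circle_int (fun w => p w + q w) rho = circle_int p rho + circle_int q rho.
Proof.
move=> r0 cp cq; rewrite !circle_intE -mulrDr.
rewrite -(cintD (ccirc_pcontM r0 cp) (ccirc_pcontM r0 cq)).
by congr (_ * _); apply: eq_cint => t _; rewrite mulrDl.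
Qed.

Lemma circle_intB (p q : C -> C) rho : 0 <= rho -> ccirc p rho -> ccirc q rho ->
  circle_int (fun w => p w - q w) rho = circle_int p rho - circle_int q rho.
Proof.
move=> r0 cp cq; rewrite !circle_intE -mulrBr.
rewrite -(cintB (ccirc_pcontM r0 cp) (ccirc_pcontM r0 cq)).
by congr (_ * _); apply: eq_cint => t _; rewrite mulrBl.
Qed.

Lemma circle_intZ (k : C) (q : C -> C) rho : 0 <= rho -> ccirc q rho ->
  circle_int (fun w => k * q w) rho = k * circle_int q rho.
Proof.
move=> r0 cq; rewrite !circle_intE mulrCA -(cintZ k (ccirc_pcontM r0 cq)).
by congr (_ * _); apply: eq_cint => t _; rewrite mulrA.
Qed.

Lemma circle_int_sum n (q : nat -> C -> C) rho : 0 <= rho ->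
  (forall i, (i < n)%N -> ccirc (q i) rho) ->
  circle_int (fun w => \sum_(i < n) q i w) rho =
  \sum_(i < n) circle_int (q i) rho.
Proof.
move=> r0 cq; rewrite circle_intE.
under [RHS]eq_bigr do rewrite circle_intE.
rewrite -mulr_sumr -(@cint_sum _ 0 (2 * pi) n (fun i t => q i (pol rho t) * pol rho t)).
  by congr (_ * _); apply: eq_cint => t _; rewrite mulr_suml.
by move=> i ni; exact: (ccirc_pcontM r0 (cq i ni)).
Qed.

Lemma circle_int_le (q : C -> C) rho M : 0 <= rho -> ccirc q rho ->
  (forall w : C, normc w = rho -> normc (q w) <= M) ->
  normc (circle_int q rho) <= 2 * M * rho.
Proof.
move=> r0 cq qM; rewrite circle_intE normcM normc_real ger0_norm; last first.
  by rewrite invr_ge0 ltW// pi2_gt0.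
rewrite ler_pdivrMl ?pi2_gt0//.
have h t : 0 <= t <= 2 * pi -> normc (q (pol rho t) * pol rho t) <= M * rho.
  by move=> _; rewrite normcM normc_pol// ler_wpM2r// qM// normc_pol.
have := cint_le (ltW (pi2_gt0 R)) (ccirc_pcontM r0 cq) h.
rewrite subr0 => /le_trans; apply.
by rewrite le_eqVlt; apply/orP; left; apply/eqP; ring.
Qed.

Lemma circle_int_inv (k : C) rho : 0 < rho -> circle_int (fun w => k / w) rho = k.
Proof.
move=> r0; rewrite circle_intE (@eq_cint _ _ _ _ (fun=> k)); last first.
  by move=> t _; rewrite divfK// -normc_gt0 normc_pol// ltW.
rewrite cint_cst ?ltW ?pi2_gt0// subr0 mulrCA -rmorphM mulVf ?mulr1//.
by rewrite gt_eqF// pi2_gt0.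
Qed.

Lemma normc_lt_eq0 (z : C) : (forall e : R, 0 < e -> normc z < e) -> z = 0.
Proof.
move=> h; apply/eqP; rewrite -normc_eq0; apply/negPn/negP => n0.
have : 0 < normc z by rewrite lt_def n0 normc_ge0.
by move=> /h; rewrite ltxx.
Qed.

Lemma near_segment {I : Type} {F : set_system I} {FF : Filter F} (a b : R)
    (P : I -> R -> Prop) :
  (forall t, a <= t <= b -> \forall t' \near t & i \near F, P i t') ->
  \forall i \near F, forall t, a <= t <= b -> P i t.
Proof.
move=> h; have cK : compact (`[a, b]%classic : set R) by exact: segment_compact.
have hK t : (`[a, b]%classic : set R) t -> \forall t' \near t & i \near F, P i t'.
  by rewrite /= in_itv /=; exact: h.
have := (compact_near_coveringP _).1 cK I F P FF hK.
by apply: filterS => i Hi t tab; apply: Hi; rewrite /= in_itv /=.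
Qed.

Lemma circle_int_radius (q : C -> C) (r1 s r2 : R) : 0 < r1 -> r1 < s < r2 ->
  (forall w : C, r1 <= normc w <= r2 -> {for w, continuous q}) ->
  circle_int q rho @[rho --> s] --> circle_int q s.
Proof.
move=> r10 /andP[r1s sr2] cq.
have s0 := lt_trans r10 r1s.
have cqs : ccirc q s by move=> w hw; apply: cq; rewrite hw !ltW.
pose g (x : R * R) : C := q (pol x.1 x.2) * pol x.1 x.2.
have cg t : {for (s, t), continuous g}.
  have cp : {for (s, t), continuous (fun x : R * R => pol x.1 x.2)}.
    have c1 : {for (s, t), continuous (fun x : R * R => (x.1)%:C : C)}.
      apply: cont_complex; first exact: cvg_fst.
      exact: (@cst_continuous (R * R)%type R 0 (s, t)).
    have c2 : {for (s, t), continuous (fun x : R * R => expi x.2 : C)}.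
      apply: (@continuous_comp (R * R)%type R C snd (fun u => expi u)).
        exact: cvg_snd.
      exact: cont_expi.
    exact: (contM c1 c2).
  have cc : {for (s, t), continuous (fun x : R * R => q (pol x.1 x.2))}.
    apply: (cont_comp (h := q) cp); apply: cq.
    by rewrite normc_pol ?ltW// r1s sr2.
  exact: (contM cc cp).
have H : forall e : R, 0 < e -> \forall rho \near s,
    forall t, 0 <= t <= 2 * pi -> normc (q (pol rho t) * pol rho t - q (pol s t) * pol s t) <= e.
  move=> e e0.
  have e2 : 0 < e / 2 by rewrite divr_gt0.
  apply: (@near_segment R (nbhs s) _ 0 (2 * pi) (fun rho t =>
    normc (q (pol rho t) * pol rho t - q (pol s t) * pol s t) <= e)) => t _.
  have /contcP/(_ _ e2)[[A B] /= [nA nB] AB] := cg t.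
  exists (B, A) => //= -[t' rho] [/= Bt Ar].
  have h1 := AB (rho, t') (conj Ar Bt).
  have h2 := AB (s, t') (conj (nbhs_singleton nA) Bt).
  rewrite -[X in normc X](_ : (g (rho, t') - g (s, t)) - (g (s, t') - g (s, t)) = _).
    by rewrite (splitr e) (le_trans (normcB_le _ _))// lerD// ltW.
  by rewrite /g /=; ring.
have nr : \forall rho \near s, r1 < rho < r2.
  by near=> rho; apply/andP; split; near: rho; [exact: lt_nbhsr|exact: lt_nbhsl].
have pc : \forall rho \near s, pcont 0 (2 * pi) (fun t => q (pol rho t) * pol rho t).
  apply: filterS nr => rho /andP[a1 a2]; apply: ccirc_pcontM.
    by rewrite ltW// (lt_trans r10).
  by move=> w hw; apply: cq; rewrite hw !ltW.
have := cint_cvg (ltW (pi2_gt0 R)) pc (ccirc_pcontM (ltW s0) cqs) H.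
have := @cvg_cst C ((2 * pi)^-1)%:C R (nbhs s) _.
move=> /(_ _) h1 /(_ _) h2.
exact: (@cvgM R[i] R (nbhs s) _ _ _ _ _ h1 h2).
Unshelve. all: by end_near. Qed.

Lemma circle_int_annulus_except (q : C -> C) (r1 s r2 : R) : 0 < r1 -> r1 < s < r2 ->
  (forall w : C, r1 <= normc w <= r2 -> {for w, continuous q}) ->
  (forall w : C, r1 <= normc w <= r2 -> normc w != s -> holo q w) ->
  circle_int q r1 = circle_int q r2.
Proof.
move=> r10 /andP[r1s sr2] cq hq.
have /cvgcP H := circle_int_radius r10 (introT andP (conj r1s sr2)) cq.
have E1 rho : r1 < rho < s -> circle_int q r1 = circle_int q rho.
  move=> /andP[a1 a2]; apply: circle_int_annulus => // w /andP[b1 b2].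
  by apply: hq; rewrite ?b1 ?lt_eqF//= ?(le_lt_trans b2)// (le_trans b2)// ltW// (lt_trans a2).
have E2 rho : s < rho < r2 -> circle_int q r2 = circle_int q rho.
  move=> /andP[a1 a2]; apply/esym/circle_int_annulus => //.
    by rewrite (lt_trans r10)// (lt_trans r1s).
  move=> w /andP[b1 b2].
  by apply: hq; rewrite ?b2 ?gt_eqF//= ?(lt_le_trans a1)// ?andbT (le_trans _ b1)// ltW// (lt_trans r1s).
suff h : circle_int q r1 = circle_int q s /\ circle_int q r2 = circle_int q s.
  by case: h => -> ->.
split; apply/eqP; rewrite -subr_eq0; apply/eqP/normc_lt_eq0 => e e0.
  have /nbhs_normP[d /= d0 Hd] := H e e0.
  pose rho := Num.max ((r1 + s) / 2) (s - d / 2).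
  have rs : rho < s by rewrite /rho gt_max; apply/andP; split; lra.
  have rr : r1 < rho by rewrite /rho lt_max; apply/orP; left; lra.
  rewrite (E1 rho) ?rr//; apply: Hd; rewrite /ball_ /= ger0_norm ?subr_ge0 ?ltW//.
  have : s - d / 2 <= rho by rewrite /rho le_max lexx orbT.
  lra.
have /nbhs_normP[d /= d0 Hd] := H e e0.
pose rho := Num.min ((r2 + s) / 2) (s + d / 2).
have rs : s < rho by rewrite /rho lt_min; apply/andP; split; lra.
have rr : rho < r2 by rewrite /rho gt_min; apply/orP; left; lra.
rewrite (E2 rho) ?rs//; apply: Hd; rewrite /ball_ /= ltr0_norm ?subr_lt0// opprB.
have : rho <= s + d / 2 by rewrite /rho ge_min lexx orbT.
lra.
Qed.

Lemma circle_mean_value (q : C -> C) (a : C) rho : 0 < rho ->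
  (forall w : C, normc w <= rho -> holo q (a + w)) ->
  circle_int (fun w => q (a + w) / w) rho = q a.
Proof.
move=> r0 hq; apply/eqP; rewrite -subr_eq0; apply/eqP/normc_lt_eq0 => e e0.
have hs w : normc w <= rho -> holo (fun w => q (a + w)) w.
  by move=> /hq; exact: (holo_comp (holoD (holo_cst a w) (holo_id w))).
have hq0 : {for 0, continuous (fun w : C => q (a + w))}.
  by apply: holo_cont; apply: hs; rewrite normc0 ltW.
have e3 : 0 < e / 3 by rewrite divr_gt0.
have /ccontP/(_ _ e3)[d d0 Hd] := hq0.
pose del := Num.min (rho / 2) (d / 2).
have del0 : 0 < del by rewrite lt_min !divr_gt0.
have delr : del < rho by rewrite gt_min; apply/orP; left; lra.
have deld : del < d by rewrite gt_min; apply/orP; right; lra.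
have wn0 w : del <= normc w -> w != 0 :> C.
  by move=> h; rewrite -normc_gt0 (lt_le_trans del0).
have hol w : del <= normc w <= rho -> holo (fun w => q (a + w) / w) w.
  by move=> /andP[h1 h2]; exact: (holo_div (hs _ h2) (holo_id w) (wn0 _ h1)).
rewrite -(circle_int_annulus del0 delr hol).
have c1 : ccirc (fun w => q (a + w) / w) del.
  by move=> w hw; apply/holo_cont/hol; rewrite hw lexx ltW.
have c2 : ccirc (fun w => q a / w) del.
  move=> w hw; apply: holo_cont.
  by apply: (holo_div (holo_cst (q a) w) (holo_id w)); rewrite wn0// hw.
rewrite -(circle_int_inv (q a) del0) -(circle_intB (ltW del0) c1 c2).
have cd : ccirc (fun w => q (a + w) / w - q a / w) del.
  exact: (ccircB c1 c2).
have le w : normc w = del -> normc (q (a + w) / w - q a / w) <= e / 3 / del.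
  move=> hw; rewrite -mulrBl normc_div hw ler_pM2r ?invr_gt0//.
  have := Hd w; rewrite subr0 addr0 hw => /(_ deld); exact: ltW.
rewrite (le_lt_trans (circle_int_le (ltW del0) cd le))//.
have -> : 2 * (e / 3 / del) * del = 2 / 3 * e by field; rewrite gt_eqF.
by lra.
Qed.

Lemma circle_int_at_infty (q : C -> C) (l : C) rho : 0 < rho ->
  (forall w : C, rho <= normc w -> holo q w) ->
  (forall e : R, 0 < e -> exists M : R, forall w : C, M < normc w ->
     normc (w * q w - l) <= e) ->
  circle_int q rho = l.
Proof.
move=> r0 hq hl; apply/eqP; rewrite -subr_eq0; apply/eqP/normc_lt_eq0 => e e0.
have e3 : 0 < e / 3 by rewrite divr_gt0.
have [M HM] := hl _ e3.
pose s := Num.max (rho + 1) (M + 1).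
have sr : rho < s by rewrite lt_max ltrDl ltr01.
have sM : M < s by rewrite lt_max !ltrDl ltr01 orbT.
have s0 := lt_trans r0 sr.
rewrite (circle_int_annulus r0 sr) => [|w /andP[h1 h2]]; last exact: hq.
have c1 : ccirc q s by move=> w hw; apply/holo_cont/hq; rewrite hw ltW.
have wn0 w : normc w = s -> w != 0 :> C by move=> h; rewrite -normc_gt0 h.
have c2 : ccirc (fun w => l / w) s.
  move=> w hw; apply: holo_cont.
  by apply: (holo_div (holo_cst l w) (holo_id w)); rewrite wn0// hw.
rewrite -(circle_int_inv l s0) -(circle_intB (ltW s0) c1 c2).
have cd : ccirc (fun w => q w - l / w) s.
  exact: (ccircB c1 c2).
have le w : normc w = s -> normc (q w - l / w) <= e / 3 / s.
  move=> hw; have -> : q w - l / w = (w * q w - l) / w by field; exact: wn0.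
  by rewrite normc_div hw ler_pM2r ?invr_gt0// HM// hw.
rewrite (le_lt_trans (circle_int_le (ltW s0) cd le))//.
have -> : 2 * (e / 3 / s) * s = 2 / 3 * e by field; rewrite gt_eqF.
by lra.
Qed.

End CircleCalculus.

(** * Cauchy's formula and its consequences *)

Section CauchyTransform.
Variable R : realType.
Notation C := (Cplx R).

Lemma pcont_bounded (a b : R) (phi : R -> C) : a <= b -> pcont a b phi ->
  exists2 M : R, 0 < M & forall t, a <= t <= b -> normc (phi t) <= M.
Proof.
move=> ab cp.
have cn : {within `[a, b], continuous (fun t => normc (phi t))}.
  apply: continuous_in_subspaceT => t; rewrite inE/= in_itv/= => tab.
  exact: (cont_normc (cp t tab)).
have [c _ h] := EVT_max ab cn.
exists (normc (phi c) + 1); first by rewrite ltr_wpDl// normc_ge0.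
move=> t tab; have := h t; rewrite in_itv /= tab => /(_ isT) /le_trans; apply.
by rewrite lerDl.
Qed.

Lemma pcont_away (a b : R) (phi : R -> C) : a <= b -> pcont a b phi ->
  (forall t, a <= t <= b -> phi t != 0) ->
  exists2 d : R, 0 < d & forall t, a <= t <= b -> d <= normc (phi t).
Proof.
move=> ab cp p0.
have cn : {within `[a, b], continuous (fun t => normc (phi t))}.
  apply: continuous_in_subspaceT => t; rewrite inE/= in_itv/= => tab.
  exact: (cont_normc (cp t tab)).
have [c + h] := EVT_min ab cn; rewrite in_itv /= => cab.
exists (normc (phi c)); first by rewrite normc_gt0; exact: p0.
by move=> t tab; apply: h; rewrite in_itv.
Qed.

Lemma param_is_derive (a b : R) (K : R -> C -> C) (K' : R -> C) (z0 : C) (M d : R) :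
  a <= b -> 0 < d ->
  (forall h : C, normc h < d -> pcont a b (fun t => K t (z0 + h))) -> pcont a b K' ->
  (forall t (h : C), a <= t <= b -> normc h < d ->
     normc (K t (z0 + h) - K t z0 - h * K' t) <= M * normc h ^+ 2) ->
  is_derive z0 1 (fun z => cint a b (fun t => K t z)) (cint a b K').
Proof.
move=> ab d0 cK cK' HM; apply/is_cderiveP => e e0.
pose N := 2 * `|M| * (b - a) + 1.
have ba0 : 0 <= b - a by rewrite subr_ge0.
have N0 : 0 < N by rewrite ltr_wpDl// !mulr_ge0.
exists (Num.min d (e / N)); first by rewrite lt_min d0 divr_gt0.
move=> h; rewrite lt_min => /andP[hd he].
have c0 : pcont a b (fun t => K t z0).
  by have := cK 0; rewrite (addr0 z0); apply; rewrite normc0.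
have ch := cK h hd.
have cZ : pcont a b (fun t => h * K' t) := pcontM (@pcont_cst _ a b h) cK'.
rewrite mulrC -(cintZ h cK') -(cintB ch c0) -(cintB (pcontB ch c0) cZ).
have B t : a <= t <= b -> normc (K t (z0 + h) - K t z0 - h * K' t) <=
    `|M| * normc h ^+ 2.
  move=> tab; rewrite (le_trans (HM t h tab hd))//.
  by rewrite ler_wpM2r ?exprn_ge0 ?normc_ge0// ler_norm.
rewrite (le_trans (cint_le ab (pcontB (pcontB ch c0) cZ) B))//.
have -> : 2 * (`|M| * normc h ^+ 2) * (b - a) =
  (2 * `|M| * (b - a) * normc h) * normc h by ring.
rewrite ler_wpM2r ?normc_ge0//.
move: he; rewrite ltr_pdivlMr// => /ltW; apply: le_trans.
by rewrite mulrC ler_wpM2l ?normc_ge0// lerDl.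
Qed.

Lemma invB_expansion (u h : C) (d0 : R) : 0 < d0 -> d0 <= normc u -> normc h < d0 / 2 ->
  normc ((u - h)^-1 - u^-1 - h * u^-1 ^+ 2) <= 2 / d0 ^+ 3 * normc h ^+ 2 /\
  normc ((u - h)^-1 ^+ 2 - u^-1 ^+ 2 - h * (2 * u^-1 ^+ 3)) <=
    8 / d0 ^+ 4 * normc h ^+ 2.
Proof.
move=> d00 du hd.
have u0 : u != 0 by rewrite -normc_gt0 (lt_le_trans d00).
have duh : d0 / 2 <= normc (u - h) by have := normcB_ge u h; lra.
have d20 : 0 < d0 / 2 by rewrite divr_gt0.
have uh0 : u - h != 0 by rewrite -normc_gt0 (lt_le_trans d20).
have iu : normc u^-1 <= d0^-1.
  by rewrite normcV lef_pV2// posrE// (lt_le_trans d00).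
have iuh : normc (u - h)^-1 <= 2 / d0.
  by rewrite normcV -[2 / d0]invf_div lef_pV2// posrE// (lt_le_trans d20).
have iu0 := normc_ge0 u^-1; have iuh0 := normc_ge0 (u - h)^-1.
have E1 : (u - h)^-1 - u^-1 - h * u^-1 ^+ 2 = u^-1 ^+ 2 * (u - h)^-1 * h ^+ 2.
  by field; rewrite u0 uh0.
have E2 : (u - h)^-1 ^+ 2 - u^-1 ^+ 2 - h * (2 * u^-1 ^+ 3) =
   (u^-1 ^+ 2 * (u - h)^-1 ^+ 2 + 2 * u^-1 ^+ 3 * (u - h)^-1) * h ^+ 2.
  by field; rewrite u0 uh0.
have P2 : normc u^-1 ^+ 2 <= d0^-1 ^+ 2 by rewrite lerXn2r ?nnegrE// ?invr_ge0 ltW.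
have P3 : normc u^-1 ^+ 3 <= d0^-1 ^+ 3 by rewrite lerXn2r ?nnegrE// ?invr_ge0 ltW.
have Q2 : normc (u - h)^-1 ^+ 2 <= (2 / d0) ^+ 2.
  by rewrite lerXn2r ?nnegrE// ?divr_ge0 ?ltW.
split.
  rewrite E1 normcM normcM !normcX ler_wpM2r ?exprn_ge0 ?normc_ge0//.
  rewrite (le_trans (ler_pM _ _ P2 iuh)) ?exprn_ge0//.
  by rewrite le_eqVlt; apply/orP; left; apply/eqP; field; rewrite gt_eqF.
rewrite E2 normcM normcX ler_wpM2r ?exprn_ge0 ?normc_ge0//.
rewrite (le_trans (normcD_le _ _))//.
rewrite normcM (normcM (2 * _)) (normcM 2) !normcX normc_nat.
have A : normc u^-1 ^+ 2 * normc (u - h)^-1 ^+ 2 <= d0^-1 ^+ 2 * (2 / d0) ^+ 2.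
  by rewrite ler_pM ?exprn_ge0.
have B : 2 * normc u^-1 ^+ 3 * normc (u - h)^-1 <= 2 * d0^-1 ^+ 3 * (2 / d0).
  rewrite ler_pM//; first by rewrite mulr_ge0// exprn_ge0.
  by rewrite ler_wpM2l.
rewrite (le_trans (lerD A B))//.
by rewrite le_eqVlt; apply/orP; left; apply/eqP; field; rewrite gt_eqF.
Qed.

Section Kernel.
Variables (a b : R) (gam phi : R -> C) (z0 : C) (d0 : R).
Hypotheses (ab : a <= b) (cg : pcont a b gam) (cp : pcont a b phi) (d00 : 0 < d0)
  (away : forall t, a <= t <= b -> d0 <= normc (gam t - z0)).

Let away0 (h : C) t : normc h < d0 / 2 -> a <= t <= b -> gam t - (z0 + h) != 0.
Proof.
move=> hd tab; rewrite -normc_gt0 opprD addrA.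
rewrite (lt_le_trans _ (normcB_ge _ _))// subr_gt0 (lt_le_trans _ (away tab))//.
by rewrite (lt_trans hd)// ltr_pdivrMr// ltr_pMr// ltr1n.
Qed.

Let cinv (h : C) : normc h < d0 / 2 -> pcont a b (fun t => (gam t - (z0 + h))^-1).
Proof.
move=> hd; exact: (pcontV (fun t => @away0 h t hd) (pcontB cg (@pcont_cst _ a b (z0 + h)))).
Qed.

Let cinv0 : pcont a b (fun t => (gam t - z0)^-1).
Proof. by have := @cinv 0; rewrite (addr0 z0); apply; rewrite normc0 divr_gt0. Qed.

Lemma cauchy_transform_derive :
  is_derive z0 1 (fun z => cint a b (fun t => phi t * (gam t - z)^-1))
    (cint a b (fun t => phi t * (gam t - z0)^-1 ^+ 2)).
Proof.
have [M M0 HM] := pcont_bounded ab cp.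
apply: (@param_is_derive a b (fun t z => phi t * (gam t - z)^-1)
  (fun t => phi t * (gam t - z0)^-1 ^+ 2) z0 (M * (2 / d0 ^+ 3)) (d0 / 2) ab).
- by rewrite divr_gt0.
- by move=> h hd; exact: (pcontM cp (cinv hd)).
- exact: (pcontM cp (pcontX cinv0)).
move=> t h tab hd.
have -> : phi t * (gam t - (z0 + h))^-1 - phi t * (gam t - z0)^-1 -
    h * (phi t * (gam t - z0)^-1 ^+ 2) =
  phi t * ((gam t - z0 - h)^-1 - (gam t - z0)^-1 - h * (gam t - z0)^-1 ^+ 2).
  by rewrite opprD addrA; ring.
have [H _] := invB_expansion d00 (away tab) hd.
by rewrite normcM -mulrA ler_pM ?normc_ge0// HM.
Qed.

Lemma cauchy_transform2_derive :
  is_derive z0 1 (fun z => cint a b (fun t => phi t * (gam t - z)^-1 ^+ 2))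
    (cint a b (fun t => phi t * (2 * (gam t - z0)^-1 ^+ 3))).
Proof.
have [M M0 HM] := pcont_bounded ab cp.
apply: (@param_is_derive a b (fun t z => phi t * (gam t - z)^-1 ^+ 2)
  (fun t => phi t * (2 * (gam t - z0)^-1 ^+ 3)) z0 (M * (8 / d0 ^+ 4)) (d0 / 2) ab).
- by rewrite divr_gt0.
- by move=> h hd; exact: (pcontM cp (pcontX (cinv hd))).
- exact: (pcontM cp (pcontM (@pcont_cst _ a b 2) (pcontX cinv0))).
move=> t h tab hd.
have -> : phi t * (gam t - (z0 + h))^-1 ^+ 2 - phi t * (gam t - z0)^-1 ^+ 2 -
    h * (phi t * (2 * (gam t - z0)^-1 ^+ 3)) =
  phi t * ((gam t - z0 - h)^-1 ^+ 2 - (gam t - z0)^-1 ^+ 2 - h * (2 * (gam t - z0)^-1 ^+ 3)).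
  by rewrite opprD addrA; ring.
have [_ H] := invB_expansion d00 (away tab) hd.
by rewrite normcM -mulrA ler_pM ?normc_ge0// HM.
Qed.

End Kernel.

Definition diffquot (q : C -> C) (b l w : C) : C :=
  if w == b then l else (q w - q b) / (w - b).

Lemma diffquot_cont (q : C -> C) (b l : C) : is_derive b 1 q l ->
  {for b, continuous (diffquot q b l)}.
Proof.
move=> /is_cderiveP H; apply/ccontP => e e0.
have e2 : 0 < e / 2 by rewrite divr_gt0.
have [d d0 Hd] := H _ e2; exists d => // w wd.
rewrite /diffquot eqxx; case: eqVneq => [_|wb]; first by rewrite subrr normc0.
have wb0 : w - b != 0 by rewrite subr_eq0.
have -> : (q w - q b) / (w - b) - l = (q (b + (w - b)) - q b - l * (w - b)) / (w - b).
  by rewrite subrKC; field.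
rewrite normc_div ltr_pdivrMr ?normc_gt0//.
by rewrite (le_lt_trans (Hd _ wd))// ltr_pM2r ?normc_gt0//; lra.
Qed.

Lemma diffquot_holo (q : C -> C) (b l w : C) : w != b -> holo q w ->
  holo (diffquot q b l) w.
Proof.
move=> wb hq; have wb0 : w - b != 0 by rewrite subr_eq0.
apply: (@near_eq_holo R (fun w => (q w - q b) / (w - b))); last first.
  exact: (holo_div (holoB hq (holo_cst (q b) w)) (holoB (holo_id w) (holo_cst b w)) wb0).
apply/nbhscP; exists (normc (w - b)); first by rewrite normc_gt0.
move=> w' h; rewrite /diffquot; case: eqVneq => // e; move: h.
by rewrite e normc_sub ltxx.
Qed.

Lemma circle_int_invB (b : C) rho : normc b < rho ->
  circle_int (fun w => (w - b)^-1) rho = 1.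
Proof.
move=> br; have r0 := le_lt_trans (normc_ge0 b) br.
have wb w : rho <= normc w -> w - b != 0.
  move=> h; rewrite -normc_gt0 (lt_le_trans _ (normcB_ge _ _))// subr_gt0.
  exact: lt_le_trans h.
apply: circle_int_at_infty => // [w h|e e0].
  exact: (holoV (holoB (holo_id w) (holo_cst b w)) (wb _ h)).
exists (Num.max rho (normc b / e + normc b)) => w; rewrite gt_max => /andP[h1 h2].
have wb0 := wb _ (ltW h1).
have -> : w * (w - b)^-1 - 1 = b / (w - b) by field.
rewrite normc_div ler_pdivrMr ?normc_gt0//.
rewrite mulrC -ler_pdivrMr//.
by have := normcB_ge w b; move: h2; lra.
Qed.

Lemma cauchy_formula0 (q : C -> C) (b : C) rho : normc b < rho ->
  (forall w : C, normc w <= rho -> holo q w) ->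
  circle_int (fun w => q w * (w - b)^-1) rho = q b.
Proof.
move=> br hq; have r0 := le_lt_trans (normc_ge0 b) br.
have [l /is_cderiveP hl] := (holoP q b).1 (hq _ (ltW br)).
pose g := diffquot q b l.
have cg w : normc w <= rho -> {for w, continuous g}.
  move=> hw; have [->|wb] := eqVneq w b; first exact: diffquot_cont.
  exact: (holo_cont (diffquot_holo l wb (hq _ hw))).
have wb w : normc w = rho -> w - b != 0.
  by move=> h; rewrite subr_eq0; apply/eqP => e; move: br; rewrite -e h ltxx.
have hg w : normc w <= rho -> w != b -> holo g w.
  by move=> h1 h2; exact: (diffquot_holo l h2 (hq _ h1)).
have [r2 r20 Er] : exists2 r2 : R, 0 < r2 & forall r1, 0 < r1 < r2 ->
    r1 < rho /\ circle_int g r1 = circle_int g rho.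
  have [b0|b0] := eqVneq b 0.
    exists rho => [//|r1 /andP[r10 r1r]]; split; first exact: r1r.
    apply: circle_int_annulus => // w /andP[h1 h2]; apply: hg => //.
    by rewrite b0 -normc_gt0 (lt_le_trans r10).
  exists (normc b); first by rewrite normc_gt0.
  move=> r1 /andP[r10 r1r]; split; first exact: lt_trans br.
  apply: (@circle_int_annulus_except _ _ _ (normc b)) => //; first by rewrite r1r.
    by move=> w /andP[_ hw]; exact: cg.
  move=> w /andP[_ hw] wb'; apply: hg => //.
  by apply/eqP => e; move: wb'; rewrite e eqxx.
have g0 : circle_int g rho = 0.
  apply: normc_lt_eq0 => e e0.
  have cg0 : {for 0, continuous g} by apply: cg; rewrite normc0 ltW.
  have /ccontP/(_ _ ltr01)[d d0 Hd] := cg0.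
  pose L := 2 * (normc (g 0) + 1).
  have L0 : 0 < L by rewrite mulr_gt0// ltr_wpDl// normc_ge0.
  have m0 : 0 < Num.min r2 (Num.min d (e / L)) by rewrite !lt_min r20 d0 divr_gt0.
  set m := Num.min _ _ in m0.
  have m2 : m / 2 < m by lra.
  have m20 : 0 < m / 2 by lra.
  have mr : m / 2 < r2 by rewrite (lt_le_trans m2)// ge_min lexx.
  have md : m / 2 < d by rewrite (lt_le_trans m2)// !ge_min lexx orbT.
  have me : m / 2 < e / L by rewrite (lt_le_trans m2)// !ge_min lexx !orbT.
  have := Er (m / 2); rewrite m20 mr => /(_ isT)[mrho <-].
  have c1 : ccirc g (m / 2) by move=> w hw; apply: cg; rewrite hw ltW.
  have bd w : normc w = m / 2 -> normc (g w) <= normc (g 0) + 1.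
    move=> hw; rewrite -[g w](subrK (g 0)) (le_trans (normcD_le _ _))//.
    by rewrite addrC lerD2l ltW// Hd// subr0 hw.
  rewrite (le_lt_trans (circle_int_le (ltW m20) c1 bd))//.
  by rewrite -/L mulrC -ltr_pdivlMr.
have c1 : ccirc g rho by move=> w hw; apply: cg; rewrite hw.
have c2 : ccirc (fun w => (w - b)^-1) rho.
  apply: ccirc_holo => w hw.
  exact: (holoV (holoB (holo_id w) (holo_cst b w)) (wb _ hw)).
have c3 : ccirc (fun w => q b * (w - b)^-1) rho.
  exact: (ccircM (@ccirc_cst R (q b) rho) c2).
rewrite (@eq_circle_int R _ (fun w => g w + q b * (w - b)^-1)) ?ltW//.
  rewrite (circle_intD (ltW r0) c1 c3) g0 add0r (circle_intZ (q b) (ltW r0) c2).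
  by rewrite circle_int_invB// mulr1.
move=> w hw; rewrite /g /diffquot; have := wb _ hw.
by rewrite subr_eq0 => /negPf E; rewrite E; field; rewrite subr_eq0 E.
Qed.

Lemma cauchy_formula (q : C -> C) (a b : C) rho : normc (b - a) < rho ->
  (forall w : C, normc w <= rho -> holo q (a + w)) ->
  circle_int (fun w => q (a + w) * (a + w - b)^-1) rho = q b.
Proof.
move=> br hq.
have hs w : normc w <= rho -> holo (fun w => q (a + w)) w.
  by move=> /hq; exact: (holo_comp (holoD (holo_cst a w) (holo_id w))).
have := cauchy_formula0 br hs; rewrite subrKC => <-.
apply: eq_circle_int => [|w _]; first by rewrite (le_trans _ (ltW br))// normc_ge0.
by congr (_ * _^-1); ring.
Qed.

Lemma is_derive_cvalue (q : C -> C) (z l : C) : is_derive z 1 q l -> 'D_1 q z = l.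
Proof. by move=> [_]. Qed.

Lemma holo_derive_formula (q : C -> C) (a : C) rho : 0 < rho ->
  (forall w : C, normc w <= rho -> holo q (a + w)) ->
  (forall b : C, normc (b - a) < rho ->
    'D_1 q b = circle_int (fun w => q (a + w) * (a + w - b)^-1 ^+ 2) rho) /\
  (forall b : C, normc (b - a) < rho -> holo (fun z => 'D_1 q z) b).
Proof.
move=> r0 hq; have r0' := ltW r0.
pose K := ((2 * pi)^-1)%:C : C.
pose gam t : C := a + pol rho t.
pose phi t : C := q (a + pol rho t) * pol rho t.
have cq : ccirc (fun w => q (a + w)) rho.
  apply: ccirc_holo => w hw.
  apply: (holo_comp (holoD (holo_cst a w) (holo_id w))); apply: hq.
  by rewrite hw.
have cphi : pcont 0 (2 * pi) phi := ccirc_pcontM r0' cq.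
have cgam : pcont 0 (2 * pi) gam.
  exact: (pcontD (@pcont_cst _ _ _ a) (@pcont_pol _ _ _ rho)).
have p2 := ltW (pi2_gt0 R).
have E b : normc (b - a) < rho ->
    q b = K * cint 0 (2 * pi) (fun t => phi t * (gam t - b)^-1).
  move=> br; rewrite -(cauchy_formula br hq) circle_intE; congr (_ * _).
  by apply: eq_cint => t _; rewrite /phi /gam mulrAC.
have away b t : normc (b - a) < rho -> rho - normc (b - a) <= normc (gam t - b).
  move=> br; have -> : gam t - b = pol rho t - (b - a) by rewrite /gam; ring.
  by have := normcB_ge (pol rho t) (b - a); rewrite normc_pol.
have nearb b : normc (b - a) < rho -> \forall z \near b, normc (z - a) < rho.
  move=> br; apply/nbhscP; exists (rho - normc (b - a)); first by rewrite subr_gt0.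
  move=> w hw; have := normcD_le (w - b) (b - a).
  by rewrite (_ : w - b + (b - a) = w - a); [lra|ring].
have dq b : normc (b - a) < rho -> 'D_1 q b =
    K * cint 0 (2 * pi) (fun t => phi t * (gam t - b)^-1 ^+ 2).
  move=> br; apply: is_derive_cvalue.
  have d0 : 0 < rho - normc (b - a) by rewrite subr_gt0.
  have H := cauchy_transform_derive p2 cgam cphi d0 (fun t _ => away b t br).
  apply: (@near_eq_is_derive R[i] C C
    (fun b => K * cint 0 (2 * pi) (fun t => phi t * (gam t - b)^-1)) q).
  by apply: filterS (nearb b br) => z hz; rewrite E.
split=> b br.
  rewrite dq// circle_intE; congr (_ * _).
  by apply: eq_cint => t _; rewrite /phi /gam mulrAC.
have d0 : 0 < rho - normc (b - a) by rewrite subr_gt0.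
have H := cauchy_transform2_derive p2 cgam cphi d0 (fun t _ => away b t br).
apply: (@near_eq_holo R
    (fun b => K * cint 0 (2 * pi) (fun t => phi t * (gam t - b)^-1 ^+ 2))).
  by apply: filterS (nearb b br) => z hz; rewrite dq.
apply: (holoM (holo_cst K b)); constructor.
by case: H.
Qed.

Lemma holo_derive (q : C -> C) (a : C) rho : 0 < rho ->
  (forall w : C, normc w <= rho -> holo q (a + w)) -> holo (fun z => 'D_1 q z) a.
Proof.
by move=> r0 hq; apply: (holo_derive_formula r0 hq).2; rewrite subrr normc0.
Qed.

Lemma cauchy_estimate (q : C -> C) (a : C) rho M : 0 < rho ->
  (forall w : C, normc w <= rho -> holo q (a + w)) ->
  (forall w : C, normc w = rho -> normc (q (a + w)) <= M) ->
  normc ('D_1 q a) <= 2 * M / rho.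
Proof.
move=> r0 hq HM; rewrite (holo_derive_formula r0 hq).1 ?subrr ?normc0//.
have wn0 w : normc w = rho -> a + w - a != 0.
  by move=> h; rewrite addrAC subrr add0r -normc_gt0 h.
have c1 : ccirc (fun w => q (a + w) * (a + w - a)^-1 ^+ 2) rho.
  apply: ccirc_holo => w hw.
  have hw' := holoD (holo_cst a w) (holo_id w).
  apply: (holoM (holo_comp hw' _)).
    by apply: hq; rewrite hw.
  exact: (holoX _ (holoV (holoB hw' (holo_cst a w)) (wn0 w hw))).
have bd w : normc w = rho ->
    normc (q (a + w) * (a + w - a)^-1 ^+ 2) <= M / rho ^+ 2.
  move=> hw; rewrite normcM normcX normcV addrAC subrr add0r hw exprVn.
  by rewrite ler_wpM2r ?HM// invr_ge0 exprn_ge0// ltW.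
rewrite (le_trans (circle_int_le (ltW r0) c1 bd))//.
by rewrite le_eqVlt; apply/orP; left; apply/eqP; field; rewrite gt_eqF.
Qed.

Lemma entire_vanishing_at_infty (h : C -> C) : (forall z : C, holo h z) ->
  (forall e : R, 0 < e -> exists M : R, forall z : C, M < normc z -> normc (h z) <= e) ->
  forall z : C, h z = 0.
Proof.
move=> hh h0 z; apply: normc_lt_eq0 => e e0.
have e3 : 0 < e / 3 by rewrite divr_gt0.
have [M HM] := h0 _ e3.
pose rho := `|M| + normc z + 1.
have r0 : 0 < rho by rewrite ltr_wpDl// addr_ge0// normc_ge0.
rewrite -(@circle_mean_value R h z rho r0 (fun w _ => hh (z + w))).
have wn0 w : normc w = rho -> w != 0 by move=> h1; rewrite -normc_gt0 h1.
have c1 : ccirc (fun w => h (z + w) / w) rho.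
  apply: ccirc_holo => w hw.
  have hw' := holoD (holo_cst z w) (holo_id w).
  exact: (holo_div (holo_comp hw' (hh _)) (holo_id w) (wn0 w hw)).
have bd w : normc w = rho -> normc (h (z + w) / w) <= e / 3 / rho.
  move=> hw; rewrite normc_div hw ler_pM2r ?invr_gt0// HM//.
  rewrite addrC (lt_le_trans _ (normcD_ge w z))// hw /rho.
  by have := ler_norm M; lra.
rewrite (le_lt_trans (circle_int_le (ltW r0) c1 bd))//.
have -> : 2 * (e / 3 / rho) * rho = 2 / 3 * e by field; rewrite gt_eqF.
by lra.
Qed.

Lemma open_mapping_at (q : C -> C) (w0 : C) rho : 0 < rho ->
  (forall w : C, normc w <= rho -> holo q (w0 + w)) ->
  (forall w : C, normc w = rho -> q (w0 + w) != q w0) ->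
  exists2 d : R, 0 < d & forall z : C, normc (z - q w0) < d ->
    exists2 w : C, normc w <= rho & q (w0 + w) = z.
Proof.
move=> r0 hq nq; have r0' := ltW r0; have p2 := ltW (pi2_gt0 R).
have hs w : normc w <= rho -> holo (fun w => q (w0 + w)) w.
  by move=> /hq; exact: (holo_comp (holoD (holo_cst w0 w) (holo_id w))).
have cq : ccirc (fun w => q (w0 + w)) rho.
  by apply: ccirc_holo => w hw; apply: hs; rewrite hw.
have cp : pcont 0 (2 * pi) (fun t => q (w0 + pol rho t) - q w0).
  exact: (pcontB (@ccirc_pcont R _ rho 0 (2 * pi) r0' cq) (@pcont_cst _ _ _ (q w0))).
have [m m0 Hm] : exists2 m : R, 0 < m & forall t, 0 <= t <= 2 * pi ->
    m <= normc (q (w0 + pol rho t) - q w0).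
  by apply: (pcont_away p2 cp) => t _; rewrite subr_eq0; apply: nq; rewrite normc_pol.
exists (m / 4); first by rewrite divr_gt0.
move=> z hz; apply: contrapT => no.
have nz w : normc w <= rho -> q (w0 + w) - z != 0.
  by move=> hw; apply/eqP => /subr0_eq e; apply: no; exists w.
have hk w : normc w <= rho -> holo (fun z' => (q z' - z)^-1) (w0 + w).
  by move=> hw; exact: (holoV (holoB (hq w hw) (holo_cst z (w0 + w))) (nz w hw)).
have := circle_mean_value r0 hk; rewrite circle_intE => H.
have nz0 := nz 0 _; rewrite normc0 addr0 in nz0; have {}nz0 := nz0 r0'.
pose N := (m * 3 / 4)^-1.
have N0 : 0 < m * 3 / 4 by lra.
have hs' w : normc w <= rho -> holo (fun w => (q (w0 + w) - z)^-1) w.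
  by move=> hw; exact: (holoV (holoB (hs w hw) (holo_cst z w)) (nz w hw)).
have pz t : pol rho t != 0 by rewrite -normc_gt0 normc_pol.
have c1 : pcont 0 (2 * pi) (fun t => (q (w0 + pol rho t) - z)^-1).
  apply: (@ccirc_pcont R (fun w => (q (w0 + w) - z)^-1) rho 0 (2 * pi) r0'); apply: ccirc_holo => w hw.
  by apply: hs'; rewrite hw.
have bd t : 0 <= t <= 2 * pi -> normc (q (w0 + pol rho t) - z)^-1 <= N.
  move=> ht; rewrite normcV lef_pV2 ?posrE ?normc_gt0 ?nz ?normc_pol//.
  have -> : q (w0 + pol rho t) - z = (q (w0 + pol rho t) - q w0) - (z - q w0) by ring.
  by have := normcB_ge (q (w0 + pol rho t) - q w0) (z - q w0); have := Hm t ht; lra.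
have : normc (q w0 - z)^-1 <= 2 * N.
  rewrite -H normcM normc_real ger0_norm ?invr_ge0// ler_pdivrMl ?pi2_gt0//.
  rewrite (@eq_cint _ _ _ _ (fun t => (q (w0 + pol rho t) - z)^-1)) => [|t _].
    rewrite (le_trans (cint_le p2 c1 bd))// subr0.
    by rewrite le_eqVlt; apply/orP; left; apply/eqP; ring.
  by rewrite divfK.
rewrite normcV => hN.
have : (normc (q w0 - z))^-1 > 2 * N.
  rewrite -[X in X < _](_ : (m * 3 / 8)^-1 = _); last by rewrite /N; field; rewrite gt_eqF.
  rewrite ltf_pV2 ?posrE ?normc_gt0//; last lra.
  by rewrite normc_sub; lra.
by rewrite ltNge hN.
Qed.

End CauchyTransform.

(** * Laurent expansions at infinity *)

Section AtInfinity.
Variable R : realType.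
Notation C := (Cplx R).

Definition cinfty : set_system C :=
  [set P | exists M : R, forall w : C, M < normc w -> P w].

Global Instance cinfty_filter : ProperFilter cinfty.
Proof.
split.
  move=> [M /(_ (`|M| + 1)%:C)]; apply; rewrite normc_real ger0_norm.
    by rewrite (le_lt_trans (ler_norm M))// ltrDl.
  by rewrite addr_ge0.
split; first by exists 0.
  move=> P Q [M HM] [N HN]; exists (Num.max M N) => w.
  by rewrite gt_max => /andP[/HM ? /HN].
by move=> P Q PQ [M HM]; exists M => w /HM /PQ.
Qed.

Lemma cvg_inftyP (q : C -> C) (l : C) : q w @[w --> cinfty] --> l <->
  forall e : R, 0 < e -> exists M : R, forall w : C, M < normc w ->
    normc (q w - l) <= e.
Proof.
split=> [/cvgcP H e /H [M HM]|H]; first by exists M => w /HM /ltW.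
apply/cvgcP => e e0; have e2 : 0 < e / 2 by rewrite divr_gt0.
have [M HM] := H _ e2; exists M => w /HM h; apply: le_lt_trans h _; lra.
Qed.

Lemma cvg_inftyM (p q : C -> C) (k l : C) : p w @[w --> cinfty] --> k ->
  q w @[w --> cinfty] --> l -> (p w * q w) @[w --> cinfty] --> k * l.
Proof. by move=> hp hq; exact: (@cvgM R[i] C cinfty _ _ _ _ _ hp hq). Qed.

Lemma cvg_inftyB (p q : C -> C) (k l : C) : p w @[w --> cinfty] --> k ->
  q w @[w --> cinfty] --> l -> (p w - q w) @[w --> cinfty] --> k - l.
Proof. by move=> hp hq; exact: (@cvgB R[i] C C cinfty _ _ _ _ _ hp hq). Qed.

Lemma cvg_inftyV (p : C -> C) (k : C) : k != 0 -> p w @[w --> cinfty] --> k ->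
  (p w)^-1 @[w --> cinfty] --> k^-1.
Proof. by move=> k0 hp; exact: (@cvgV R[i] C cinfty _ _ _ k0 hp). Qed.

Lemma cvg_inftyX (p : C -> C) (k : C) n : p w @[w --> cinfty] --> k ->
  (p w ^+ n) @[w --> cinfty] --> k ^+ n.
Proof.
move=> hp; elim: n => [|n IH].
  exact: (@cvg_cst C 1 C cinfty _).
rewrite exprS; have -> : (fun w => p w ^+ n.+1) = (fun w => p w * p w ^+ n).
  by apply/funext => w; rewrite exprS.
exact: cvg_inftyM.
Qed.

Lemma cvg_infty_cst (k : C) : (fun _ : C => k) w @[w --> cinfty] --> k.
Proof. exact: (@cvg_cst C k C cinfty _). Qed.

Lemma cvg_infty_inv : (w^-1 : C) @[w --> cinfty] --> (0 : C).
Proof.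
apply/cvg_inftyP => e e0; exists e^-1 => w hw.
have w0 : 0 < normc w by rewrite (lt_trans _ hw)// invr_gt0.
by rewrite (subr0 w^-1) normcV -[X in _ <= X]invrK lef_pV2 ?posrE ?invr_gt0// ltW.
Qed.

Lemma cvg_infty_eq (p q : C -> C) (l : C) (M : R) :
  (forall w : C, M < normc w -> p w = q w) -> p w @[w --> cinfty] --> l ->
  q w @[w --> cinfty] --> l.
Proof.
move=> pq /cvg_inftyP H; apply/cvg_inftyP => e /H [N HN].
by exists (Num.max M N) => w; rewrite gt_max => /andP[/pq <- /HN].
Qed.

Lemma circle_int_infty (q : C -> C) (l : C) rho : 0 < rho ->
  (forall w : C, rho <= normc w -> holo q w) ->
  (w * q w) @[w --> cinfty] --> l -> circle_int q rho = l.
Proof.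
by move=> r0 hq /cvg_inftyP H; apply: circle_int_at_infty.
Qed.

End AtInfinity.

Section ExteriorExpansion.
Variable R : realType.
Notation C := (Cplx R).
Variables (q : C -> C) (l : C) (r : R).
Hypotheses (r0 : 0 < r) (hq : forall w : C, r < normc w -> holo q w)
  (ql : (w * q w) @[w --> (@cinfty R)] --> l).

Lemma circle_int_disc0 (p : C -> C) s : 0 < s ->
  (forall w : C, normc w <= s -> holo p w) -> circle_int p s = 0.
Proof.
move=> s0 hp.
have h (w : C) : normc w <= s -> holo (fun w => w * p w) (0 + w).
  by move=> hw; rewrite (add0r w); exact: (holoM (holo_id w) (hp w hw)).
rewrite -[RHS](mul0r (p 0)) -(circle_mean_value s0 h).
apply: eq_circle_int => [|w hw]; first exact: ltW.
by rewrite (add0r w) mulrAC mulfV ?mul1r// -normc_gt0 hw.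
Qed.

Lemma exterior_formula (w0 : C) s : r < s -> s < normc w0 ->
  circle_int (fun w => q w * (w0 - w)^-1) s = q w0.
Proof.
move=> rs sw0; have s0 := lt_trans r0 rs.
have rw0 := lt_trans rs sw0.
have [l0 /is_cderiveP hl0] := (holoP q w0).1 (hq rw0).
pose g := diffquot q w0 l0.
have hg w : r < normc w -> w != w0 -> holo g w.
  by move=> h1 h2; exact: (diffquot_holo l0 h2 (hq h1)).
have cg w : r < normc w -> {for w, continuous g}.
  move=> hw; have [->|wb] := eqVneq w w0; first exact: diffquot_cont.
  exact: (holo_cont (hg _ hw wb)).
pose s2 := normc w0 + 1.
have s20 : normc w0 < s2 by rewrite ltrDl.
have E : circle_int g s = circle_int g s2.
  apply: (@circle_int_annulus_except R g s (normc w0) s2 s0).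
  - by rewrite sw0.
  - by move=> w /andP[h _]; apply: cg; exact: lt_le_trans h.
  - move=> w /andP[h _] hn; apply: hg; first exact: lt_le_trans h.
    by apply/eqP => e; move: hn; rewrite e eqxx.
have E2 : circle_int g s2 = - q w0.
  apply: circle_int_infty.
  - by rewrite (le_lt_trans _ s20)// normc_ge0.
  - move=> w hw; have hw' := lt_le_trans s20 hw.
    apply: hg; first exact: lt_trans hw'.
    by apply/eqP => e; move: hw'; rewrite e ltxx.
  - have H : ((w * q w) * w^-1 - q w0) * (1 - w0 * w^-1)^-1 @[w --> (@cinfty R)]
       --> (l * 0 - q w0) * (1 - w0 * 0)^-1.
      apply: cvg_inftyM.
        apply: cvg_inftyB; last exact: cvg_infty_cst.
        exact: (cvg_inftyM ql (@cvg_infty_inv R)).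
      apply: cvg_inftyV; first by rewrite mulr0 subr0 oner_neq0.
      apply: cvg_inftyB; first exact: cvg_infty_cst.
      exact: (cvg_inftyM (@cvg_infty_cst R w0) (@cvg_infty_inv R)).
    have -> : - q w0 = (l * 0 - q w0) * (1 - w0 * 0)^-1.
      by rewrite !mulr0 subr0 sub0r invr1 mulr1.
    apply: (cvg_infty_eq (M := normc w0) _ H) => w hw.
    have wn0 : w != 0 by rewrite -normc_gt0 (le_lt_trans _ hw)// normc_ge0.
    have wb : w != w0 by apply/eqP => e; move: hw; rewrite e ltxx.
    have wb0 : w - w0 != 0 by rewrite subr_eq0.
    by rewrite /g /diffquot (negPf wb); field; rewrite wn0 wb0.
have wn (w : C) : normc w <= s -> w0 - w != 0.
  move=> hw; rewrite subr_eq0; apply/eqP => e; move: sw0.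
  by rewrite e ltNge hw.
have hK (w : C) : normc w <= s -> holo (fun w => (w0 - w)^-1) w.
  by move=> hw; exact: (holoV (holoB (holo_cst w0 w) (holo_id w)) (wn w hw)).
have c1 : ccirc g s by move=> w hw; apply: cg; rewrite hw.
have c2 : ccirc (fun w => (w0 - w)^-1) s.
  by apply: ccirc_holo => w hw; apply: hK; rewrite hw.
have c3 : ccirc (fun w => q w0 * (w0 - w)^-1) s.
  exact: (ccircM (@ccirc_cst R (q w0) s) c2).
rewrite (@eq_circle_int R _ (fun w => q w0 * (w0 - w)^-1 - g w) s (ltW s0)).
  rewrite (circle_intB (ltW s0) c3 c1) (circle_intZ (q w0) (ltW s0) c2).
  by rewrite (circle_int_disc0 s0 hK) mulr0 sub0r E E2 opprK.
move=> w hw; have wb : w != w0 by apply/eqP => e; move: sw0; rewrite -e hw ltxx.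
have h1 : w0 - w != 0 by apply: wn; rewrite hw.
have h2 : w - w0 != 0 by rewrite subr_eq0.
by rewrite /g /diffquot (negPf wb); field; rewrite h1 h2.
Qed.

Lemma exterior_remainder s M (w0 : C) n : r < s -> s < normc w0 ->
  (forall w : C, normc w = s -> normc (q w) <= M) ->
  normc (q w0 - \sum_(k < n) circle_int (fun w => w ^+ k * q w) s / w0 ^+ k.+1) <=
  2 * s * M / (normc w0 - s) * (s / normc w0) ^+ n.
Proof.
move=> rs sw0 HM; have s0 := lt_trans r0 rs.
have n00 : 0 < normc w0 := lt_trans s0 sw0.
have w00 : w0 != 0 by rewrite -normc_gt0.
have wn (w : C) : normc w = s -> w0 - w != 0.
  move=> hw; rewrite subr_eq0; apply/eqP => e; move: sw0.
  by rewrite e hw ltxx.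
have cq : ccirc q s by apply: ccirc_holo => w hw; apply: hq; rewrite hw.
have cid : ccirc (fun w : C => w) s by apply: ccirc_holo => w _; exact: holo_id.
have cX k : ccirc (fun w : C => w ^+ k) s.
  by apply: ccirc_holo => w _; exact: (holoX k (holo_id w)).
have cK : ccirc (fun w => (w0 - w)^-1) s.
  apply: ccirc_holo => w hw.
  exact: (holoV (holoB (holo_cst w0 w) (holo_id w)) (wn w hw)).
have cqK := ccircM cq cK.
have cXq k := ccircM (cX k) cq.
have cS : ccirc (fun w => \sum_(k < n) w0^-1 ^+ k.+1 * (w ^+ k * q w)) s.
  elim: n => [|m IH].
    have -> : (fun w => \sum_(k < 0) w0^-1 ^+ k.+1 * (w ^+ k * q w)) = (fun=> 0).
      by apply/funext => w; rewrite big_ord0.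
    exact: ccirc_cst.
  move=> w hw; have -> : (fun w => \sum_(k < m.+1) w0^-1 ^+ k.+1 * (w ^+ k * q w)) =
     (fun w => \sum_(k < m) w0^-1 ^+ k.+1 * (w ^+ k * q w) +
       w0^-1 ^+ m.+1 * (w ^+ m * q w)).
    by apply/funext => z; rewrite big_ord_recr.
  apply: contD; first exact: IH.
  exact: (ccircM (@ccirc_cst R (w0^-1 ^+ m.+1) s) (cXq m)) hw.
have -> : q w0 - \sum_(k < n) circle_int (fun w => w ^+ k * q w) s / w0 ^+ k.+1 =
    circle_int (fun w => q w * (w0 - w)^-1 -
      \sum_(k < n) w0^-1 ^+ k.+1 * (w ^+ k * q w)) s.
  rewrite (circle_intB (ltW s0) cqK cS) (exterior_formula rs sw0); congr (_ - _).
  rewrite (@circle_int_sum R n (fun k w => w0^-1 ^+ k.+1 * (w ^+ k * q w)) s (ltW s0)).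
    apply: eq_bigr => k _.
    by rewrite (circle_intZ _ (ltW s0) (cXq k)) mulrC exprVn.
  by move=> i _; exact: (ccircM (@ccirc_cst R (w0^-1 ^+ i.+1) s) (cXq i)).
have tel w : w0 - w != 0 -> q w * (w0 - w)^-1 -
      \sum_(k < n) w0^-1 ^+ k.+1 * (w ^+ k * q w) =
    q w * (w / w0) ^+ n * (w0 - w)^-1.
  move=> h; elim: n {cS} => [|m IH].
    by rewrite big_ord0 subr0 expr0 mulr1.
  rewrite big_ord_recr /= opprD addrA IH !exprMn exprSr exprVn.
  have : w0 ^+ m != 0 by rewrite expf_neq0.
  by move=> a2; rewrite (exprS w); field; rewrite h w00 a2.
have d0 : 0 < normc w0 - s by rewrite subr_gt0.
have bd w : normc w = s -> normc (q w * (w0 - w)^-1 -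
      \sum_(k < n) w0^-1 ^+ k.+1 * (w ^+ k * q w)) <=
    M * (s / normc w0) ^+ n / (normc w0 - s).
  move=> hw; rewrite (tel w (wn w hw)) normcM normcM normcX normc_div hw normcV.
  have h1 : (normc (w0 - w))^-1 <= (normc w0 - s)^-1.
    rewrite lef_pV2 ?posrE// ?normc_gt0 ?wn//.
    by have := normcB_ge w0 w; rewrite hw.
  have n0 : 0 <= (s / normc w0) ^+ n by rewrite exprn_ge0// divr_ge0 ?ltW.
  rewrite ler_pM ?invr_ge0 ?normc_ge0// ?mulr_ge0 ?normc_ge0//.
  by rewrite ler_wpM2r// HM.
rewrite (le_trans (circle_int_le (ltW s0) (ccircB cqK cS) bd))//.
by rewrite le_eqVlt; apply/orP; left; apply/eqP; ring.
Qed.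

End ExteriorExpansion.

Section CircleSupremum.
Variable R : realType.
Notation C := (Cplx R).

Lemma pol_surj (w : C) rho : 0 < rho -> normc w = rho ->
  exists2 t : R, 0 <= t <= 2 * pi & w = pol rho t.
Proof.
move=> r0 hw; pose x := complex.Re w / rho; pose y := complex.Im w / rho.
have rn0 : rho != 0 by rewrite gt_eqF.
have xy : x ^+ 2 + y ^+ 2 = 1.
  have H : complex.Re w ^+ 2 + complex.Im w ^+ 2 = rho ^+ 2.
    rewrite -hw; case: (w) => a b; rewrite /normc /= sqr_sqrtr//.
    by rewrite addr_ge0// sqr_ge0.
  by rewrite /x /y !expr_div_n -mulrDl H mulfV// expf_neq0.
have x1 : -1 <= x <= 1.
  rewrite -ler_norml -(@ler_pXn2r _ 2)// ?nnegrE// expr1n real_normK ?num_real//.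
  by rewrite -xy lerDl sqr_ge0.
have yE : Num.sqrt (1 - x ^+ 2) = `|y|.
  by rewrite -xy addrAC subrr add0r sqrtr_sqr.
have ex : rho * x = complex.Re w by rewrite /x mulrC divfK.
have ey : rho * y = complex.Im w by rewrite /y mulrC divfK.
have wE : w = pol rho (acos x) \/ w = pol rho (2 * pi - acos x).
  have [y0|y0] := leP 0 y; [left|right].
    rewrite /pol /expi acosK ?in_itv//= sin_acos// yE ger0_norm//; simpc.
    by rewrite ex ey; case: (w).
  rewrite /pol /expi addrC mulr_natl cosD2pi sinD2pi cosN sinN.
  rewrite acosK ?in_itv//= sin_acos// yE ltr0_norm// opprK; simpc.
  by rewrite ex ey; case: (w).
have a0 := acos_ge0 x1; have api := acos_lepi x1; have p0 := pi_gt0 R.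
by case: wE => ->; [exists (acos x)|exists (2 * pi - acos x)] => //; lra.
Qed.

Lemma ccirc_bounded (q : C -> C) rho : 0 < rho -> ccirc q rho ->
  exists2 M : R, 0 < M & forall w : C, normc w = rho -> normc (q w) <= M.
Proof.
move=> r0 cq.
have [M M0 HM] := pcont_bounded (ltW (pi2_gt0 R)) (@ccirc_pcont R q rho 0 (2 * pi) (ltW r0) cq).
by exists M => // w /(pol_surj r0)[t ht ->]; exact: HM.
Qed.

Lemma normc_sum_le n (u : nat -> C) :
  normc (\sum_(k < n) u k) <= \sum_(k < n) normc (u k).
Proof.
elim: n => [|n IH]; first by rewrite !big_ord0 normc0.
by rewrite !big_ord_recr /= (le_trans (normcD_le _ _))// lerD2r.
Qed.

Lemma geometric_le (x : R) n : 0 <= x < 1 -> \sum_(k < n) x ^+ k <= (1 - x)^-1.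
Proof.
move=> /andP[x0 x1]; have d0 : 0 < 1 - x by rewrite subr_gt0.
rewrite -[X in _ <= X]mul1r ler_pdivlMr// mulrC -opprB mulNr -subrX1 opprB.
by rewrite gerBl exprn_ge0.
Qed.

Lemma expr_archimed (x M : R) : 0 <= x < 1 -> 0 < M -> exists n, x ^+ n < M.
Proof.
move=> /andP[x0 x1] M0.
have H : (x ^+ n @[n --> \oo] --> (0 : R)) by apply: cvg_expr; rewrite ger0_norm.
have /cvgrPdist_lt/(_ _ M0)[N _ HN] := H.
exists N; have := HN N (leqnn N); rewrite /= sub0r normrN ger0_norm//.
exact: exprn_ge0.
Qed.

Lemma laurent_coef_eq0 (d : nat -> C) s : 0 < s ->
  (forall w : C, s < normc w ->
     series (fun k => d k / w ^+ k.+1 : C) @ \oo --> (0 : C)) ->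
  forall k, d k = 0.
Proof.
move=> s0 H; pose tau := s + 1.
have t0 : 0 < tau by rewrite /tau; lra.
pose u k : C := d k / tau%:C ^+ k.+1.
have [B B0 HB] : exists2 B : R, 0 < B & forall k, normc (u k) <= B.
  have /cvgcP/(_ _ ltr01)[N _ HN] : series u @ \oo --> (0 : C).
    by apply: H; rewrite normc_real gtr0_norm// /tau; lra.
  exists (2 + \sum_(k < N) normc (u k)).
    by rewrite ltr_pwDl// sumr_ge0// => i _; exact: normc_ge0.
  move=> k; have [kN|Nk] := ltnP k N.
    rewrite (bigD1 (Ordinal kN))//= addrCA lerDl addr_ge0//.
    by rewrite sumr_ge0// => i _; exact: normc_ge0.
  have h1 := HN k Nk; have h2 := HN k.+1 (leqW Nk); rewrite /= in h1 h2.
  have -> : u k = (series u k.+1 - 0) - (series u k - 0).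
    by rewrite /series /= big_nat_recr//=; ring.
  have := normcB_le (series u k.+1 - 0) (series u k - 0).
  have : 0 <= \sum_(k0 < N) normc (u k0).
    by rewrite sumr_ge0// => i _; exact: normc_ge0.
  by move: h1 h2; lra.
have dB k : normc (d k) <= B * tau ^+ k.+1.
  have := HB k; rewrite /u normc_div normcX normc_real gtr0_norm//.
  by rewrite ler_pdivrMr ?exprn_gt0.
move=> n; elim/ltn_ind: n => n IH.
have key T : 2 <= T -> normc (d n) <= 2 * B * tau ^+ n.+1 / T.
  move=> T2; have T0 : 0 < T by lra.
  pose w : C := (T * tau)%:C.
  have nw : normc w = T * tau by rewrite normc_real gtr0_norm// mulr_gt0.
  have wn0 : w != 0 by rewrite -normc_gt0 nw mulr_gt0.
  have sw : s < normc w.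
    rewrite nw; have : 1 * tau <= T * tau by rewrite ler_wpM2r ?ltW//; lra.
    by rewrite /tau; lra.
  have hs := H w sw.
  apply/ler_addgt0Pl => e e0.
  have e1 : 0 < e / normc w ^+ n.+1 by rewrite divr_gt0// exprn_gt0// nw mulr_gt0.
  have /cvgcP/(_ _ e1)[N _ HN] := hs.
  pose m := (N + n.+1)%N.
  have := HN m (leq_addr _ _); rewrite /= subr0 => hm.
  have E : series (fun k => d k / w ^+ k.+1) m = d n / w ^+ n.+1 +
      \sum_(k < N) d (k + n.+1)%N / w ^+ (k + n.+1).+1.
    rewrite /series /= big_mkord.
    rewrite -(big_mkord xpredT (fun k => d k / w ^+ k.+1)).
    rewrite (@big_cat_nat _ _ _ n)//=; last by rewrite /m addnS leqW// leq_addl.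
    rewrite big_nat_cond big1 ?add0r; last first.
      by move=> i /andP[/andP[_ h] _]; rewrite IH// mul0r.
    rewrite big_ltn//; last by rewrite /m addnS ltnS leq_addl.
    congr (_ + _); rewrite -{1}(add0n n.+1) big_addn /m addnK big_mkord.
    by [].
  have tail : normc (\sum_(k < N) d (k + n.+1)%N / w ^+ (k + n.+1).+1) <=
      2 * B / T ^+ n.+2.
    rewrite (le_trans (normc_sum_le N (fun k => d (k + n.+1)%N / w ^+ (k + n.+1).+1)))//.
    have b k : normc (d (k + n.+1)%N / w ^+ (k + n.+1).+1) <=
        B / T ^+ n.+2 * T^-1 ^+ k.
      rewrite normc_div normcX nw ler_pdivrMr ?exprn_gt0 ?mulr_gt0//.
      rewrite (le_trans (dB _))// exprMn.
      have -> : (k + n.+1).+1 = (n.+2 + k)%N by rewrite addnC addSn.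
      rewrite !exprD exprVn.
      have : T ^+ n.+2 != 0 by rewrite expf_neq0// gt_eqF.
      have : T ^+ k != 0 by rewrite expf_neq0// gt_eqF.
      move=> a1 a2; rewrite le_eqVlt; apply/orP; left; apply/eqP.
      by field; rewrite a1 a2.
    apply: (@le_trans _ _ (\sum_(k < N) B / T ^+ n.+2 * T^-1 ^+ k)).
      by apply: ler_sum => k _; exact: b.
    rewrite -mulr_sumr (_ : 2 * B / T ^+ n.+2 = B / T ^+ n.+2 * 2); last by ring.
    apply: ler_wpM2l; first by rewrite divr_ge0 ?exprn_ge0 ?ltW.
    have T1 : T^-1 <= 2^-1 by rewrite lef_pV2 ?posrE//; lra.
    rewrite (le_trans (geometric_le N _))//.
      by rewrite invr_ge0 ltW//=; lra.
    rewrite -[X in _ <= X]invrK lef_pV2 ?posrE//; lra.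
  have hd : normc (d n / w ^+ n.+1) <= e / normc w ^+ n.+1 + 2 * B / T ^+ n.+2.
    have -> : d n / w ^+ n.+1 = series (fun k => d k / w ^+ k.+1) m -
       \sum_(k < N) d (k + n.+1)%N / w ^+ (k + n.+1).+1 by rewrite E addrK.
    by rewrite (le_trans (normcB_le _ _))// lerD// ltW.
  move: hd; rewrite normc_div normcX ler_pdivrMr ?exprn_gt0 ?normc_gt0// nw.
  move=> /le_trans; apply; rewrite le_eqVlt; apply/orP; left; apply/eqP.
  rewrite exprMn (exprS T n.+1).
  have : T ^+ n.+1 != 0 by rewrite expf_neq0// gt_eqF.
  have : tau ^+ n.+1 != 0 by rewrite expf_neq0// gt_eqF.
  move=> a1 a2; have a3 : T != 0 by rewrite gt_eqF.
  by field; rewrite a1 a2 a3.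
apply: normc_lt_eq0 => e e0.
pose K := 2 * B * tau ^+ n.+1.
have K0 : 0 < K by rewrite !mulr_gt0// exprn_gt0.
pose T := 2 + 2 * K / e.
have T2 : 2 <= T.
  by rewrite /T lerDl divr_ge0//; [rewrite mulr_ge0// ltW|exact: ltW].
rewrite (le_lt_trans (key T T2))// -/K ltr_pdivrMr; last lra.
rewrite /T mulrDr mulrCA mulfV ?gt_eqF// mulr1; lra.
Qed.

Lemma circle_int_indep (p : C -> C) r s s' : 0 < r ->
  (forall w : C, r < normc w -> holo p w) -> r < s -> r < s' ->
  circle_int p s = circle_int p s'.
Proof.
move=> r0 hp; wlog ss' : s s' / s <= s' => [hw rs rs'|rs rs'].
  by case: (leP s s') => h; [exact: hw|apply/esym/hw => //; exact: ltW].
move: ss'; rewrite le_eqVlt => /orP[/eqP -> //|ss'].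
apply: (circle_int_annulus (lt_trans r0 rs) ss') => w /andP[h _].
by apply: hp; exact: lt_le_trans h.
Qed.

End CircleSupremum.

Section CauchyIntegralSeries.
Variable R : realType.
Notation C := (Cplx R).
Variables (phi : C -> C) (rho : R).
Hypotheses (rho1 : 1 < rho) (cphi : ccirc phi rho).

Let rho0 : 0 < rho. Proof. exact: lt_trans ltr01 rho1. Qed.

Let coef (k : nat) : C := circle_int (fun u => phi u / u ^+ k.+1) rho.

Lemma cauchy_integral_series (w : C) : normc w < rho ->
  series (fun k => coef k * w ^+ k : C) @ \oo -->
    (circle_int (fun u => phi u / (u - w)) rho : C).
Proof.
move=> wr; have [M M0 HM] := ccirc_bounded rho0 cphi.
have un0 (u : C) : normc u = rho -> u != 0 by move=> h; rewrite -normc_gt0 h.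
have uw0 (u : C) : normc u = rho -> u - w != 0.
  by move=> h; rewrite subr_eq0; apply/eqP => e; move: wr; rewrite -e h ltxx.
have ccoef k : ccirc (fun u => phi u / u ^+ k.+1) rho.
  apply: (ccircM cphi); apply: ccirc_holo => u hu.
  exact: (holoV (holoX k.+1 (holo_id u)) (expf_neq0 k.+1 (un0 u hu))).
have cterm k : ccirc (fun u => w ^+ k * (phi u / u ^+ k.+1)) rho.
  exact: (ccircM (@ccirc_cst R (w ^+ k) rho) (ccoef k)).
have cK : ccirc (fun u => phi u / (u - w)) rho.
  apply: (ccircM cphi); apply: ccirc_holo => u hu.
  exact: (holoV (holoB (holo_id u) (holo_cst w u)) (uw0 u hu)).
have csum m : ccirc (fun u => \sum_(k < m) w ^+ k * (phi u / u ^+ k.+1)) rho.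
  elim: m => [|m IH].
    have -> : (fun u => \sum_(k < 0) w ^+ k * (phi u / u ^+ k.+1)) = (fun=> 0).
      by apply/funext => u; rewrite big_ord0.
    exact: ccirc_cst.
  move=> u hu; have -> : (fun u => \sum_(k < m.+1) w ^+ k * (phi u / u ^+ k.+1)) =
     (fun u => \sum_(k < m) w ^+ k * (phi u / u ^+ k.+1) + w ^+ m * (phi u / u ^+ m.+1)).
    by apply/funext => u'; rewrite big_ord_recr.
  by apply: contD; [exact: IH|exact: cterm].
have E m : series (fun k => coef k * w ^+ k : C) m -
     circle_int (fun u => phi u / (u - w)) rho =
    - circle_int (fun u => phi u / (u - w) - \sum_(k < m) w ^+ k * (phi u / u ^+ k.+1)) rho.
  rewrite (circle_intB (ltW rho0) cK (csum m)) opprB; congr (_ - _).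
  rewrite (@circle_int_sum R m (fun k u => w ^+ k * (phi u / u ^+ k.+1)) rho (ltW rho0)).
    rewrite /series /= big_mkord; apply: eq_bigr => k _.
    by rewrite (circle_intZ _ (ltW rho0) (ccoef k)) mulrC.
  by move=> k _; exact: cterm.
have tel (u : C) m : normc u = rho ->
    phi u / (u - w) - \sum_(k < m) w ^+ k * (phi u / u ^+ k.+1) =
    phi u * (w / u) ^+ m / (u - w).
  move=> hu; have u0 := un0 u hu; have uw := uw0 u hu.
  elim: m => [|m IH]; first by rewrite big_ord0 subr0 expr0 mulr1.
  rewrite big_ord_recr /= opprD addrA IH !expr_div_n (exprSr u) (exprSr w).
  have : u ^+ m != 0 by rewrite expf_neq0.
  move: (u ^+ m) (w ^+ m) => x y x0.
  by field; rewrite uw u0 x0.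
have d0 : 0 < rho - normc w by rewrite subr_gt0.
have x01 : 0 <= normc w / rho < 1.
  by rewrite divr_ge0 ?normc_ge0 ?(ltW rho0)//= ltr_pdivrMr ?mul1r.
apply/cvgcP => e e0.
have K0 : 0 < 2 * (M / (rho - normc w)) * rho by rewrite !mulr_gt0// invr_gt0.
have [m0 Hm0] := expr_archimed x01 (divr_gt0 e0 K0).
exists m0 => // m /= m0m; rewrite E normc_opp.
have bd (u : C) : normc u = rho ->
    normc (phi u / (u - w) - \sum_(k < m) w ^+ k * (phi u / u ^+ k.+1)) <=
    M / (rho - normc w) * (normc w / rho) ^+ m.
  move=> hu; rewrite (tel u m hu) normc_div normcM normcX normc_div hu mulrAC.
  rewrite ler_wpM2r ?exprn_ge0//; first by case/andP: x01.
  rewrite ler_pM ?invr_ge0 ?normc_ge0// ?HM//.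
  rewrite lef_pV2 ?posrE ?normc_gt0 ?uw0//.
  by have := normcB_ge u w; rewrite hu.
rewrite (le_lt_trans (circle_int_le (ltW rho0) (ccircB cK (csum m)) bd))//.
have -> : 2 * (M / (rho - normc w) * (normc w / rho) ^+ m) * rho =
   (normc w / rho) ^+ m * (2 * (M / (rho - normc w)) * rho) by ring.
rewrite -ltr_pdivlMr// (le_lt_trans _ Hm0)//; case/andP: x01 => x0 /ltW x1.
by rewrite -(subnK m0m) exprD ler_piMl ?exprn_ge0// exprn_ile1.
Qed.

Lemma cauchy_integral_cont (w : C) : normc w < rho ->
  {for w, continuous (fun w => circle_int (fun u => phi u / (u - w)) rho : C)}.
Proof.
move=> wr; have d0 : 0 < rho - normc w by rewrite subr_gt0.
have away t : 0 <= t <= 2 * pi -> rho - normc w <= normc (pol rho t - w).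
  by move=> _; have := normcB_ge (pol rho t) w; rewrite normc_pol// ltW.
have [H _] := cauchy_transform_derive (ltW (pi2_gt0 R)) (@pcont_pol R 0 (2 * pi) rho)
  (@ccirc_pcontM R phi rho 0 (2 * pi) (ltW rho0) cphi) d0 away.
have hK := holoM (holo_cst ((2 * pi)^-1)%:C w) (Holo H).
have -> : (fun w => circle_int (fun u => phi u / (u - w)) rho : C) =
   (fun z => ((2 * pi)^-1)%:C * cint 0 (2 * pi)
   (fun t => phi (pol rho t) * pol rho t * (pol rho t - z)^-1)).
  apply/funext => y; rewrite circle_intE; congr (_ * _).
  by apply: eq_cint => t _; rewrite mulrAC.
exact: (holo_cont hK).
Qed.

Lemma series_extends_to_one (H : C -> C) :
  {within [set w : C | `|w| <= 1], continuous H} ->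
  (forall w : C, `|w| < 1 -> H w = circle_int (fun u => phi u / (u - w)) rho) ->
  forall x : R, 0 <= x <= 1 ->
  series (fun k => coef k * x%:C ^+ k : C) @ \oo --> (H x%:C : C).
Proof.
move=> cH eH x /andP[x0 x1].
pose A (w : C) : C := circle_int (fun u => phi u / (u - w)) rho.
have nx (y : R) : 0 <= y -> normc (y%:C : C) = y by move=> y0; rewrite normc_real ger0_norm.
have eHx (y : R) : 0 <= y < 1 -> H y%:C = A y%:C.
  by move=> /andP[y0 y1]; apply: eH; rewrite normrE_normc nx// ltcR.
suff -> : H x%:C = A x%:C.
  by apply: cauchy_integral_series; rewrite nx//; exact: le_lt_trans rho1.
move: x1; rewrite le_eqVlt => /orP[/eqP xE|x1]; last by apply: eHx; rewrite x0.
rewrite xE; apply/eqP; rewrite -subr_eq0; apply/eqP/normc_lt_eq0 => e e0.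
have e2 : 0 < e / 2 by lra.
have n1 : normc (1%:C : C) < rho by rewrite nx.
have /ccontP/(_ _ e2)[d1 d10 Hd1] := cauchy_integral_cont n1.
have D1 : [set w : C | `|w| <= 1] 1%:C by rewrite /= normrE_normc nx// lecR.
have /subspace_continuousP/(_ _ D1) cH1 := cH.
have /(_ _) := (@cvgcP R C (within [set w : C | `|w| <= 1] (nbhs (1%:C : C))) _ H (H 1%:C)).1 cH1.
move=> /(_ _ e2); rewrite /within /= => /nbhscP[d2 d20 Hd2].
pose m := Num.min 1 (Num.min d1 d2).
have m0 : 0 < m by rewrite !lt_min ltr01 d10.
have m1 : m <= 1 by rewrite ge_min lexx.
have md1 : m <= d1 by rewrite !ge_min lexx orbT.
have md2 : m <= d2 by rewrite !ge_min lexx !orbT.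
pose y := 1 - m / 2.
have y0 : 0 <= y by rewrite /y; lra.
have y1 : y < 1 by rewrite /y; lra.
have ny : normc (y%:C - 1%:C : C) = m / 2.
  by rewrite -rmorphB /= normc_real /y ler0_norm; lra.
have h1 := Hd1 y%:C; rewrite ny in h1.
have h2 := Hd2 y%:C; rewrite ny in h2.
have {}h1 := h1 _; have {}h2 := h2 _.
have i1 : m / 2 < d1 by lra.
have i2 : m / 2 < d2 by lra.
have Dy : `|y%:C : C| <= 1 by rewrite normrE_normc nx// lecR ltW.
have k1 := h1 i1; have k2 := h2 i2 Dy.
have E : H y%:C = A y%:C by apply: eHx; rewrite y0.
rewrite -/(A 1%:C) -/(A y%:C) in k1.
have -> : H 1%:C - A 1%:C = (A y%:C - A 1%:C) - (H y%:C - H 1%:C).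
  by rewrite E opprB [RHS]addrC addrA subrK.
by rewrite (le_lt_trans (normcB_le _ _))// (splitr e) ltrD.
Qed.

End CauchyIntegralSeries.

(** * Bernstein coefficients of monomials *)

Section BernsteinCoefficients.
Variables (R : realType) (n : nat).
Hypothesis n0 : (0 < n)%N.

(* [bern_coef p j] is the probability that j balls in n boxes occupy exactly p
   of them; conditioning on the last ball gives [bern_coef_rec]. *)
Definition bern_coef (p j : nat) : R :=
  'C(n, p)%:R * \sum_(k < p.+1) (-1) ^+ (p - k) * 'C(p, k)%:R * (k%:R / n%:R) ^+ j.

Local Notation D := bern_coef.
Local Notation N := (n%:R : R).

Let N0 : 0 < N. Proof. by rewrite ltr0n. Qed.
Let Nn0 : N != 0. Proof. by rewrite gt_eqF. Qed.
Lemma bern_coef_gt p j : (n < p)%N -> D p j = 0.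
Proof. by move=> np; rewrite /D bin_small// mul0r. Qed.

Lemma bern_coef_0 p : D p 0 = (p == 0)%:R.
Proof.
rewrite /D (_ : \sum_(k < p.+1) _ = (-1 + 1) ^+ p).
  by rewrite addNr expr0n; case: p => [|p]; rewrite ?bin0 ?mul1r// mulr0.
rewrite exprDn; apply: eq_bigr => k _.
by rewrite expr0 mulr1 expr1n mulr1 mulr_natr.
Qed.

Lemma bern_coef_0S j : D 0 j.+1 = 0.
Proof. by rewrite /D big_ord1 mul0r exprS mul0r !mulr0. Qed.

Lemma bin_diff p k : k%:R * 'C(p.+1, k)%:R = p.+1%:R * ('C(p.+1, k)%:R - 'C(p, k)%:R) :> R.
Proof.
case: k => [|k]; first by rewrite !bin0 subrr mul0r mulr0.
have -> : 'C(p.+1, k.+1)%:R - 'C(p, k.+1)%:R = 'C(p, k)%:R :> R.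
  by rewrite binS natrD addrAC subrr add0r.
by rewrite -!natrM -mul_bin_diag.
Qed.

Lemma bin_rec p : p.+1%:R * 'C(n, p.+1)%:R = (N - p%:R) * 'C(n, p)%:R :> R.
Proof.
have [pn|np] := leqP p n; last by rewrite !bin_small// ?mulr0// ltnW.
by rewrite -natrB// -!natrM mul_bin_left.
Qed.

Lemma bern_coef_rec p j :
  D p.+1 j.+1 = p.+1%:R / N * D p.+1 j + (1 - p%:R / N) * D p j.
Proof.
pose phi (k : nat) : R := (k%:R / N) ^+ j.
pose S q : R := \sum_(k < q.+1) (-1) ^+ (q - k) * 'C(q, k)%:R * phi k.
have E : \sum_(k < p.+2) (-1) ^+ (p.+1 - k) * 'C(p.+1, k)%:R * (k%:R / N) ^+ j.+1 =
    p.+1%:R / N * (S p.+1 + S p).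
  have -> : S p.+1 + S p = \sum_(k < p.+2) (-1) ^+ (p.+1 - k) *
      ('C(p.+1, k)%:R - 'C(p, k)%:R) * phi k.
    rewrite (eq_bigr (fun k : 'I_p.+2 => (-1) ^+ (p.+1 - k) * 'C(p.+1, k)%:R * phi k -
       (-1) ^+ (p.+1 - k) * 'C(p, k)%:R * phi k)); last by move=> k _; ring.
    rewrite sumrB; congr (_ + _).
    rewrite big_ord_recr /= bin_small// mulr0 mul0r addr0 -sumrN.
    apply: eq_bigr => k _; rewrite subSn; last by rewrite -ltnS.
    by rewrite exprS mulN1r !mulNr opprK.
  rewrite mulr_sumr; apply: eq_bigr => k _.
  rewrite exprS -/(phi k) [LHS](_ : _ = (-1) ^+ (p.+1 - k) *
     (k%:R * 'C(p.+1, k)%:R) / N * phi k); last by ring.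
  by rewrite bin_diff; ring.
rewrite /D E -/(S p.+1) -/(S p) mulrCA !mulrDr; congr (_ + _).
rewrite [LHS](_ : _ = (p.+1%:R * 'C(n, p.+1)%:R) / N * S p); last by ring.
by rewrite bin_rec; field.
Qed.

Lemma bern_coef_lt p j : (j < p)%N -> D p j = 0.
Proof.
elim: j p => [|j IH] [|p]// jp; first by rewrite bern_coef_0.
by rewrite bern_coef_rec !IH ?mulr0 ?addr0//; exact: leqW.
Qed.

Lemma bern_coef_ge0 p j : 0 <= D p j.
Proof.
elim: j p => [|j IH] p; first by rewrite bern_coef_0.
case: p => [|p]; first by rewrite bern_coef_0S.
rewrite bern_coef_rec addr_ge0//; first by rewrite mulr_ge0// divr_ge0.
have [pn|np] := leqP p n; last by rewrite (bern_coef_gt _ np) mulr0.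
by rewrite mulr_ge0// subr_ge0 ler_pdivrMr// mul1r ler_nat.
Qed.

Lemma bern_coef_sum j : \sum_(p < j.+1) D p j = 1.
Proof.
elim: j => [|j IH]; first by rewrite big_ord1 bern_coef_0.
rewrite big_ord_recl bern_coef_0S add0r.
rewrite (eq_bigr (fun p : 'I_j.+1 => p.+1%:R / N * D p.+1 j + (1 - p%:R / N) * D p j)); last first.
  by move=> p _; exact: bern_coef_rec.
pose g (p : nat) : R := p%:R / N * D p j.
have sh : \sum_(p < j.+1) g p.+1 = \sum_(p < j.+1) g p.
  have g0 : g 0%N = 0 by rewrite /g !mul0r.
  have gl : g j.+1 = 0 by rewrite /g bern_coef_lt// mulr0.
  transitivity (\sum_(p < j.+2) g p).
    rewrite [RHS]big_ord_recl -[LHS]add0r; congr (_ + _).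
    exact: (esym g0).
  by rewrite big_ord_recr /= gl addr0.
rewrite big_split /= sh -big_split /= -[RHS]IH; apply: eq_bigr => p _.
by rewrite /g; ring.
Qed.

Local Notation alpha j := (D j j).
Local Notation B2 j := ('C(j, 2)%:R / N).

Lemma bin2_le j : 'C(j, 2)%:R <= j%:R ^+ 2 / 2 :> R.
Proof.
rewrite ler_pdivlMr// -natrX -natrM ler_nat bin2 muln2 halfK.
rewrite (leq_trans (leq_subr _ _))//; case: j => // j /=.
by rewrite -mulnn leq_mul2l leqnSn orbT.
Qed.

Lemma alpha_rec j : alpha j.+1 = (1 - j%:R / N) * alpha j.
Proof. by rewrite bern_coef_rec (bern_coef_lt (ltnSn j)) mulr0 add0r. Qed.

Lemma alpha_le1 j : alpha j <= 1.
Proof.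
by rewrite -(bern_coef_sum j) big_ord_recr /= lerDr sumr_ge0// => p _; exact: bern_coef_ge0.
Qed.

Lemma B2S j : B2 j.+1 = B2 j + j%:R / N.
Proof. by rewrite binS bin1 natrD mulrDl. Qed.

Lemma alpha_defect j : 1 - alpha j <= B2 j.
Proof.
elim: j => [|j IH]; first by rewrite bern_coef_0 subrr divr_ge0.
rewrite alpha_rec B2S.
have : j%:R / N * alpha j <= j%:R / N.
  by rewrite ler_piMr ?divr_ge0// alpha_le1.
by move: IH; lra.
Qed.

Lemma increment_le j : j%:R / N * B2 j <= j%:R ^+ 3 / 2 / N ^+ 2.
Proof.
rewrite (_ : j%:R / N * B2 j = j%:R * 'C(j, 2)%:R / N ^+ 2); last by field.
rewrite ler_pM2r ?invr_gt0 ?exprn_gt0//.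
rewrite (_ : j%:R ^+ 3 / 2 = j%:R * (j%:R ^+ 2 / 2)); last by field.
by rewrite ler_wpM2l// bin2_le.
Qed.

Lemma quartic_step j : (j%:R ^+ 4 + j%:R ^+ 3) / N ^+ 2 <= j.+1%:R ^+ 4 / N ^+ 2.
Proof.
rewrite ler_pM2r ?invr_gt0 ?exprn_gt0//.
have j0 : 0 <= j%:R :> R by [].
have -> : j.+1%:R = j%:R + 1 :> R by rewrite -natr1.
have -> : (j%:R + 1) ^+ 4 = j%:R ^+ 4 + j%:R ^+ 3 +
  (3 * j%:R ^+ 3 + 6 * j%:R ^+ 2 + 4 * j%:R + 1) :> R by ring.
by rewrite lerDl !addr_ge0// mulr_ge0// exprn_ge0.
Qed.

Lemma alpha_second j : 0 <= alpha j - 1 + B2 j <= j%:R ^+ 4 / N ^+ 2.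
Proof.
elim: j => [|j /andP[h1 h2]].
  by rewrite bern_coef_0 subrr bin0n mul0r addr0 expr0n mul0r lexx.
have d0 : 0 <= j%:R / N * (1 - alpha j).
  by rewrite mulr_ge0 ?divr_ge0// subr_ge0 alpha_le1.
have d1 : j%:R / N * (1 - alpha j) <= j%:R / N * B2 j.
  by rewrite ler_wpM2l ?divr_ge0// alpha_defect.
have d2 := increment_le j; have d3 := quartic_step j.
have d4 : 0 <= j%:R ^+ 3 / N ^+ 2 by rewrite divr_ge0// exprn_ge0// ltW.
have E : alpha j.+1 - 1 + B2 j.+1 = alpha j - 1 + B2 j + j%:R / N * (1 - alpha j).
  by rewrite alpha_rec B2S; ring.
rewrite E addr_ge0//= (le_trans _ d3)//.
rewrite mulrDl lerD// (le_trans d1)// (le_trans d2)//.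
rewrite (_ : _ / 2 / _ = j%:R ^+ 3 / N ^+ 2 / 2); last by field.
by lra.
Qed.

Lemma beta_le j : D j j.+1 <= B2 j.+1.
Proof.
elim: j => [|j IH]; first by rewrite bern_coef_0S divr_ge0.
rewrite bern_coef_rec B2S addrC lerD//.
  rewrite (le_trans _ IH)// ler_piMl ?bern_coef_ge0 ?lerBlDr ?lerDl ?divr_ge0//.
by rewrite ler_piMr ?divr_ge0// alpha_le1.
Qed.

Lemma beta_second j : 0 <= B2 j.+1 - D j j.+1 <= j.+1%:R ^+ 4 / N ^+ 2.
Proof.
rewrite subr_ge0 beta_le /=; elim: j => [|j IH].
  by rewrite bern_coef_0S subr0 bin_small// mul0r divr_ge0 ?exprn_ge0// ltW.
rewrite (le_trans _ (quartic_step j.+1))//.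
have E : B2 j.+2 - D j.+1 j.+2 = (B2 j.+1 - D j j.+1) +
   (j.+1%:R / N * (1 - alpha j.+1) + j%:R / N * D j j.+1).
  by rewrite bern_coef_rec (B2S j.+1); ring.
rewrite E mulrDl lerD//.
have d1 : j.+1%:R / N * (1 - alpha j.+1) <= j.+1%:R / N * B2 j.+1.
  by rewrite ler_wpM2l ?divr_ge0// alpha_defect.
have d2 : j%:R / N * D j j.+1 <= j.+1%:R / N * B2 j.+1.
  rewrite ler_pM ?bern_coef_ge0 ?divr_ge0 ?beta_le//.
  by rewrite ler_pM2r ?invr_gt0// ler_nat.
have d3 := increment_le j.+1.
rewrite (_ : _ / 2 / _ = j.+1%:R ^+ 3 / N ^+ 2 / 2) in d3; last by field.
by move: d1 d2 d3; lra.
Qed.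

End BernsteinCoefficients.

Section SeriesBounds.
Variable R : realType.
Notation C := (Cplx R).

Lemma quartic_geometric (x : R) : 0 <= x < 1 -> exists2 K : R, 0 < K &
  forall M, \sum_(j < M) j.+1%:R ^+ 4 * x ^+ j <= K.
Proof.
move=> /andP[x0 x1]; pose d := (1 - x) / 30.
have d0 : 0 < d by rewrite /d; lra.
have d1 : d <= 1 by rewrite /d; lra.
have d0' := ltW d0.
pose y := (1 + d) ^+ 4 * x.
have y0 : 0 <= y by rewrite /y mulr_ge0// exprn_ge0//; lra.
have q : (1 + d) ^+ 4 <= 1 + 15 * d.
  have a1 : d ^+ 2 <= d by rewrite expr2 ler_piMl.
  have a2 : d ^+ 3 <= d.
    by rewrite exprS ler_piMr// exprn_ile1.
  have a3 : d ^+ 4 <= d.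
    by rewrite exprS ler_piMr// exprn_ile1.
  rewrite (_ : (1 + d) ^+ 4 = 1 + 4 * d + 6 * d ^+ 2 + 4 * d ^+ 3 + d ^+ 4); last by ring.
  by lra.
have y1 : y < 1.
  have : y <= (1 + 15 * d) * x by rewrite /y ler_wpM2r.
  have : x * (1 - x) <= 1 * (1 - x) by rewrite ler_wpM2r//; lra.
  by rewrite /d; move: x1; nra.
exists (d ^- 4 / (1 - y)).
  by rewrite divr_gt0 ?subr_gt0// invr_gt0 exprn_gt0.
have bern j : d * j.+1%:R <= (1 + d) ^+ j.
  have : 1 + j%:R * d <= (1 + d) ^+ j.
    elim: j => [|j IH]; first by rewrite mul0r addr0 expr0.
    rewrite exprS -natr1.
    have : 0 <= j%:R * d * d by apply: mulr_ge0 => //; apply: mulr_ge0.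
    have : (1 + d) * (1 + j%:R * d) <= (1 + d) * (1 + d) ^+ j.
      by rewrite ler_wpM2l//; lra.
    lra.
  by rewrite -natr1; lra.
move=> M; apply: (@le_trans _ _ (\sum_(j < M) d ^- 4 * y ^+ j)).
  apply: ler_sum => j _; have yE : y ^+ j = ((1 + d) ^+ 4) ^+ j * x ^+ j by rewrite -exprMn.
  rewrite yE [X in _ <= X]mulrA; apply: ler_wpM2r; first exact: exprn_ge0.
  rewrite -exprM mulnC exprM -exprVn -exprMn lerXn2r ?nnegrE//.
    by rewrite mulr_ge0 ?invr_ge0 ?exprn_ge0//; lra.
  by rewrite -ler_pdivrMl ?invr_gt0// invrK.
rewrite -mulr_sumr ler_wpM2l ?geometric_le ?y0//.
by rewrite invr_ge0 exprn_ge0.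
Qed.

Lemma series_lim_bound (u : nat -> C) (l : C) (K : R) :
  (forall M, \sum_(k < M) normc (u k) <= K) ->
  series u @ \oo --> l -> normc l <= K.
Proof.
move=> hK /cvgcP hl; apply/ler_addgt0Pr => e e0.
have [N _ HN] := hl e e0.
have := HN N (leqnn N); rewrite /= normc_sub => h.
rewrite -(subrK (series u N) l) (le_trans (normcD_le _ _))// addrC lerD//.
  rewrite /series /= big_mkord (le_trans (normc_sum_le N u))//.
exact: ltW.
Qed.

Lemma abs_series_cvg (u : nat -> C) (K : R) :
  (forall M, \sum_(k < M) normc (u k) <= K) ->
  exists l : C, series u @ \oo --> l.
Proof.
move=> hK.
have real (v : nat -> R) : (forall k, `|v k| <= normc (u k)) ->
    exists l : R, series v @ \oo --> l.
  move=> hv; apply/cvg_ex; apply: normed_cvg.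
  apply: nondecreasing_is_cvgn.
    by apply: (@nondecreasing_series R (fun k => `|v k|) xpredT 0%N).
  exists K => _ [M _ <-].
  rewrite [X in X <= _](_ : _ = \sum_(k < M) `|v k|); last first.
    by rewrite -(big_mkord xpredT (fun k => `|v k|)).
  by rewrite (le_trans _ (hK M))// ler_sum.
have [a ha] := real _ (fun k => normc_Re (u k)).
have [b hb] := real _ (fun k => normc_Im (u k)).
exists (a +i* b); apply/cvgcP => e e0.
have e2 : 0 < e / 2 by rewrite divr_gt0.
have /cvgrPdistC_lt/(_ _ e2)[N1 _ H1] := ha.
have /cvgrPdistC_lt/(_ _ e2)[N2 _ H2] := hb.
exists (maxn N1 N2) => // m /=; rewrite geq_max => /andP[m1 m2].
have E : series u m = (\sum_(0 <= k < m) complex.Re (u k)) +i*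
    (\sum_(0 <= k < m) complex.Im (u k)).
  rewrite /series /=; elim: (m) => [|k IH]; first by rewrite !big_nil.
  by rewrite !big_nat_recr//= IH; case: (u k) => p q; simpc.
move: E; rewrite /series /= => ->.
rewrite (le_lt_trans (normc_le_ReIm _))//= (splitr e) ltrD//.
  exact: H1.
exact: H2.
Qed.

Lemma cvg_finite_sum n (u : nat -> nat -> C) (l : nat -> C) :
  (forall i, (i < n)%N -> u i @ \oo --> l i) ->
  (fun M => \sum_(i < n) u i M : C) @ \oo --> (\sum_(i < n) l i : C).
Proof.
elim: n => [|n IH] h.
  rewrite big_ord0; have -> : (fun M => \sum_(i < 0) u i M : C) = (fun=> 0).
    by apply/funext => M; rewrite big_ord0.
  exact: (@cvg_cst C 0 nat \oo _).
rewrite big_ord_recr /=.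
have -> : (fun M => \sum_(i < n.+1) u i M : C) = (fun M => \sum_(i < n) u i M + u n M).
  by apply/funext => M; rewrite big_ord_recr.
apply: (@cvgD R[i] C nat \oo); last exact: h.
by apply: IH => i ni; apply: h; exact: ltnW.
Qed.

Lemma cvg_scale (k : C) (u : nat -> C) (l : C) : u @ \oo --> l ->
  (fun M => k * u M) @ \oo --> k * l.
Proof.
move=> h; exact: (@cvgM R[i] nat \oo _ _ _ _ _ (@cvg_cst C k nat \oo _) h).
Qed.

Lemma cvg_seriesB (u v : nat -> C) (k l : C) : series u @ \oo --> k ->
  series v @ \oo --> l -> series (fun i => u i - v i) @ \oo --> k - l.
Proof.
move=> hu hv.
have -> : series (fun i => u i - v i) = (fun M => series u M - series v M).
  by apply/funext => M; rewrite /series /= -sumrB.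
exact: (@cvgB R[i] C nat \oo _ _ _ _ _ hu hv).
Qed.

Lemma cvg_seriesZ (c : C) (u : nat -> C) (k : C) : series u @ \oo --> k ->
  series (fun i => c * u i) @ \oo --> c * k.
Proof.
move=> hu.
have -> : series (fun i => c * u i) = (fun M => c * series u M).
  by apply/funext => M; rewrite /series /= -mulr_sumr.
exact: cvg_scale.
Qed.

End SeriesBounds.

Section BernsteinEstimate.
Variable R : realType.
Notation C := (Cplx R).

Definition bern_sum (H : C -> C) (F : nat -> C) (n : nat) : C :=
  \sum_(p < n.+1) ('C(n, p)%:R * fwd_diff H (n%:R^-1)%R p * F p).

Definition bern_mono (F : nat -> C) (n j : nat) : C :=
  \sum_(p < j.+1) (bern_coef R n p j)%:C * F p.

Lemma sum_ord_zero_tail m m' (g : nat -> C) : (m <= m')%N ->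
  (forall p, (m <= p)%N -> g p = 0) -> \sum_(p < m') g p = \sum_(p < m) g p.
Proof.
move=> mm' g0; rewrite -(subnKC mm'); elim: (m' - m)%N => [|k IH]; first by rewrite addn0.
by rewrite addnS big_ord_recr /= IH g0 ?addr0// leq_addr.
Qed.

Lemma bern_sum_cvg (a : nat -> C) (H : C -> C) (F : nat -> C) n : (0 < n)%N ->
  (forall x : R, 0 <= x <= 1 ->
    series (fun k => a k * x%:C ^+ k : C) @ \oo --> (H x%:C : C)) ->
  series (fun j => a j * bern_mono F n j : C) @ \oo --> bern_sum H F n.
Proof.
move=> n0 hH.
pose w p k : C := 'C(n, p)%:R * ((-1) ^+ (p - k) * 'C(p, k)%:R) * F p.
pose x (k : nat) : R := k%:R / n%:R.
have E1 : bern_sum H F n = \sum_(p < n.+1) \sum_(k < p.+1) w p k * H (x k)%:C.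
  apply: eq_bigr => p _; rewrite /fwd_diff mulrAC mulr_sumr.
  by apply: eq_bigr => k _; rewrite /w /x; ring.
rewrite E1.
have -> : series (fun j => a j * bern_mono F n j : C) = (fun M =>
   \sum_(p < n.+1) \sum_(k < p.+1) w p k * series (fun j => a j * (x k)%:C ^+ j) M).
  apply/funext => M.
  have B j : bern_mono F n j = \sum_(p < n.+1) \sum_(k < p.+1) w p k * (x k)%:C ^+ j.
    have -> : bern_mono F n j = \sum_(p < n.+1) (bern_coef R n p j)%:C * F p.
      have zj p : (j.+1 <= p)%N -> (bern_coef R n p j)%:C * F p = 0.
        by move=> jp; rewrite (bern_coef_lt R n0 jp) mul0r.
      have zn p : (n.+1 <= p)%N -> (bern_coef R n p j)%:C * F p = 0.
        by move=> np; rewrite (bern_coef_gt R j np) mul0r.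
      rewrite /bern_mono -(sum_ord_zero_tail (leq_maxl j.+1 n.+1) zj).
      by rewrite (sum_ord_zero_tail (leq_maxr j.+1 n.+1) zn).
    apply: eq_bigr => p _; rewrite /bern_coef rmorphM rmorph_sum /= rmorph_nat.
    rewrite mulrAC mulr_sumr; apply: eq_bigr => k _.
    have -> : ((-1) ^+ (p - k) * 'C(p, k)%:R * (k%:R / n%:R) ^+ j)%:C =
        (-1) ^+ (p - k) * 'C(p, k)%:R * (x k)%:C ^+ j :> R[i].
      rewrite (rmorphM (real_complex R)) (rmorphM (real_complex R)) !(rmorphXn (real_complex R)).
      by rewrite (rmorphN1 (real_complex R)) (rmorph_nat (real_complex R)).
    by rewrite /w; ring.
  rewrite /series /=.
  rewrite (eq_bigr (fun j => \sum_(p < n.+1) \sum_(k < p.+1) w p k * (a j * (x k)%:C ^+ j))).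
    rewrite exchange_big /=; apply: eq_bigr => p _.
    by rewrite exchange_big /=; apply: eq_bigr => k _; rewrite mulr_sumr.
  move=> j _; rewrite B mulr_sumr; apply: eq_bigr => p _.
  by rewrite mulr_sumr; apply: eq_bigr => k _; rewrite mulrCA.
apply: (@cvg_finite_sum R n.+1 (fun p M => \sum_(k < p.+1) w p k * series (fun j => a j * (x k)%:C ^+ j) M)
  (fun p => \sum_(k < p.+1) w p k * H (x k)%:C)) => p pn.
apply: (@cvg_finite_sum R p.+1 (fun k M => w p k * series (fun j => a j * (x k)%:C ^+ j) M)
  (fun k => w p k * H (x k)%:C)) => k kp.
apply: cvg_scale; apply: hH; rewrite /x divr_ge0//=.
by rewrite ler_pdivrMr ?ltr0n// mul1r ler_nat -ltnS (leq_trans kp).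
Qed.

Section Monomials.
Variables (F : nat -> C) (A s : R) (n : nat).
Hypotheses (n0 : (0 < n)%N) (A0 : 0 <= A) (s1 : 1 <= s).
Hypothesis hF : forall p, normc (F p) <= A * s ^+ p.

Local Notation D := (bern_coef R n).
Local Notation N := (n%:R : R).

Let hFle p j : (p <= j)%N -> normc (F p) <= A * s ^+ j.
Proof. by move=> pj; rewrite (le_trans (hF p))// ler_wpM2l// ler_weXn2l. Qed.

Let sumD_le m j : (m <= j)%N ->
  normc (\sum_(p < m) (D p j)%:C * F p) <= (\sum_(p < m) D p j) * (A * s ^+ j).
Proof.
move=> mj; rewrite (le_trans (normc_sum_le m (fun p => (D p j)%:C * F p)))// mulr_suml.
apply: ler_sum => p _; rewrite normcM normc_real ger0_norm ?bern_coef_ge0//.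
by rewrite ler_wpM2l ?bern_coef_ge0// hFle// (leq_trans (ltnW (ltn_ord p))).
Qed.

Let As0 j : 0 <= A * s ^+ j.
Proof. by rewrite mulr_ge0// exprn_ge0// (le_trans ler01). Qed.

Lemma bern_mono_first j :
  normc (bern_mono F n j - F j) <= j%:R ^+ 2 / N * (A * s ^+ j).
Proof.
have Sj := bern_coef_sum R n0 j; rewrite big_ord_recr /= in Sj.
rewrite /bern_mono big_ord_recr /=.
have -> : \sum_(p < j) (D p j)%:C * F p + (D j j)%:C * F j - F j =
   \sum_(p < j) (D p j)%:C * F p - (1 - D j j)%:C * F j.
  by rewrite rmorphB /=; ring.
rewrite (le_trans (normcB_le _ _))// normcM normc_real.
have al := alpha_le1 R n0 j.
rewrite ger0_norm ?subr_ge0//.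
have h1 := sumD_le (leqnn j).
have E : \sum_(p < j) D p j = 1 - D j j by rewrite -Sj addrK.
rewrite E in h1.
have h2 : (1 - D j j) * normc (F j) <= (1 - D j j) * (A * s ^+ j).
  by rewrite ler_wpM2l ?subr_ge0.
have h3 : 2 * (1 - D j j) <= j%:R ^+ 2 / N.
  have := alpha_defect R n0 j.
  have : 'C(j, 2)%:R / N <= j%:R ^+ 2 / 2 / N.
    by rewrite ler_pM2r ?invr_gt0 ?ltr0n// bin2_le.
  rewrite (mulrAC _ _ N^-1); lra.
have := ler_wpM2r (As0 j) h3; move: h1 h2; lra.
Qed.

Lemma bern_mono_second j :
  normc (bern_mono F n j - F j - ('C(j, 2)%:R / N)%:C * (F j.-1 - F j)) <=
  3 * (j%:R ^+ 4 / N ^+ 2) * (A * s ^+ j).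
Proof.
case: j => [|j].
  rewrite /bern_mono big_ord1 bern_coef_0 bin0n mul0r /= mul0r mul1r subr0 subrr normc0.
  by rewrite mulr_ge0// mulr_ge0// divr_ge0 ?exprn_ge0.
have Sj := bern_coef_sum R n0 j.+1; rewrite !big_ord_recr /= in Sj.
rewrite /bern_mono !big_ord_recr /=.
have /andP[a0 a1] := alpha_second R n0 j.+1.
have /andP[b0 b1] := beta_second R n0 j.
set B := 'C(j.+1, 2)%:R / N in a0 a1 b0 b1 *.
set al := D j.+1 j.+1 in a0 a1 Sj *.
set be := D j j.+1 in b0 b1 Sj *.
set Q := j.+1%:R ^+ 4 / N ^+ 2 in a1 b1 *.
set T := A * s ^+ j.+1.
have T0 : 0 <= T by exact: As0.
have h1 := sumD_le (leqW (leqnn j)).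
have -> : \sum_(p < j) (D p j.+1)%:C * F p + be%:C * F j + al%:C * F j.+1 - F j.+1 -
    B%:C * (F j - F j.+1) =
   \sum_(p < j) (D p j.+1)%:C * F p - (B - be)%:C * F j + (al - 1 + B)%:C * F j.+1.
  by rewrite rmorphB rmorphD rmorphB /=; ring.
have E : \sum_(p < j) D p j.+1 <= Q.
  by move: Sj a0 b1; set S := \sum_(p < j) _; lra.
have k1 : (\sum_(p < j) D p j.+1) * T <= Q * T by rewrite ler_wpM2r.
have k2 : (B - be) * normc (F j) <= Q * T by rewrite ler_pM// ?normc_ge0// hFle.
have k3 : (al - 1 + B) * normc (F j.+1) <= Q * T by rewrite ler_pM// ?normc_ge0// hFle.
rewrite (le_trans (normcD_le _ _))//.
have := normcB_le (\sum_(p < j) (D p j.+1)%:C * F p) ((B - be)%:C * F j).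
rewrite !normcM !normc_real !ger0_norm//.
by move: h1 k1 k2 k3; rewrite -/T; lra.
Qed.

End Monomials.

Theorem bern_estimate (A s Ma rho : R) : 0 < A -> 1 <= s -> s < rho -> 0 < Ma ->
  exists2 K : R, 0 < K & forall (n : nat) (F a : nat -> C) (H : C -> C) (h : C),
  (0 < n)%N -> (forall p, normc (F p) <= A * s ^+ p) ->
  (forall k, normc (a k) <= Ma * rho^-1 ^+ k) ->
  (forall x : R, 0 <= x <= 1 ->
    series (fun k => a k * x%:C ^+ k : C) @ \oo --> (H x%:C : C)) ->
  series (fun k => a k * F k : C) @ \oo --> h ->
  [/\ normc h <= K, normc (bern_sum H F n - h) <= K / n%:R &
   exists2 S : C, series (fun k => ('C(k.+2, 2)%:R / n%:R)%:C *
       (F k.+1 - F k.+2) * a k.+2 : C) @ \oo --> S &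
     normc (bern_sum H F n - h - S) <= K / n%:R ^+ 2].
Proof.
move=> A0 s1 srho Ma0; have rho0 : 0 < rho by lra.
have x01 : 0 <= s / rho < 1.
  by rewrite divr_ge0 ?ltW//= ?ltr_pdivrMr ?mul1r//; lra.
have [K4 K40 HK] := quartic_geometric x01.
exists (3 * (A * Ma) * K4); first by rewrite !mulr_gt0.
move=> n F a H h n0 hF ha hH hh.
have N0 : 0 < n%:R :> R by rewrite ltr0n.
have A0' := ltW A0; have Ma0' := ltW Ma0; have N0' := ltW N0; have K40' := ltW K40.
have AM : 0 < A * Ma by rewrite mulr_gt0.
have sk k : 0 <= A * s ^+ k by rewrite mulr_ge0 ?ltW// exprn_gt0//; lra.
have bound (u : nat -> C) (c : R) : 0 <= c ->
    (forall j, normc (u j) <= c * j.+1%:R ^+ 4 * (A * s ^+ j)) ->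
    forall M, \sum_(j < M) normc (a j * u j) <= c * (A * Ma) * K4.
  move=> c0 hu M; apply: (@le_trans _ _ (\sum_(j < M) c * (A * Ma) * (j.+1%:R ^+ 4 * (s / rho) ^+ j))).
    apply: ler_sum => j _; rewrite normcM (le_trans (ler_pM _ _ (ha j) (hu j))) ?normc_ge0//.
    rewrite le_eqVlt; apply/orP; left; apply/eqP.
    by rewrite exprMn; ring.
  by rewrite -mulr_sumr ler_wpM2l// !mulr_ge0.
have pos4 j : 0 <= j.+1%:R ^+ 4 :> R by rewrite exprn_ge0.
have p1 j : 1 <= j.+1%:R ^+ 4 :> R by rewrite exprn_ege1// ler1n.
have p2 j : j%:R ^+ 2 <= j.+1%:R ^+ 4 :> R.
  apply: (@le_trans _ _ (j.+1%:R ^+ 2)); last by rewrite ler_weXn2l// ler1n.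
  by rewrite lerXn2r ?nnegrE// ler_nat.
have p4 j : j%:R ^+ 4 <= j.+1%:R ^+ 4 :> R by rewrite lerXn2r ?nnegrE// ler_nat.
have K0 : 0 < A * Ma * K4 by rewrite mulr_gt0.
have hB := @bern_sum_cvg a H F n n0 hH.
have hD : series (fun j => a j * (bern_mono F n j - F j) : C) @ \oo --> bern_sum H F n - h.
  have -> : (fun j => a j * (bern_mono F n j - F j) : C) =
      (fun j => a j * bern_mono F n j - a j * F j).
    by apply/funext => j; rewrite mulrBr.
  exact: cvg_seriesB.
pose T j : C := ('C(j, 2)%:R / n%:R)%:C * (F j.-1 - F j).
have C2 j : 'C(j, 2)%:R / n%:R <= j%:R ^+ 2 / 2 / n%:R :> R.
  by rewrite ler_pM2r ?invr_gt0// bin2_le.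
have hFp j : normc (F j.-1) <= A * s ^+ j.
  by rewrite (le_trans (hF _))// ler_wpM2l// ler_weXn2l// leq_pred.
have bT : forall M, \sum_(j < M) normc (a j * T j) <= n%:R^-1 * (A * Ma) * K4.
  apply: bound; first by rewrite invr_ge0.
  move=> j; rewrite /T normcM normc_real ger0_norm ?divr_ge0//.
  have h1 : normc (F j.-1 - F j) <= 2 * (A * s ^+ j).
    by rewrite (le_trans (normcB_le _ _))//; have := hF j; have := hFp j; lra.
  have h2 : 'C(j, 2)%:R / n%:R <= j.+1%:R ^+ 4 / 2 / n%:R :> R.
    by rewrite (le_trans (C2 j))// !ler_pM2r ?invr_gt0.
  rewrite (le_trans (ler_pM _ _ h2 h1)) ?normc_ge0 ?divr_ge0//.
  rewrite le_eqVlt; apply/orP; left; apply/eqP; field.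
  by rewrite gt_eqF.
have [S hS] := @abs_series_cvg R (fun j => a j * T j) _ bT.
split.
- apply: (series_lim_bound _ hh) => M.
  have := bound F 1 ler01 _ M; rewrite mul1r => b.
  rewrite (le_trans (b _))//; last by lra.
  by move=> j; rewrite mul1r (le_trans (hF j))// ler_peMl.
- apply: (series_lim_bound _ hD) => M.
  have := bound (fun j => bern_mono F n j - F j) n%:R^-1 _ _ M.
  move=> /(_ _)/wrap[|/(_ _)/wrap[j|b]]; first by rewrite invr_ge0.
    rewrite (le_trans (bern_mono_first n0 (ltW A0) s1 hF j))// ler_wpM2r//.
    by rewrite mulrC ler_wpM2l// invr_ge0.
  rewrite (le_trans b)// -mulrA mulrC ler_pM2r ?invr_gt0//; lra.
exists S.
  have hS2 : series (fun j => a j * T j) (M + 2) @[M --> \oo] --> S.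
    have := hS; rewrite -(cvg_shiftn 2); exact.
  have -> // : series (fun k => ('C(k.+2, 2)%:R / n%:R)%:C * (F k.+1 - F k.+2) * a k.+2 : C) =
     (fun M => series (fun j => a j * T j) (M + 2)%N).
  apply/funext => M; rewrite /series /= !big_mkord addn2.
  rewrite 2!big_ord_recl /= /T /= !bin_small// !mul0r !mulr0 !add0r.
  by apply: eq_bigr => k _; rewrite mulrC.
have hR : series (fun j => a j * (bern_mono F n j - F j - T j) : C) @ \oo -->
    bern_sum H F n - h - S.
  have -> : (fun j => a j * (bern_mono F n j - F j - T j) : C) =
      (fun j => a j * (bern_mono F n j - F j) - a j * T j).
    by apply/funext => j; rewrite -mulrBr.
  exact: (@cvg_seriesB R (fun j => a j * (bern_mono F n j - F j)) (fun j => a j * T j) _ _ hD hS).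
apply: (series_lim_bound _ hR) => M.
have := bound (fun j => bern_mono F n j - F j - T j) (3 / n%:R ^+ 2) _ _ M.
move=> /(_ _)/wrap[|/(_ _)/wrap[j|b]]; first by rewrite divr_ge0// exprn_ge0.
  rewrite (le_trans (bern_mono_second n0 (ltW A0) s1 hF j))// ler_wpM2r//.
  rewrite [X in _ <= X]mulrAC -[X in _ <= X]mulrA ler_wpM2l// ler_wpM2r//.
rewrite (le_trans b)// le_eqVlt; apply/orP; left; apply/eqP; ring.
Qed.

End BernsteinEstimate.

(** * Faber polynomials of the exterior map *)

Section ExteriorMap.
Variable R : realType.
Notation C := (Cplx R).
Variables (G : set C) (Psi : C -> C) (c : R).
Hypothesis hPsi : forall w : C, 1 < normc w -> holo Psi w.
Hypothesis injPsi : forall w1 w2 : C, 1 < normc w1 -> 1 < normc w2 ->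
  Psi w1 = Psi w2 -> w1 = w2.
Hypothesis imPsi : forall z : C, ~ G z <-> exists2 w : C, 1 < normc w & Psi w = z.
Hypothesis c0 : 0 < c.
Hypothesis limPsi : (Psi w / w) @[w --> (@cinfty R)] --> (c%:C : C).

Local Notation dPsi := ('D_1 Psi).
Local Notation cC := (c%:C : C).

Lemma cC_neq0 : cC != 0.
Proof. by rewrite -normc_gt0 normc_real gtr0_norm. Qed.

Lemma holo_dPsi (w : C) : 1 < normc w -> holo dPsi w.
Proof.
move=> hw; apply: (@holo_derive R Psi w ((normc w - 1) / 2)); first lra.
move=> h hh; apply: hPsi; have := normcD_ge w h; lra.
Qed.

Lemma lim_dPsi : dPsi w @[w --> (@cinfty R)] --> cC.
Proof.
apply/cvg_inftyP => e e0; have e6 : 0 < e / 6 by rewrite divr_gt0.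
have /cvg_inftyP/(_ _ e6)[M HM] := limPsi.
exists (Num.max 4 (2 * `|M|)) => w; rewrite gt_max => /andP[w4 wM].
have w2 : 0 < normc w / 2 by lra.
pose q (z : C) := Psi z - c%:C * z.
have hq (h : C) : normc h <= normc w / 2 -> holo q (w + h).
  move=> hh; apply: (holoB _ (holoM (holo_cst c%:C (w + h)) (holo_id (w + h)))).
  by apply: hPsi; have := normcD_ge w h; lra.
have dq : 'D_1 q w = dPsi w - c%:C.
  have w1 : 1 < normc w by lra.
  case: (hPsi w1) => /derivableP dP.
  apply: is_derive_cvalue.
  have d2 := is_deriveM (is_derive_cst cC w 1) (is_derive_id (w : C) 1).
  have := is_deriveB dP d2.
  by rewrite /GRing.scale /= mulr0 addr0 mulr1.
rewrite -dq.
have bd h : normc h = normc w / 2 -> normc (q (w + h)) <= e / 6 * (3 / 2 * normc w).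
  move=> hh; have l1 : normc (w + h) <= 3 / 2 * normc w.
    by have := normcD_le w h; lra.
  have l2 : M < normc (w + h).
    by have := normcD_ge w h; have := ler_norm M; lra.
  have n0 : 0 < normc (w + h) by have := normcD_ge w h; lra.
  have wh0 : w + h != 0 by rewrite -normc_gt0.
  have -> : q (w + h) = (Psi (w + h) / (w + h) - c%:C) * (w + h).
    by rewrite /q mulrBl divfK.
  rewrite normcM ler_pM ?normc_ge0//; exact: HM.
rewrite (le_trans (cauchy_estimate w2 hq bd))//.
have w0 : 0 < normc w by lra.
by rewrite le_eqVlt; apply/orP; left; apply/eqP; field; rewrite gt_eqF.
Qed.

Lemma Psi_growth (L : R) : exists M : R, forall w : C, M < normc w ->
  L < normc (Psi w).
Proof.
have c2 : 0 < c / 2 by rewrite divr_gt0.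
have /cvg_inftyP/(_ _ c2)[M HM] := limPsi.
exists (Num.max M (Num.max 1 (2 * L / c))) => w.
rewrite !gt_max => /and3P[/HM h1 w1 h2].
have w0 : 0 < normc w by lra.
have wn0 : w != 0 by rewrite -normc_gt0.
have : c / 2 <= normc (Psi w / w).
  have := normcB_ge cC (c%:C - Psi w / w).
  by rewrite subKr normc_real gtr0_norm// normc_sub; have := c0; move: h1; lra.
rewrite normc_div ler_pdivlMr//; apply: lt_le_trans.
by move: h2; rewrite ltr_pdivrMr//; have := c0; lra.
Qed.

Definition inside (rho : R) : set C :=
  [set z | forall w : C, rho <= normc w -> Psi w != z].

Definition insidec (rho : R) : set C :=
  [set z | forall w : C, rho < normc w -> Psi w != z].

Lemma inside_insidec rho z : inside rho z -> insidec rho z.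
Proof. by move=> h w /ltW /h. Qed.

Lemma insidec_inside r s z : r < s -> insidec r z -> inside s z.
Proof. by move=> rs h w sw; apply: h; exact: lt_le_trans sw. Qed.

Lemma insidec_le r s z : r <= s -> insidec r z -> insidec s z.
Proof. by move=> rs h w sw; apply: h; exact: le_lt_trans sw. Qed.

Lemma G_insidec rho z : 1 <= rho -> G z -> insidec rho z.
Proof.
move=> r1 Gz w rw; apply/eqP => e.
have : ~ G z by apply/imPsi; exists w => //; exact: le_lt_trans rw.
exact.
Qed.

Lemma Psi_insidec (v : C) : 1 < normc v -> insidec (normc v) (Psi v).
Proof.
move=> v1 w vw; apply/eqP => e; have := injPsi (lt_trans v1 vw) v1 e.
by move=> e'; move: vw; rewrite e' ltxx.
Qed.

Lemma Psi_insidec_le (v : C) rho : 1 < normc v <= rho -> insidec rho (Psi v).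
Proof. by move=> /andP[v1 vr]; apply: insidec_le vr _; exact: Psi_insidec. Qed.

Lemma lim_kernel (z : C) : (w * (Psi w - z)^-1) @[w --> (@cinfty R)] --> (cC^-1).
Proof.
have H : (Psi w / w - z * w^-1)^-1 @[w --> (@cinfty R)] --> (cC - z * 0)^-1.
  apply: cvg_inftyV; first by rewrite mulr0 subr0 cC_neq0.
  apply: (cvg_inftyB limPsi).
  exact: (cvg_inftyM (@cvg_infty_cst R z) (@cvg_infty_inv R)).
rewrite mulr0 subr0 in H.
have [M HM] := Psi_growth (normc z).
apply: (cvg_infty_eq (M := Num.max 0 M) _ H) => w.
rewrite gt_max => /andP[w0 /HM hw].
have wn0 : w != 0 by rewrite -normc_gt0.
have d0 : Psi w - z != 0 by rewrite subr_eq0; apply/eqP => e; move: hw; rewrite e ltxx.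
by rewrite -mulrBl invfM invrK mulrC.
Qed.

Lemma open_exterior r (w0 : C) : 1 <= r -> r < normc w0 ->
  exists2 d : R, 0 < d & forall z : C, normc (z - Psi w0) < d ->
    exists2 w : C, r < normc w & Psi w = z.
Proof.
move=> r1 rw0; pose rho := (normc w0 - r) / 2.
have rho0 : 0 < rho by rewrite /rho; lra.
have hl (w : C) : normc w <= rho -> r < normc (w0 + w).
  by move=> hw; have := normcD_ge w0 w; move: hw; rewrite /rho; lra.
have [|w hw|d d0 H] := open_mapping_at rho0 (q := Psi) (w0 := w0).
- by move=> w hw; apply: hPsi; rewrite (le_lt_trans r1)// hl.
- apply/eqP => e; have := injPsi (le_lt_trans r1 (hl w _)) (le_lt_trans r1 rw0) e.
  rewrite hw lexx => /(_ isT) /eqP; rewrite -subr_eq0 addrAC subrr add0r => /eqP w00.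
  by move: rho0; rewrite -hw w00 normc0 ltxx.
exists d => // z /H[w hw <-]; exists (w0 + w) => //; exact: hl.
Qed.

Lemma closure_insidec r z : 1 <= r -> closure (insidec r) z -> insidec r z.
Proof.
move=> r1 hz w rw; apply/eqP => e.
have [d d0 H] := open_exterior r1 rw.
have [y [hy1 hy2]] : (insidec r `&` [set y : C | normc (y - z) < d]) !=set0.
  by apply: hz; apply/nbhscP; exists d.
move: hy2; rewrite /= -e => /H[w' rw' e'].
by have := hy1 w' rw'; rewrite e' eqxx.
Qed.

Lemma disc_uniform (M : R) (P : R -> C -> Prop) :
  (forall w : C, exists2 d : R, 0 < d & forall w' : C, normc (w' - w) < d ->
     forall e, 0 < e < d -> P e w') ->
  exists2 d : R, 0 < d & forall e, 0 < e < d ->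
    forall w : C, normc w <= M -> P e w.
Proof.
move=> h.
have N : \forall e \near (0 : R)^'+, forall x, - M <= x <= M ->
    forall y, - M <= y <= M -> P e (x +i* y).
  apply: (@near_segment R R (0 : R)^'+ _ (- M) M (fun e x =>
    forall y, - M <= y <= M -> P e (x +i* y))) => x _.
  have := @near_segment R (R * R)%type (filter_prod (nbhs x) (0 : R)^'+) _ (- M) M
    (fun xe y => P xe.2 (xe.1 +i* y)).
  apply => y _.
  have [d d0 Hd] := h (x +i* y).
  have d2 : 0 < d / 2 by rewrite divr_gt0.
  exists ([set y' | `|y - y'| < d / 2],
      [set xe : R * R | `|x - xe.1| < d / 2 /\ 0 < xe.2 < d]) => /=.
    split; first by apply/nbhs_normP; exists (d / 2).
    exists ([set x' | `|x - x'| < d / 2], [set e | 0 < e < d]) => /=.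
      split; first by apply/nbhs_normP; exists (d / 2).
      near=> e; apply/andP; split; near: e; first exact: nbhs_right_gt.
      exact: nbhs_right_lt.
    by move=> [x' e] [].
  move=> [y' [x' e]] /= [hy [hx he]]; apply: Hd => //.
  rewrite (le_lt_trans (normc_le_ReIm _))//= (splitr d) ltrD//.
    by rewrite distrC.
  by rewrite distrC.
have [d d0 Hd] := N; exists d => // e /andP[e0 ed] w hw.
have b1 := le_trans (normc_Re w) hw; have b2 := le_trans (normc_Im w) hw.
rewrite (_ : w = complex.Re w +i* complex.Im w); last by case: (w).
apply: (Hd e) => //; last 2 first.
- by rewrite -ler_norml.
- by rewrite -ler_norml.
by rewrite /ball_ /= sub0r normrN gtr0_norm.
Unshelve. all: by end_near. Qed.

Lemma open_inside rho z : 1 < rho -> inside rho z ->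
  exists2 d : R, 0 < d & forall z' : C, normc (z' - z) < d -> inside rho z'.
Proof.
move=> r1 hz; have [M HM] := Psi_growth (normc z + 1).
have H w : exists2 d : R, 0 < d & forall w' : C, normc (w' - w) < d ->
     forall e, 0 < e < d -> rho <= normc w' -> e <= normc (Psi w' - z).
  have [rw|wr] := leP rho (normc w); last first.
    exists (rho - normc w); first by rewrite subr_gt0.
    move=> w' h e _ h2; have := normcB_ge w' w; move: h h2; lra.
  have m0 : 0 < normc (Psi w - z) by rewrite normc_gt0 subr_eq0; exact: hz.
  set m := normc _ in m0.
  have m2 : 0 < m / 2 by lra.
  have /holo_cont/ccontP/(_ _ m2)[d d0 Hd] := hPsi (lt_le_trans r1 rw).
  exists (Num.min d (m / 2)); first by rewrite lt_min d0.
  move=> w'; rewrite lt_min => /andP[/Hd h _] e /andP[_]; rewrite lt_min => /andP[_ em] _.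
  have := normcB_ge (Psi w - z) (Psi w - Psi w').
  rewrite (_ : Psi w - z - (Psi w - Psi w') = Psi w' - z); last by ring.
  by rewrite -/m normc_sub; move: h em; lra.
have [d d0 Hd] := disc_uniform M H.
exists (Num.min (d / 2) 1); first by rewrite lt_min divr_gt0//=.
move=> z'; rewrite lt_min => /andP[h1 h2] w rw; apply/eqP => e.
have [wM|Mw] := leP (normc w) M.
  have d2 : 0 < d / 2 < d by apply/andP; split; lra.
  have := Hd _ d2 w wM rw; rewrite e leNgt.
  by rewrite h1.
have := HM _ Mw; rewrite e.
have := normcD_le (z' - z) z; rewrite subrK.
by move: h2; lra.
Qed.

Lemma insidec_bounded r : 1 <= r ->
  exists L : R, forall z : C, insidec r z -> normc z <= L.
Proof.
move=> r1; pose s := r + 1; have s0 : 0 < s by rewrite /s; lra.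
have rs : r < s by rewrite /s; lra.
have cP : ccirc Psi s.
  by apply: ccirc_holo => w hw; apply: hPsi; rewrite hw; lra.
have [B B0 HB] := pcont_bounded (ltW (pi2_gt0 R)) (@ccirc_pcont R Psi s 0 (2 * pi) (ltW s0) cP).
exists (B + 4 * s * c) => z hz; rewrite leNgt; apply/negP => big.
pose N := normc z - B; have N0 : 0 < N by rewrite /N; have := mulr_gt0 s0 c0; lra.
have nz (w : C) : r < normc w -> Psi w - z != 0 by move=> hw; rewrite subr_eq0; exact: hz.
have hq (w : C) : r < normc w -> holo (fun w => (Psi w - z)^-1) w.
  move=> hw; apply: (holoV (holoB (hPsi _) (holo_cst z w)) (nz w hw)).
  exact: le_lt_trans hw.
have hq' (w : C) : s <= normc w -> holo (fun w => (Psi w - z)^-1) w.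
  by move=> hw; apply: hq; exact: lt_le_trans hw.
have E := circle_int_infty s0 hq' (lim_kernel z).
have cq : ccirc (fun w => (Psi w - z)^-1) s.
  by apply: ccirc_holo => w hw; apply: hq'; rewrite hw.
have bd t : 0 <= t <= 2 * pi ->
    normc ((Psi (pol s t) - z)^-1 * pol s t) <= N^-1 * s.
  move=> ht; rewrite normcM normc_pol ?(ltW s0)// ler_wpM2r ?(ltW s0)// normcV.
  rewrite lef_pV2 ?posrE// ?normc_gt0 ?nz ?normc_pol ?(ltW s0)//.
  by rewrite normc_sub; have := normcB_ge z (Psi (pol s t)); have := HB t ht; rewrite /N; lra.
have : normc (cC^-1) <= 2 * (N^-1 * s).
  rewrite -E circle_intE normcM normc_real ger0_norm ?invr_ge0 ?(ltW (pi2_gt0 R))//.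
  rewrite ler_pdivrMl ?pi2_gt0//.
  have := cint_le (ltW (pi2_gt0 R)) (@ccirc_pcontM R _ s 0 (2 * pi) (ltW s0) cq) bd.
  by rewrite subr0 => /le_trans; apply; rewrite mulrC.
rewrite normcV normc_real gtr0_norm// => h.
have : N <= 2 * s * c.
  rewrite -ler_pdivrMr// -[X in X <= _]mulrC -ler_pdivlMr//.
  by move: h; rewrite (mulrC N^-1) mulrA.
by have := mulr_gt0 s0 c0; rewrite /N; move: big; lra.
Qed.

Lemma insidec_away r s : 1 <= r -> r < s -> exists2 d : R, 0 < d &
  forall t z, 0 <= t <= 2 * pi -> insidec r z -> d <= normc (Psi (pol s t) - z).
Proof.
move=> r1 rs; have s0 : 0 < s by lra.
have cP : ccirc Psi s.
  by apply: ccirc_holo => w hw; apply: hPsi; rewrite hw; lra.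
have : \forall e \near (0 : R)^'+, forall t, 0 <= t <= 2 * pi ->
    forall z, insidec r z -> e <= normc (Psi (pol s t) - z).
  apply: (@near_segment R R (0 : R)^'+ _ 0 (2 * pi) (fun e t =>
    forall z, insidec r z -> e <= normc (Psi (pol s t) - z))) => t ht.
  have rp : r < normc (pol s t) by rewrite normc_pol// ltW.
  have [d d0 Hd] := open_exterior r1 rp.
  have d2 : 0 < d / 2 by lra.
  have /contcP/(_ _ d2) Ht := @ccirc_pcont R Psi s 0 (2 * pi) (ltW s0) cP t ht.
  exists ([set t' | normc (Psi (pol s t') - Psi (pol s t)) < d / 2], [set e | 0 < e < d / 2]) => /=.
    split => //.
    near=> e; apply/andP; split; near: e; first exact: nbhs_right_gt.
    exact: nbhs_right_lt.
  move=> [t' e] /= [h1 /andP[_ h2]] z hz; rewrite leNgt; apply/negP => h3.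
  have [|w rw e'] := Hd z.
    have := normcB_le (Psi (pol s t') - Psi (pol s t)) (Psi (pol s t') - z).
    rewrite (_ : _ - _ - _ = z - Psi (pol s t)); last by ring.
    lra.
  by have := hz w rw; rewrite e' eqxx.
move=> [d d0 Hd]; exists (d / 2); first by rewrite divr_gt0.
move=> t z ht hz; apply: Hd => //=; last by rewrite divr_gt0.
by rewrite sub0r normrN gtr0_norm ?divr_gt0//; move: d0 => /=; lra.
Unshelve. all: by end_near. Qed.

Definition kern (z w : C) : C := dPsi w * (Psi w - z)^-1.

Definition faberC (n : nat) (s : R) (z : C) : C :=
  circle_int (fun w => w ^+ n * kern z w) s.

Lemma insidec_neq r (z w : C) : insidec r z -> r < normc w -> Psi w - z != 0.
Proof. by move=> hz hw; rewrite subr_eq0; exact: hz. Qed.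

Lemma holo_inv_kern r (z w : C) : 1 <= r -> insidec r z -> r < normc w ->
  holo (fun w => (Psi w - z)^-1) w.
Proof.
move=> r1 hz hw.
exact: (holoV (holoB (hPsi (le_lt_trans r1 hw)) (holo_cst z w)) (insidec_neq hz hw)).
Qed.

Lemma holo_kern r (z w : C) : 1 <= r -> insidec r z -> r < normc w ->
  holo (kern z) w.
Proof.
move=> r1 hz hw.
exact: (holoM (holo_dPsi (le_lt_trans r1 hw)) (holo_inv_kern r1 hz hw)).
Qed.

Lemma lim_kern (z : C) : (w * kern z w) @[w --> (@cinfty R)] --> (1 : C).
Proof.
have H := cvg_inftyM lim_dPsi (lim_kernel z).
have -> : (1 : C) = cC * cC^-1 by rewrite mulfV// cC_neq0.
apply: (cvg_infty_eq (M := 0) _ H) => w _.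
by rewrite /kern mulrCA.
Qed.

Lemma ccircX_kern n r s z : 1 <= r -> r < s -> insidec r z ->
  ccirc (fun w => w ^+ n * kern z w) s.
Proof.
move=> r1 rs hz; apply: ccirc_holo => w hw.
apply: (holoM (holoX n (holo_id w)) (holo_kern r1 hz _)).
by rewrite hw.
Qed.

Lemma faberC0 r s z : 1 <= r -> r < s -> insidec r z -> faberC 0 s z = 1.
Proof.
move=> r1 rs hz; have s0 : 0 < s by lra.
rewrite /faberC (@eq_circle_int R _ (kern z) s (ltW s0)) => [|w _]; last first.
  by rewrite expr0 mul1r.
apply: (circle_int_infty s0 _ (lim_kern z)) => w hw.
by apply: (holo_kern r1 hz); exact: lt_le_trans hw.
Qed.

Lemma inv_geometric (P z0 z : C) m : P - z0 != 0 -> P - z != 0 ->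
  (P - z)^-1 = \sum_(j < m) (z - z0) ^+ j * (P - z0)^-1 ^+ j.+1 +
    (z - z0) ^+ m * ((P - z0)^-1 ^+ m * (P - z)^-1).
Proof.
move=> a b; elim: m => [|m IH]; first by rewrite big_ord0 !expr0 add0r !mul1r.
rewrite big_ord_recr /= {1}IH -addrA; congr (_ + _).
rewrite !exprSr.
have : (P - z0)^-1 ^+ m != 0 by rewrite expf_neq0// invr_eq0.
move: ((P - z0)^-1 ^+ m) ((z - z0) ^+ m) => x y _.
by field; rewrite a b.
Qed.

Definition faber_dcoef (z0 : C) (n j : nat) : C :=
  circle_int (fun w => w ^+ n * dPsi w * (Psi w - z0)^-1 ^+ j.+1) 2.

Lemma faberC_poly (z0 : C) n r s z : G z0 -> 1 <= r -> r < s -> insidec r z ->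
  (\sum_(j < n.+1) (faber_dcoef z0 n j) *: ('X - z0%:P) ^+ j).[z] = faberC n s z.
Proof.
move=> Gz0 r1 rs hz; have s0 : 0 < s by lra.
have i0 : insidec 1 z0 by exact: G_insidec.
have s1 : 1 < s by exact: le_lt_trans rs.
have hA (w : C) : 1 < normc w -> holo (fun w => w ^+ n * dPsi w) w.
  by move=> hw; exact: (holoM (holoX n (holo_id w)) (holo_dPsi hw)).
have hu j (w : C) : 1 < normc w -> holo (fun w => (Psi w - z0)^-1 ^+ j) w.
  by move=> hw; exact: (holoX j (holo_inv_kern (lexx 1) i0 hw)).
have hAu j (w : C) : 1 < normc w ->
    holo (fun w => w ^+ n * dPsi w * (Psi w - z0)^-1 ^+ j) w.
  by move=> hw; exact: (holoM (hA w hw) (hu j w hw)).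
have hrem (w : C) : r < normc w -> holo (fun w => w ^+ n * dPsi w *
    (Psi w - z0)^-1 ^+ n.+1 * (Psi w - z)^-1) w.
  move=> hw; exact: (holoM (hAu n.+1 w (le_lt_trans r1 hw)) (holo_inv_kern r1 hz hw)).
have cA j : ccirc (fun w => w ^+ n * dPsi w * (Psi w - z0)^-1 ^+ j) s.
  by apply: ccirc_holo => w hw; apply: hAu; rewrite hw.
have crem : ccirc (fun w => w ^+ n * dPsi w * (Psi w - z0)^-1 ^+ n.+1 * (Psi w - z)^-1) s.
  by apply: ccirc_holo => w hw; apply: hrem; rewrite hw.
have zero : circle_int (fun w => w ^+ n * dPsi w * (Psi w - z0)^-1 ^+ n.+1 * (Psi w - z)^-1) s = 0.
  apply: (circle_int_infty s0).
    by move=> w hw; apply: hrem; exact: lt_le_trans hw.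
  have H := cvg_inftyM (cvg_inftyM (cvg_inftyX (n := n.+1) (lim_kernel z0)) lim_dPsi)
    (cvg_inftyM (lim_kernel z) (@cvg_infty_inv R)).
  have -> : (0 : C) = cC^-1 ^+ n.+1 * cC * (cC^-1 * 0) by rewrite !mulr0.
  apply: (cvg_infty_eq (M := 0) _ H) => w w0.
  have wn0 : w != 0 by rewrite -normc_gt0.
  rewrite exprMn (exprS w).
  move: ((Psi w - z0)^-1 ^+ n.+1) ((Psi w - z)^-1) ('D_1 Psi w) (w ^+ n) => a b d e.
  by field.
have cterm j : ccirc (fun w => (z - z0) ^+ j * (w ^+ n * dPsi w * (Psi w - z0)^-1 ^+ j.+1)) s.
  exact: (ccircM (@ccirc_cst R ((z - z0) ^+ j) s) (cA j.+1)).
have csum m : ccirc (fun w => \sum_(j < m) (z - z0) ^+ j *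
    (w ^+ n * dPsi w * (Psi w - z0)^-1 ^+ j.+1)) s.
  elim: m => [|m IH].
    have -> : (fun w => \sum_(j < 0) (z - z0) ^+ j *
        (w ^+ n * dPsi w * (Psi w - z0)^-1 ^+ j.+1)) = (fun=> 0).
      by apply/funext => w; rewrite big_ord0.
    exact: ccirc_cst.
  move=> w hw; have -> : (fun w => \sum_(j < m.+1) (z - z0) ^+ j *
        (w ^+ n * dPsi w * (Psi w - z0)^-1 ^+ j.+1)) =
     (fun w => \sum_(j < m) (z - z0) ^+ j *
        (w ^+ n * dPsi w * (Psi w - z0)^-1 ^+ j.+1) +
       (z - z0) ^+ m * (w ^+ n * dPsi w * (Psi w - z0)^-1 ^+ m.+1)).
    by apply/funext => w'; rewrite big_ord_recr.
  by apply: contD; [exact: IH|exact: cterm].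
have crem2 := ccircM (@ccirc_cst R ((z - z0) ^+ n.+1) s) crem.
rewrite /faberC (@eq_circle_int R _ (fun w =>
   \sum_(j < n.+1) (z - z0) ^+ j * (w ^+ n * dPsi w * (Psi w - z0)^-1 ^+ j.+1) +
   (z - z0) ^+ n.+1 * (w ^+ n * dPsi w * (Psi w - z0)^-1 ^+ n.+1 * (Psi w - z)^-1)) s (ltW s0)).
  rewrite (circle_intD (ltW s0) (csum n.+1) crem2) (circle_intZ _ (ltW s0) crem) zero mulr0 addr0.
  rewrite (@circle_int_sum R n.+1 (fun j w => (z - z0) ^+ j * (w ^+ n * dPsi w * (Psi w - z0)^-1 ^+ j.+1)) s (ltW s0)).
    rewrite horner_sum; apply: eq_bigr => j _.
    rewrite hornerZ horner_exp hornerXsubC (circle_intZ _ (ltW s0) (cA j.+1)) mulrC.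
    congr (_ * _); have s12 : (1 : R) < 2 by rewrite ltr1n.
    exact: (circle_int_indep ltr01 (hAu j.+1) s12 s1).
  by move=> j _; exact: cterm.
move=> w hw; have w1 : 1 < normc w by rewrite hw.
have rw : r < normc w by rewrite hw.
rewrite /kern {1}(inv_geometric n.+1 (insidec_neq i0 w1) (insidec_neq hz rw)).
rewrite (mulrA (w ^+ n)) mulrDr mulr_sumr; congr (_ + _).
  by apply: eq_bigr => j _; rewrite mulrCA.
by rewrite mulrCA (mulrA (w ^+ n * dPsi w)).
Qed.

Lemma kern_bound r s : 1 <= r -> r < s -> exists2 M : R, 0 < M &
  forall z w : C, insidec r z -> normc w = s -> normc (kern z w) <= M.
Proof.
move=> r1 rs; have s0 : 0 < s by lra.
have cd : ccirc dPsi s.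
  by apply: ccirc_holo => w hw; apply: holo_dPsi; rewrite hw; exact: le_lt_trans rs.
have [M M0 HM] := ccirc_bounded s0 cd.
have [d d0 Hd] := insidec_away r1 rs.
exists (M / d); first by rewrite divr_gt0.
move=> z w hz hw; rewrite /kern normcM normcV ler_pM ?invr_ge0 ?normc_ge0//.
  exact: HM.
have [t ht wE] := pol_surj s0 hw.
have h := Hd t z ht hz; rewrite -wE in h.
by rewrite lef_pV2 ?posrE// (lt_le_trans d0).
Qed.

Lemma faberC_bound r s : 1 <= r -> r < s -> exists2 A : R, 0 < A &
  forall z n, insidec r z -> normc (faberC n s z) <= A * s ^+ n.
Proof.
move=> r1 rs; have s0 : 0 < s by lra.
have [M M0 HM] := kern_bound r1 rs.
exists (2 * M * s); first by rewrite !mulr_gt0.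
move=> z n hz.
have bd w : normc w = s -> normc (w ^+ n * kern z w) <= s ^+ n * M.
  move=> hw; rewrite normcM normcX hw ler_wpM2l ?HM// exprn_ge0// ltW//.
rewrite (le_trans (circle_int_le (ltW s0) (ccircX_kern (n := n) r1 rs hz) bd))//.
by rewrite le_eqVlt; apply/orP; left; apply/eqP; ring.
Qed.

Lemma kern_expansion r s s' z : 1 <= r -> r < s -> s < s' -> insidec r z ->
  exists2 M : R, 0 < M & forall (w : C) n, normc w = s' ->
  normc (kern z w - \sum_(k < n) faberC k s z / w ^+ k.+1) <= M * (s / s') ^+ n.
Proof.
move=> r1 rs ss' hz; have r0 : 0 < r by lra.
have s0 : 0 < s by lra.
have [M M0 HM] := kern_bound r1 rs.
have h (w : C) : r < normc w -> holo (kern z) w by exact: holo_kern.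
exists (2 * s * M / (s' - s)).
  by rewrite divr_gt0 ?subr_gt0// !mulr_gt0.
move=> w n hw; have sw : s < normc w by rewrite hw.
have := @exterior_remainder R (kern z) 1 r r0 h (lim_kern z) s M w n rs sw
  (fun w hw => HM z w hz hw).
by rewrite hw.
Qed.

Section FaberPolynomials.
Variable F : nat -> {poly R[i]}.
Hypothesis faberF : forall z w : C, G z -> 1 < normc w ->
  series (fun n => ((F n).[z] / w ^+ n.+1 : C)) @ \oo --> (kern z w : C).
Hypothesis connG : connected G.
Hypothesis twoG : exists a b, [/\ G a, G b & a <> b].

Lemma faber_on_G z n s : G z -> 1 < s -> (F n).[z] = faberC n s z.
Proof.
move=> Gz s1; have hz : insidec 1 z by exact: G_insidec.
have s0 : 0 < s by lra.
apply/eqP; rewrite -subr_eq0; apply/eqP.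
apply: (@laurent_coef_eq0 R (fun k => (F k).[z] - faberC k s z) s s0 _ n) => w sw.
have w1 := lt_trans s1 sw.
have H1 := faberF Gz w1.
have H2 : series (fun k => faberC k s z / w ^+ k.+1 : C) @ \oo --> (kern z w : C).
  have [M M0 HM] := kern_expansion (lexx 1) s1 sw hz.
  apply/cvgcP => e e0.
  have x01 : 0 <= s / normc w < 1.
    by rewrite divr_ge0 ?normc_ge0 ?ltW//= ltr_pdivrMr ?mul1r// (lt_trans s0).
  have [N HN] := expr_archimed x01 (divr_gt0 e0 M0).
  exists N => // m /= Nm; rewrite normc_sub big_mkord.
  rewrite (le_lt_trans (HM w m erefl))// mulrC -ltr_pdivlMr//.
  rewrite (le_lt_trans _ HN)//; case/andP: x01 => x0 /ltW x1.
  by rewrite -(subnK Nm) exprD ler_piMl ?exprn_ge0// exprn_ile1.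
have := @cvgB R[i] C nat \oo _ _ _ _ _ H1 H2.
move=> /(_ _) H3.
have -> : series (fun k => ((F k).[z] - faberC k s z) / w ^+ k.+1 : C) =
    series (fun k => (F k).[z] / w ^+ k.+1 : C) - series (fun k => faberC k s z / w ^+ k.+1 : C).
  apply/funext => m; rewrite [RHS](_ : _ = \sum_(0 <= k < m) ((F k).[z] / w ^+ k.+1 : C)
    - \sum_(0 <= k < m) (faberC k s z / w ^+ k.+1 : C)) //.
  by rewrite -sumrB; apply: eq_bigr => k _; rewrite mulrBl.
by rewrite -(subrr (kern z w)).
Qed.

Lemma G_many_points N : exists2 s : seq C, uniq s & size s = N /\ forall x, x \in s -> G x.
Proof.
have [a [b [Ga Gb ab]]] := twoG.
pose D := normc (b - a).
have D0 : 0 < D by rewrite normc_gt0 subr_eq0; apply/eqP => e; exact: ab.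
pose f (z : C) := normc (z - a).
have cf : {within G, continuous f}.
  apply: continuous_subspaceT => z.
  have h : holo (fun z : C => z - a) z := holoB (holo_id z) (holo_cst a z).
  exact: (@cont_normc R C (fun z => z - a) z (holo_cont h)).
have cI : connected (f @` G) by exact: connected_continuous_connected.
have /connected_intervalP itv := cI.
have pick k : (k < N)%N -> exists2 z, G z & f z = k%:R / N%:R * D.
  move=> kN; have N0 : (0 : R) < N%:R by rewrite ltr0n (leq_ltn_trans _ kN).
  have : (f @` G) (k%:R / N%:R * D).
    apply: (itv (f a) (f b)); [by exists a|by exists b|].
    rewrite /f subrr normc0 -/D; apply/andP; split.
      by rewrite mulr_ge0 ?divr_ge0 ?normc_ge0.
    rewrite -[X in _ <= X]mul1r ler_pM2r// ler_pdivrMr// mul1r ler_nat.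
    exact: ltnW.
  by move=> [z Gz fz]; exists z.
pose g (k : 'I_N) : C := sval (cid2 (pick k (ltn_ord k))).
have gG k : G (g k) by rewrite /g; case: cid2.
have gf k : f (g k) = k%:R / N%:R * D by rewrite /g; case: cid2.
have ginj : injective g.
  move=> i j e; have := gf i; rewrite e gf => /(mulIf (lt0r_neq0 D0)).
  have N0 : (N%:R : R)^-1 != 0.
    by rewrite invr_eq0 pnatr_eq0 -lt0n (leq_ltn_trans _ (ltn_ord i)).
  by move=> /(mulIf N0) /eqP; rewrite eqr_nat => /eqP h; apply/val_inj.
exists [seq g k | k <- enum 'I_N]; first by rewrite map_inj_uniq// enum_uniq.
split; first by rewrite size_map size_enum_ord.
by move=> x /mapP[k _ ->].
Qed.

Lemma poly_eq0_on_G (p : {poly R[i]}) : (forall z, G z -> p.[z] = 0) -> p = 0.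
Proof.
move=> h; apply/eqP/negPn/negP => p0.
have [s us [sz sG]] := G_many_points (size p).
have := max_poly_roots p0 _ us; rewrite sz ltnn => /(_ _)/wrap[|//].
by apply/allP => x /sG /h e; apply/rootP.
Qed.

Lemma faberE z n r s : 1 <= r -> r < s -> insidec r z -> (F n).[z] = faberC n s z.
Proof.
move=> r1 rs hz; have [z0 [_ [Gz0 _ _]]] := twoG.
rewrite -(faberC_poly n Gz0 r1 rs hz).
pose P := \sum_(j < n.+1) (faber_dcoef z0 n j) *: ('X - z0%:P) ^+ j.
suff -> : F n = P by [].
apply/eqP; rewrite -subr_eq0; apply/eqP/poly_eq0_on_G => y Gy.
have y1 : insidec 1 y by exact: G_insidec.
have s12 : (1 : R) < 2 by rewrite ltr1n.
by rewrite hornerD hornerN (faber_on_G n Gy s12) (faberC_poly n Gz0 (lexx 1) s12 y1) subrr.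
Qed.

End FaberPolynomials.

Lemma path_derive_pol (s t : R) : 0 < s -> path_derive (pol s : R -> C) t (pol s t * 'i).
Proof.
move=> s0; have E u : pol s u = cexp ((ln s)%:C + u%:C * 'i).
  by rewrite /cexp /pol; simpc; rewrite lnK.
rewrite E (_ : pol s = (fun u => cexp ((ln s)%:C + u%:C * 'i))); last exact/funext.
exact: (path_derive_comp (is_derive_cexp _) (path_derive_affine (ln s)%:C 'i t)).
Qed.

Lemma is_derive_inv_sub (b z : C) : b - z != 0 ->
  is_derive b 1 (fun u => (u - z)^-1) (- (b - z)^-1 ^+ 2).
Proof.
move=> bz; have d0 : 0 < normc (b - z) by rewrite normc_gt0.
apply/is_cderiveP => e e0; set d := normc _ in d0.
exists (Num.min (d / 2) (e / (2 / d ^+ 3))).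
  by rewrite lt_min !divr_gt0// exprn_gt0.
move=> h; rewrite lt_min => /andP[h1 h2].
have hN : normc (- h) < d / 2 by rewrite normc_opp.
have [H _] := invB_expansion d0 (lexx _) hN.
have -> : (b + h - z)^-1 - (b - z)^-1 - - (b - z)^-1 ^+ 2 * h =
   (b - z - - h)^-1 - (b - z)^-1 - - h * (b - z)^-1 ^+ 2.
  by rewrite opprK (addrAC b h) mulNr mulNr (mulrC h).
rewrite (le_trans H)// normc_opp expr2 mulrA ler_wpM2r ?normc_ge0//.
by rewrite mulrC -ler_pdivlMr ?divr_gt0 ?exprn_gt0// ltW.
Qed.

Lemma kern_circle_away s (v : C) : 1 < s -> s < normc v -> exists2 d : R, 0 < d &
  forall t, 0 <= t <= 2 * pi -> d <= normc (Psi (pol s t) - Psi v).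
Proof.
move=> s1 sv; have s0 : 0 < s by lra.
have cP : ccirc Psi s by apply: ccirc_holo => w hw; apply: hPsi; rewrite hw.
apply: (pcont_away (ltW (pi2_gt0 R))).
  exact: (pcontB (@ccirc_pcont R Psi s 0 (2 * pi) (ltW s0) cP) (@pcont_cst R _ _ (Psi v))).
move=> t _; rewrite subr_eq0; apply/eqP => e.
have n1 : normc (pol s t) = s by rewrite normc_pol// ltW.
have := injPsi _ (lt_trans s1 sv) e; rewrite n1 => /(_ s1) e'.
by move: sv; rewrite -e' n1 ltxx.
Qed.

Lemma kern_integral_derive s (v : C) : 1 < s -> s < normc v ->
  is_derive (Psi v) 1 (fun z => circle_int (kern z) s) 0.
Proof.
move=> s1 sv; have s0 : 0 < s by lra.
have p2 := ltW (pi2_gt0 R).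
pose gam t := Psi (pol s t).
pose phi t : C := dPsi (pol s t) * pol s t.
pose K := ((2 * pi)^-1)%:C : C.
have cP : ccirc Psi s by apply: ccirc_holo => w hw; apply: hPsi; rewrite hw.
have cd : ccirc dPsi s by apply: ccirc_holo => w hw; apply: holo_dPsi; rewrite hw.
have cgam : pcont 0 (2 * pi) gam := @ccirc_pcont R Psi s 0 (2 * pi) (ltW s0) cP.
have cphi : pcont 0 (2 * pi) phi := @ccirc_pcontM R dPsi s 0 (2 * pi) (ltW s0) cd.
have [d d0 Hd] := kern_circle_away s1 sv.
have H := cauchy_transform_derive p2 cgam cphi d0 Hd.
have n0 t : 0 <= t <= 2 * pi -> gam t - Psi v != 0.
  by move=> ht; rewrite -normc_gt0 (lt_le_trans d0)// Hd.
have cinv : pcont 0 (2 * pi) (fun t => (gam t - Psi v)^-1).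
  exact: (pcontV n0 (pcontB cgam (@pcont_cst R _ _ (Psi v)))).
have c2 : pcont 0 (2 * pi) (fun t => phi t * (gam t - Psi v)^-1 ^+ 2).
  exact: (pcontM cphi (pcontX (n := 2) cinv)).
have I0 : cint 0 (2 * pi) (fun t => phi t * (gam t - Psi v)^-1 ^+ 2) = 0.
  have F0 : cint 0 (2 * pi) (fun t => - 'i * (phi t * (gam t - Psi v)^-1 ^+ 2)) =
      (gam (2 * pi) - Psi v)^-1 - (gam 0 - Psi v)^-1.
    apply: (cint_FTC_path (Phi := fun t => (gam t - Psi v)^-1) (pi2_gt0 R)).
      exact: (pcontM (@pcont_cst R _ _ (- 'i)) c2).
    move=> t ht.
    have w1 : 1 < normc (pol s t) by rewrite normc_pol// ltW.
    have hi := hPsi w1.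
    have := path_derive_comp (is_derive_inv_sub (n0 t ht))
      (path_derive_comp (holo_is_derive hi) (path_derive_pol t s0)).
    rewrite (_ : _ * (_ * _) = - 'i * (phi t * (gam t - Psi v)^-1 ^+ 2))//.
    by rewrite /phi; ring.
  move: F0; rewrite (cintZ (- 'i) c2) /gam /pol expi2pi expi0 subrr => /eqP.
  rewrite mulf_eq0 => /orP[|/eqP //].
  by rewrite oppr_eq0 -normc_eq0 normc_i oner_eq0.
rewrite I0 in H.
have := is_deriveZ K H; rewrite scaler0.
have -> // : K \*: (fun z => cint 0 (2 * pi) (fun t => phi t * (gam t - z)^-1)) =
  (fun z => circle_int (kern z) s).
apply/funext => z; rewrite circle_intE; congr (_ * _).
by apply: eq_cint => t _; rewrite /phi /kern /gam mulrAC.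
Qed.

Lemma kern_integral_exterior s (v : C) : 1 < s -> s < normc v ->
  circle_int (kern (Psi v)) s = 0.
Proof.
move=> s1 sv; have s0 : 0 < s by lra.
have p2 := ltW (pi2_gt0 R).
have v0 : 0 < normc v := lt_trans s0 sv.
pose j (t : R) : C := circle_int (kern (Psi (0 + t%:C * v))) s.
have nv (t : R) : 1 <= t -> normc (0 + t%:C * v) = t * normc v.
  by move=> t1; rewrite add0r normcM normc_real ger0_norm//; lra.
have svt (t : R) : 1 <= t -> s < normc (0 + t%:C * v).
  by move=> t1; rewrite nv// (lt_le_trans sv)// ler_peMl// ltW.
have const T : 1 < T -> j T = j 1.
  move=> T1; apply/eqP; rewrite -subr_eq0; apply/eqP.
  rewrite -(@cint_FTC_path R 1 T j (fun=> 0) T1).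
  - by rewrite cint_cst ?mul0r// ltW.
  - exact: pcont_cst.
  - move=> t /andP[t1 _]; have st := svt t t1.
    have hp := path_derive_comp (holo_is_derive (hPsi (lt_trans s1 st)))
      (path_derive_affine 0 v t).
    have := path_derive_comp (kern_integral_derive s1 st) hp.
    by rewrite mul0r.
suff : j 1 = 0 by rewrite /j add0r mul1r.
have cP : ccirc Psi s by apply: ccirc_holo => w hw; apply: hPsi; rewrite hw.
have cd : ccirc dPsi s by apply: ccirc_holo => w hw; apply: holo_dPsi; rewrite hw.
have [B B0 HB] := ccirc_bounded s0 cP.
have [D D0 HD] := ccirc_bounded s0 cd.
apply: normc_lt_eq0 => e e0.
pose N := 2 * D * s * 2 / e; have N0 : 0 < N by rewrite divr_gt0// !mulr_gt0.
have [M HM] := Psi_growth (N + B).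
pose T := 2 + `|M| / normc v.
have T1 : 1 < T by rewrite /T ltr_wpDr// ?ltr1n// divr_ge0 ?normc_ge0.
rewrite -(const T T1) /j; set z := Psi _.
have hz : N + B < normc z.
  apply: HM; rewrite nv ?(ltW T1)// /T mulrDl divfK ?gt_eqF//.
  by have := ler_norm M; lra.
have nz (w : C) : normc w = s -> N <= normc (Psi w - z).
  by move=> hw; rewrite normc_sub; have := normcB_ge z (Psi w); have := HB w hw; lra.
have cK : ccirc (kern z) s.
  apply: ccirc_holo => w hw; have w1 : 1 < normc w by rewrite hw.
  apply: (holoM (holo_dPsi w1) (holoV (holoB (hPsi w1) (holo_cst z w)) _)).
  by rewrite -normc_gt0 (lt_le_trans N0)// nz.
have bd (w : C) : normc w = s -> normc (kern z w) <= D / N.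
  move=> hw; rewrite /kern normcM normcV ler_pM ?invr_ge0 ?normc_ge0// ?HD//.
  by rewrite lef_pV2 ?posrE// ?nz// (lt_le_trans N0)// nz.
rewrite (le_lt_trans (circle_int_le (ltW s0) cK bd))//.
have -> : 2 * (D / N) * s = e / 2.
  by rewrite /N; field; rewrite !gt_eqF.
lra.
Qed.

Section AnalyticFunction.
Variables (f : C -> C) (Rr : R).
Hypothesis hf : forall z, inside Rr z -> holo f z.

Lemma Psi_inside (w : C) : 1 < normc w < Rr -> inside Rr (Psi w).
Proof. by move=> /andP[w1 wR]; exact: insidec_inside wR (Psi_insidec w1). Qed.

Lemma holo_fPsi (w : C) : 1 < normc w < Rr -> holo (fun w => f (Psi w)) w.
Proof.
move=> hw; case/andP: (hw) => w1 _.
exact: (holo_comp (hPsi w1) (hf (Psi_inside hw))).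
Qed.

Lemma ccirc_fPsi rho : 1 < rho < Rr -> ccirc (fun w => f (Psi w)) rho.
Proof. by move=> hr; apply: ccirc_holo => w hw; apply: holo_fPsi; rewrite hw. Qed.

Definition cauchyPsi (rho : R) (z : C) : C :=
  circle_int (fun w => f (Psi w) * kern z w) rho.

Lemma cauchyPsi_jump s rho (v : C) : 1 < s -> s < normc v -> normc v < rho -> rho < Rr ->
  cauchyPsi rho (Psi v) - f (Psi v) = cauchyPsi s (Psi v).
Proof.
move=> s1 sv vr rR; have s0 : 0 < s by lra.
have r0 : 0 < rho by lra.
have v1 := lt_trans s1 sv.
have hv : 1 < normc v < Rr by rewrite v1 (lt_trans vr).
have /holo_is_derive dl := hf (Psi_inside hv).
set l := 'D_1 f (Psi v) in dl.
pose g (w : C) := diffquot f (Psi v) l (Psi w) * dPsi w.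
have cg (w : C) : 1 < normc w < Rr -> {for w, continuous g}.
  move=> hw; case/andP: (hw) => w1 wR.
  have cq : {for Psi w, continuous (diffquot f (Psi v) l)}.
    have [->|ne] := eqVneq (Psi w) (Psi v); first exact: diffquot_cont.
    exact: (holo_cont (diffquot_holo l ne (hf (Psi_inside hw)))).
  exact: (contM (cont_comp (holo_cont (hPsi w1)) cq) (holo_cont (holo_dPsi w1))).
have hg (w : C) : 1 < normc w < Rr -> normc w != normc v -> holo g w.
  move=> hw ne; case/andP: (hw) => w1 wR.
  have nP : Psi w != Psi v.
    by apply/eqP => /(injPsi w1 v1) e; move: ne; rewrite e eqxx.
  exact: (holoM (holo_comp (hPsi w1) (diffquot_holo l nP (hf (Psi_inside hw)))) (holo_dPsi w1)).
have E : circle_int g s = circle_int g rho.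
  apply: (@circle_int_annulus_except R g s (normc v) rho s0).
  - by rewrite sv.
  - move=> w /andP[h1 h2]; apply: cg.
    by rewrite (lt_le_trans s1 h1) (le_lt_trans h2).
  - move=> w /andP[h1 h2]; apply: hg.
    by rewrite (lt_le_trans s1 h1) (le_lt_trans h2).
have I x : 1 < x < Rr -> x != normc v ->
    circle_int g x = cauchyPsi x (Psi v) - f (Psi v) * circle_int (kern (Psi v)) x.
  move=> /andP[x1 xR] xv; have x0 : 0 < x by lra.
  have nP (w : C) : normc w = x -> Psi w != Psi v.
    move=> hw; apply/eqP; rewrite -hw in x1; move=> /(injPsi x1 v1) e.
    by move: xv; rewrite -hw e eqxx.
  have cK : ccirc (kern (Psi v)) x.
    apply: ccirc_holo => w hw; have w1 : 1 < normc w by rewrite hw.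
    have n0 : Psi w - Psi v != 0 by rewrite subr_eq0 nP.
    exact: (holoM (holo_dPsi w1) (holoV (holoB (hPsi w1) (holo_cst (Psi v) w)) n0)).
  have x1R : 1 < x < Rr by rewrite x1.
  have c1 := ccircM (ccirc_fPsi x1R) cK.
  have c2 := ccircM (@ccirc_cst R (f (Psi v)) x) cK.
  rewrite /cauchyPsi -(circle_intZ _ (ltW x0) cK) -(circle_intB (ltW x0) c1 c2).
  apply: eq_circle_int => [|w hw]; first exact: ltW.
  rewrite /g /diffquot (negPf (nP w hw)) /kern.
  have n0 : Psi w - Psi v != 0 by rewrite subr_eq0 nP.
  by field.
have sR : 1 < s < Rr by rewrite s1 (lt_trans sv)// (lt_trans vr).
have rR' : 1 < rho < Rr by rewrite rR (lt_trans v1).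
move: E; rewrite (I s sR (negbT (lt_eqF sv))) (I rho rR' (negbT (gt_eqF vr))).
rewrite (kern_integral_exterior s1 sv) mulr0 subr0 => ->.
have hz := Psi_insidec v1.
have := faberC0 (ltW v1) vr hz; rewrite /faberC.
rewrite (@eq_circle_int R _ (kern (Psi v)) rho (ltW r0)) => [->|w _].
  by rewrite mulr1.
by rewrite expr0 mul1r.
Qed.

Lemma cauchyPsi_holo s (z : C) : 1 < s < Rr ->
  (exists2 d : R, 0 < d & forall t, 0 <= t <= 2 * pi -> d <= normc (Psi (pol s t) - z)) ->
  holo (cauchyPsi s) z.
Proof.
move=> /andP[s1 sR] [d d0 Hd]; have s0 : 0 < s by lra.
pose gam t := Psi (pol s t).
have cP : ccirc Psi s by apply: ccirc_holo => w hw; apply: hPsi; rewrite hw.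
have cd : ccirc dPsi s by apply: ccirc_holo => w hw; apply: holo_dPsi; rewrite hw.
have cf : ccirc (fun w => f (Psi w)) s by apply: ccirc_fPsi; rewrite s1.
have cgam : pcont 0 (2 * pi) gam := @ccirc_pcont R Psi s 0 (2 * pi) (ltW s0) cP.
have cphi := @ccirc_pcontM R _ s 0 (2 * pi) (ltW s0) (ccircM cf cd).
have [H _] := cauchy_transform_derive (ltW (pi2_gt0 R)) cgam cphi d0 Hd.
have hK := holoM (holo_cst ((2 * pi)^-1)%:C z) (Holo H).
have -> // : cauchyPsi s = (fun z => ((2 * pi)^-1)%:C * cint 0 (2 * pi)
   (fun t => f (Psi (pol s t)) * dPsi (pol s t) * pol s t * (gam t - z)^-1)).
apply/funext => y; rewrite /cauchyPsi circle_intE; congr (_ * _).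
by apply: eq_cint => t _; rewrite /kern /gam; ring.
Qed.

(* Dixon's argument: the difference of both sides on the inside of the level
   curve and the Cauchy transform outside glue to an entire function that
   vanishes at infinity. *)
Lemma cauchyPsi_formula rho z : 1 < rho < Rr -> inside rho z -> cauchyPsi rho z = f z.
Proof.
move=> /andP[r1 rR]; have [s s1 sr] : exists2 s : R, 1 < s & s < rho.
  by exists ((1 + rho) / 2); lra.
have s0 : 0 < s by lra.
have r0 : 0 < rho by lra.
have sR : 1 < s < Rr by rewrite s1 (lt_trans sr).
have rR' : 1 < rho < Rr by rewrite r1.
pose h (z : C) : C := if pselect (inside rho z) then cauchyPsi rho z - f z else cauchyPsi s z.
have hin y : inside rho y -> h y = cauchyPsi rho y - f y.
  by rewrite /h; case: pselect.
have hout (v : C) : s < normc v -> h (Psi v) = cauchyPsi s (Psi v).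
  move=> sv; rewrite /h; case: pselect => // iv.
  apply: cauchyPsi_jump => //.
  by rewrite ltNge; apply/negP => /iv; rewrite eqxx.
have away_in y : inside rho y ->
    exists2 d : R, 0 < d & forall t, 0 <= t <= 2 * pi -> d <= normc (Psi (pol rho t) - y).
  move=> iy; have cP : ccirc Psi rho.
    by apply: ccirc_holo => w hw; apply: hPsi; rewrite hw.
  apply: (pcont_away (ltW (pi2_gt0 R))).
    exact: (pcontB (@ccirc_pcont R Psi rho 0 (2 * pi) (ltW r0) cP) (@pcont_cst R _ _ y)).
  by move=> t _; rewrite subr_eq0; apply: iy; rewrite normc_pol// ltW.
have entire y : holo h y.
  have [iy|ny] := pselect (inside rho y).
    have [d d0 Hd] := open_inside r1 iy.
    apply: (@near_eq_holo R (fun y => cauchyPsi rho y - f y)).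
      by apply/nbhscP; exists d => // y' /Hd /hin ->.
    apply: (holoB (cauchyPsi_holo rR' (away_in y iy))).
    by apply: hf => w Rw; apply: iy; apply: ltW; exact: lt_le_trans Rw.
  have [v rv yE] : exists2 v : C, rho <= normc v & Psi v = y.
    apply: contrapT => no; apply: ny => w rw; apply/eqP => e.
    by apply: no; exists w.
  have sv : s < normc v := lt_le_trans sr rv.
  have [d d0 Hd] := open_exterior (ltW s1) sv.
  apply: (@near_eq_holo R (cauchyPsi s)).
    apply/nbhscP; exists d => // y'; rewrite -yE => /Hd[w sw <-].
    by rewrite hout.
  rewrite -yE; exact: (cauchyPsi_holo sR (kern_circle_away s1 sv)).
have cP : ccirc Psi s by apply: ccirc_holo => w hw; apply: hPsi; rewrite hw.
have cd : ccirc dPsi s by apply: ccirc_holo => w hw; apply: holo_dPsi; rewrite hw.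
have cf := ccirc_fPsi sR.
have [B B0 HB] := ccirc_bounded s0 cP.
have [D D0 HD] := ccirc_bounded s0 (ccircM cf cd).
have [L HL] := insidec_bounded (ltW r1).
have van : forall e : R, 0 < e -> exists M : R, forall y : C, M < normc y -> normc (h y) <= e.
  move=> e e0; pose N := 2 * D * s / e; have N0 : 0 < N by rewrite divr_gt0// !mulr_gt0.
  exists (Num.max L (N + B)) => y; rewrite gt_max => /andP[Ly Ny].
  have -> : h y = cauchyPsi s y.
    rewrite /h; case: pselect => // iy; have := HL y (inside_insidec iy).
    by rewrite leNgt Ly.
  have ny (w : C) : normc w = s -> N <= normc (Psi w - y).
    by move=> hw; rewrite normc_sub; have := normcB_ge y (Psi w); have := HB w hw; lra.
  have cK : ccirc (fun w => f (Psi w) * kern y w) s.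
    apply: (ccircM cf); apply: ccirc_holo => w hw; have w1 : 1 < normc w by rewrite hw.
    apply: (holoM (holo_dPsi w1) (holoV (holoB (hPsi w1) (holo_cst y w)) _)).
    by rewrite -normc_gt0 (lt_le_trans N0)// ny.
  have bd (w : C) : normc w = s -> normc (f (Psi w) * kern y w) <= D / N.
    move=> hw; rewrite /kern mulrA normcM normcV ler_pM ?invr_ge0 ?normc_ge0// ?HD//.
    by rewrite lef_pV2 ?posrE// ?ny// (lt_le_trans N0)// ny.
  rewrite /cauchyPsi (le_trans (circle_int_le (ltW s0) cK bd))//.
  rewrite le_eqVlt; apply/orP; left; apply/eqP.
  by rewrite /N; field; rewrite !gt_eqF.
have h0 := entire_vanishing_at_infty entire van.
move=> iz; have := h0 z; rewrite hin// => /eqP; rewrite subr_eq0 => /eqP.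
exact.
Qed.

Definition laurent_coef (rho : R) (k : nat) : C :=
  circle_int (fun u => f (Psi u) / u ^+ k.+1) rho.

Lemma ccirc_coef rho k : 1 < rho < Rr -> ccirc (fun u => f (Psi u) / u ^+ k.+1) rho.
Proof.
move=> hr; case/andP: (hr) => r1 _; apply: ccirc_holo => w hw.
have w0 : w ^+ k.+1 != 0 by rewrite expf_neq0// -normc_gt0 hw; lra.
apply: (holo_div (holo_fPsi _) (holoX k.+1 (holo_id w)) w0).
by rewrite hw.
Qed.

Lemma laurent_coef_indep rho rho' k : 1 < rho < Rr -> 1 < rho' < Rr ->
  laurent_coef rho k = laurent_coef rho' k.
Proof.
wlog h : rho rho' / rho <= rho' => [hw a b|/andP[a1 a2] /andP[b1 b2]].
  by case: (leP rho rho') => ab; [exact: hw|apply/esym/hw => //; exact: ltW].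
move: h; rewrite le_eqVlt => /orP[/eqP -> //|h].
have r0 : 0 < rho by lra.
apply: (circle_int_annulus r0 h) => w /andP[h1 h2].
have w1 := lt_le_trans a1 h1.
have w0 : w ^+ k.+1 != 0 by rewrite expf_neq0// -normc_gt0; lra.
apply: (holo_div (holo_fPsi _) (holoX k.+1 (holo_id w)) w0).
by rewrite w1 (le_lt_trans h2).
Qed.

Lemma laurent_coef_bound rho rho0 : 1 < rho < Rr -> 1 < rho0 < Rr ->
  exists2 A : R, 0 < A & forall k, normc (laurent_coef rho0 k) <= A * rho^-1 ^+ k.
Proof.
move=> hr hr0; case/andP: (hr) => r1 _; have r0 : 0 < rho by lra.
have [M M0 HM] := ccirc_bounded r0 (ccirc_fPsi hr).
exists (2 * M); first by rewrite mulr_gt0.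
move=> k; rewrite (laurent_coef_indep k hr0 hr).
have bd (w : C) : normc w = rho -> normc (f (Psi w) / w ^+ k.+1) <= M / rho ^+ k.+1.
  by move=> hw; rewrite normc_div normcX hw ler_pM2r ?invr_gt0 ?exprn_gt0// HM.
rewrite (le_trans (circle_int_le (ltW r0) (ccirc_coef (k := k) hr) bd))//.
rewrite exprSr exprVn; have : rho ^+ k != 0 by rewrite expf_neq0// gt_eqF.
have rn0 : rho != 0 by rewrite gt_eqF.
move: (rho ^+ k) => x x0; rewrite le_eqVlt; apply/orP; left; apply/eqP.
by field; rewrite x0 rn0.
Qed.

Lemma faber_expansion r s rho0 z : 1 <= r -> r < s -> s < Rr -> 1 < rho0 < Rr ->
  insidec r z ->
  series (fun k => laurent_coef rho0 k * faberC k s z : C) @ \oo --> (f z : C).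
Proof.
move=> r1 rs sR hr0 hz; have [rho srho rhoR] : exists2 rho : R, s < rho & rho < Rr.
  by exists ((s + Rr) / 2); lra.
have rho1 : 1 < rho by lra.
have r0 : 0 < rho by lra.
have s0 : 0 < s by lra.
have hrho : 1 < rho < Rr by rewrite rho1.
have rrho : r < rho := lt_trans rs srho.
have iz : inside rho z := insidec_inside rrho hz.
have [M M0 HM] := kern_expansion r1 rs srho hz.
have cf := ccirc_fPsi hrho.
have [N N0 HN] := ccirc_bounded r0 cf.
have cK : ccirc (kern z) rho.
  by apply: ccirc_holo => w hw; apply: (holo_kern r1 hz); rewrite hw.
have cterm k : ccirc (fun w => faberC k s z * (f (Psi w) / w ^+ k.+1)) rho.
  exact: (ccircM (@ccirc_cst R (faberC k s z) rho) (ccirc_coef (k := k) hrho)).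
have csum m : ccirc (fun w => \sum_(k < m) faberC k s z * (f (Psi w) / w ^+ k.+1)) rho.
  elim: m => [|m IH].
    have -> : (fun w => \sum_(k < 0) faberC k s z * (f (Psi w) / w ^+ k.+1)) = (fun=> 0).
      by apply/funext => w; rewrite big_ord0.
    exact: ccirc_cst.
  move=> w hw; have -> : (fun w => \sum_(k < m.+1) faberC k s z * (f (Psi w) / w ^+ k.+1)) =
     (fun w => \sum_(k < m) faberC k s z * (f (Psi w) / w ^+ k.+1) +
       faberC m s z * (f (Psi w) / w ^+ m.+1)).
    by apply/funext => w'; rewrite big_ord_recr.
  by apply: contD; [exact: IH|exact: cterm].
have E m : series (fun k => laurent_coef rho0 k * faberC k s z : C) m - f z =
    - circle_int (fun w => f (Psi w) * kern z w -
       \sum_(k < m) faberC k s z * (f (Psi w) / w ^+ k.+1)) rho.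
  rewrite (circle_intB (ltW r0) (ccircM cf cK) (csum m)).
  rewrite -[circle_int (fun w => f (Psi w) * kern z w) rho]/(cauchyPsi rho z).
  rewrite (cauchyPsi_formula hrho iz) opprB; congr (_ - _).
  rewrite (@circle_int_sum R m (fun k w => faberC k s z * (f (Psi w) / w ^+ k.+1)) rho (ltW r0)).
    rewrite /series /= big_mkord; apply: eq_bigr => k _.
    by rewrite (circle_intZ _ (ltW r0) (ccirc_coef (k := k) hrho)) mulrC (laurent_coef_indep k hr0 hrho).
  by move=> k _; exact: cterm.
have x01 : 0 <= s / rho < 1.
  by rewrite divr_ge0 ?ltW//= ltr_pdivrMr ?mul1r.
apply/cvgcP => e e0.
have K0 : 0 < 2 * (N * M) * rho by rewrite !mulr_gt0.
have [m0 Hm0] := expr_archimed x01 (divr_gt0 e0 K0).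
exists m0 => // m /= m0m; rewrite E normc_opp.
have bd (w : C) : normc w = rho -> normc (f (Psi w) * kern z w -
       \sum_(k < m) faberC k s z * (f (Psi w) / w ^+ k.+1)) <= N * M * (s / rho) ^+ m.
  move=> hw; have -> : f (Psi w) * kern z w -
       \sum_(k < m) faberC k s z * (f (Psi w) / w ^+ k.+1) =
     f (Psi w) * (kern z w - \sum_(k < m) faberC k s z / w ^+ k.+1).
    rewrite mulrBr mulr_sumr; congr (_ - _); apply: eq_bigr => k _.
    by rewrite mulrCA.
  by rewrite normcM -mulrA ler_pM ?normc_ge0// ?HN// HM.
have cD := ccircB (ccircM cf cK) (csum m).
rewrite (le_lt_trans (circle_int_le (ltW r0) cD bd))//.
have -> : 2 * (N * M * (s / rho) ^+ m) * rho = (s / rho) ^+ m * (2 * (N * M) * rho) by ring.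
rewrite -ltr_pdivlMr// (le_lt_trans _ Hm0)//; case/andP: x01 => x0 /ltW x1.
by rewrite -(subnK m0m) exprD ler_piMl ?exprn_ge0// exprn_ile1.
Qed.

End AnalyticFunction.

Lemma bernstein_faber_estimate (F : nat -> {poly R[i]}) (f H : C -> C) (Rr r : R) :
  (forall z n r s, 1 <= r -> r < s -> insidec r z -> (F n).[z] = faberC n s z) ->
  (forall z, inside Rr z -> holo f z) -> 1 < r < Rr ->
  {within [set w : C | `|w| <= 1], continuous H} ->
  (forall w : C, `|w| < 1 -> H w = assoc_fun Psi f (contour_radius Rr) w) ->
  exists2 K : R, 0 < K & forall (z : C) n, insidec r z -> (0 < n)%N ->
  [/\ normc (f z) <= K, normc (bernstein_faber F H n z - f z) <= K / n%:R &
   exists2 S : C, series (fun k => ('C(k.+2, 2)%:R / n%:R)%:C *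
       ((F k.+1).[z] - (F k.+2).[z]) * faber_coef Psi f (contour_radius Rr) k.+2 : C)
         @ \oo --> S &
     normc (bernstein_faber F H n z - f z - S) <= K / n%:R ^+ 2].
Proof.
move=> FE hf /andP[r1 rR] cH eH.
pose s := (2 * r + Rr) / 3; pose rho := (r + 2 * Rr) / 3.
have rs : r < s by rewrite /s; lra.
have sR : s < Rr by rewrite /s; lra.
have srho : s < rho by rewrite /s /rho; lra.
have s1 : 1 <= s by lra.
have hrho : 1 < rho < Rr by rewrite /rho; apply/andP; split; lra.
have hc : 1 < contour_radius Rr < Rr by rewrite /contour_radius; apply/andP; split; lra.
case/andP: (hc) => c1 _.
have r1' := ltW r1.
have [A A0 HA] := faberC_bound r1' rs.
have [Ma Ma0 HMa] := laurent_coef_bound hf hrho hc.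
have [K K0 HK] := bern_estimate A0 s1 srho Ma0.
exists K => // z n hz n0.
apply: (HK n (fun p => (F p).[z]) (laurent_coef f (contour_radius Rr)) H (f z) n0).
- by move=> p; rewrite (FE _ _ _ _ r1' rs hz) HA.
- exact: HMa.
- by move=> x hx; exact: (series_extends_to_one c1 (ccirc_fPsi hf hc) cH eH hx).
have -> : (fun k => laurent_coef f (contour_radius Rr) k * (F k).[z] : C) =
    (fun k => laurent_coef f (contour_radius Rr) k * faberC k s z).
  by apply/funext => k; rewrite (FE _ _ _ _ r1' rs hz).
exact: (faber_expansion hf r1' rs sR hc hz).
Qed.

End ExteriorMap.

(** * Products *)

Lemma normc_combine (R : realType) (x f y g u d e : Cplx R) (a b K L : R) :
  normc x <= a -> normc f <= K -> normc g <= L -> normc y <= L * b ->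
  normc u <= K * b -> normc (d * e) <= K * L * b ->
  normc (x - f * y - g * u - d * e) <= a + 3 * K * L * b.
Proof.
move=> hx hf hg hy hu hde.
have k1 : normc (f * y) <= K * (L * b) by rewrite normcM ler_pM ?normc_ge0.
have k2 : normc (g * u) <= L * (K * b) by rewrite normcM ler_pM ?normc_ge0.
have j1 := normcB_le x (f * y); have j2 := normcB_le (x - f * y) (g * u).
have j3 := normcB_le (x - f * y - g * u) (d * e).
have -> : a + 3 * K * L * b = a + K * (L * b) + L * (K * b) + K * L * b by ring.
move: hx hde k1 k2 j1 j2 j3; lra.
Qed.

Lemma level_domainP (R : realType) (G : set (Cplx R)) Psi :
  exterior_conformal_map G Psi -> forall Rr z, inside Psi Rr z -> level_domain G Psi Rr z.
Proof.
move=> [_ _ imP _] Rr z hz; have [Gz|nGz] := pselect (G z); [by left|right].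
have : (~` G) z by [].
rewrite -imP => -[w w1 wz]; exists w => //=; rewrite w1 normrE_normc ltcR ltNge.
by apply/negP => /hz; rewrite wz eqxx.
Qed.

Theorem theorem6p1 (R : realType) (G : set (Cplx R)) (Psi : Cplx R -> Cplx R)
    (F : nat -> {poly R[i]}) (Rr r : R) (f g Hf Hg Hfg : Cplx R -> Cplx R) :
  (* G is a continuum (compact, connected, not a point) with connected complement *)
  compact G -> connected G -> (exists a b, G a /\ G b /\ a <> b) ->
  connected (~` G) ->
  exterior_conformal_map G Psi ->
  faber_polynomials G Psi F ->
  (1 < Rr)%R ->
  (* f and g analytic in G_R *)
  (forall z, level_domain G Psi Rr z -> derivable f z 1) ->
  (forall z, level_domain G Psi Rr z -> derivable g z 1) ->
  (* the functions H associated with f, g, fg extend continuously to the closed disc *)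
  {within [set w : Cplx R | `|w| <= 1], continuous Hf} ->
  (forall w : Cplx R, `|w| < 1 -> Hf w = assoc_fun Psi f (contour_radius Rr) w) ->
  {within [set w : Cplx R | `|w| <= 1], continuous Hg} ->
  (forall w : Cplx R, `|w| < 1 -> Hg w = assoc_fun Psi g (contour_radius Rr) w) ->
  {within [set w : Cplx R | `|w| <= 1], continuous Hfg} ->
  (forall w : Cplx R, `|w| < 1 ->
     Hfg w = assoc_fun Psi (fun z => f z * g z) (contour_radius Rr) w) ->
  (1 < r)%R -> (r < Rr)%R ->
  (* (i) *)
  (exists C : R, forall (z : Cplx R) (n : nat),
     closure (level_domain G Psi r) z -> (0 < n)%N ->
     `|bernstein_faber F Hfg n z - bernstein_faber F Hf n z * bernstein_faber F Hg n z|
       <= (C / n%:R)%R%:C) /\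
  (* (ii) *)
  (exists C : R, forall (z : Cplx R) (n : nat),
     closure (level_domain G Psi r) z -> (0 < n)%N ->
     exists S : Cplx R,
       series (fun k => let k := k.+2 in
         ((k * (k - 1))%:R / (2 * n%:R) * ((F k.-1).[z] - (F k).[z])
          * (faber_coef Psi (fun x => f x * g x) (contour_radius Rr) k
             - f z * faber_coef Psi g (contour_radius Rr) k
             - g z * faber_coef Psi f (contour_radius Rr) k) : Cplx R)) @ \oo --> S
       /\ `|bernstein_faber F Hfg n z - bernstein_faber F Hf n z * bernstein_faber F Hg n z
            - S| <= (C / (n%:R ^+ 2))%R%:C).
Proof.
move=> _ connG [a [b [Ga [Gb ab]]]] _ hmap hfab _ hf hg cHf eHf cHg eHg cHfg eHfg r1 rR.
have twoG : exists a b, [/\ G a, G b & a <> b] by exists a, b.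
have inL := level_domainP hmap.
have [dP injP imP [c [c0 limP]]] := hmap.
have n1 (w : Cplx R) : 1 < normc w -> 1 < `|w| by rewrite normrE_normc ltcR.
have hPsi (w : Cplx R) : 1 < normc w -> holo Psi w by move=> /n1 /dP; exact: Holo.
have injPsi (w1 w2 : Cplx R) : 1 < normc w1 -> 1 < normc w2 -> Psi w1 = Psi w2 -> w1 = w2.
  by move=> /n1 h1 /n1 h2; exact: injP.
have imPsi z : ~ G z <-> exists2 w : Cplx R, 1 < normc w & Psi w = z.
  split=> [nGz|[w w1 <-]].
    have : (~` G) z by [].
    by rewrite -imP => -[w /= w1 wz]; exists w => //; move: w1; rewrite normrE_normc ltcR.
  have : (~` G) (Psi w) by rewrite -imP; exists w => //; exact: n1.
  exact.
have limPsi : (Psi w / w) @[w --> (@cinfty R)] --> (c%:C : Cplx R).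
  apply/cvg_inftyP => e e0; have [M HM] := limP e e0; exists M => w Mw.
  have := HM w; rewrite !normrE_normc !ltcR => /(_ Mw); exact: ltW.
have hF (z w : Cplx R) : G z -> 1 < normc w ->
    series (fun n => ((F n).[z] / w ^+ n.+1 : Cplx R)) @ \oo --> (kern Psi z w : Cplx R).
  by move=> Gz /n1; exact: hfab.
have FE z n p q : 1 <= p -> p < q -> insidec Psi p z -> (F n).[z] = faberC Psi n q z.
  exact: (faberE hPsi injPsi imPsi c0 limPsi hF connG twoG).
have Hf' z : inside Psi Rr z -> holo f z by move=> /inL /hf; exact: Holo.
have Hg' z : inside Psi Rr z -> holo g z by move=> /inL /hg; exact: Holo.
have Hfg' z : inside Psi Rr z -> holo (fun z => f z * g z) z.
  by move=> hz; exact: holoM (Hf' z hz) (Hg' z hz).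
have hr : 1 < r < Rr by rewrite r1.
have est f0 H0 := @bernstein_faber_estimate R Psi c hPsi injPsi c0 limPsi F f0 H0 Rr r FE.
have [K K0 HK] := est _ _ Hf' hr cHf eHf.
have [L L0 HL] := est _ _ Hg' hr cHg eHg.
have [M M0 HM] := est _ _ Hfg' hr cHfg eHfg.
have clos z : closure (level_domain G Psi r) z -> insidec Psi r z.
  move=> hz; apply: (closure_insidec hPsi injPsi (ltW r1)).
  apply: closure_subset hz => y [Gy|[w /= /andP[w1 wr] <-]].
    exact: (G_insidec imPsi (ltW r1) Gy).
  apply: (Psi_insidec_le injPsi); move: w1 wr.
  by rewrite normrE_normc !ltcR => -> /ltW ->.
have quad (d e : Cplx R) (n : nat) : (0 < n)%N -> normc d <= K / n%:R -> normc e <= L / n%:R ->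
    normc (d * e) <= K * L * n%:R ^- 2.
  move=> n0 hd he; rewrite normcM (le_trans (ler_pM _ _ hd he)) ?normc_ge0//.
  by rewrite le_eqVlt; apply/orP; left; apply/eqP; field; rewrite pnatr_eq0 -lt0n.
split; exists (M + 3 * K * L) => z n /clos hz n0;
  have [f1 f2 [Sf sf f3]] := HK z n hz n0; have [g1 g2 [Sg sg g3]] := HL z n hz n0;
  have [_ m2 [Sm sm m3]] := HM z n hz n0; have q := quad _ _ n n0 f2 g2.
  rewrite normrE_normc lecR mulrDl.
  have -> : bernstein_faber F Hfg n z - bernstein_faber F Hf n z * bernstein_faber F Hg n z =
     (bernstein_faber F Hfg n z - f z * g z) - f z * (bernstein_faber F Hg n z - g z) -
     g z * (bernstein_faber F Hf n z - f z) -
     (bernstein_faber F Hf n z - f z) * (bernstein_faber F Hg n z - g z) by ring.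
  apply: normc_combine => //; apply: (le_trans q).
  rewrite ler_pM2l ?mulr_gt0// lef_pV2 ?posrE ?exprn_gt0 ?ltr0n//.
  by rewrite ler_eXnr// ler1n.
exists (Sm - f z * Sg - g z * Sf); split.
  have hS := cvg_seriesB (cvg_seriesB sm (@cvg_seriesZ R (f z) _ _ sg)) (@cvg_seriesZ R (g z) _ _ sf).
  have E k : ('C(k.+2, 2)%:R / n%:R)%:C = (k.+2 * (k.+2 - 1))%:R / (2 * n%:R) :> R[i].
    have -> : (k.+2 * (k.+2 - 1) = 2 * 'C(k.+2, 2))%N by rewrite -(mul_bin_diag k.+2 1) bin1 subn1.
    rewrite (fmorph_div (real_complex R)) !(rmorph_nat (real_complex R)) natrM.
    by rewrite -mulf_div divff ?mul1r// pnatr_eq0.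
  set v := (X in series X @ _ --> _).
  set u := (X in series X @ _ --> _) in hS.
  have -> // : v = u.
  apply/funext => k; rewrite /u /v /= -E /=.
  ring.
rewrite normrE_normc lecR mulrDl.
have -> : bernstein_faber F Hfg n z - bernstein_faber F Hf n z * bernstein_faber F Hg n z
     - (Sm - f z * Sg - g z * Sf) =
   (bernstein_faber F Hfg n z - f z * g z - Sm) - f z * (bernstein_faber F Hg n z - g z - Sg) -
   g z * (bernstein_faber F Hf n z - f z - Sf) -
   (bernstein_faber F Hf n z - f z) * (bernstein_faber F Hg n z - g z) by ring.
exact: normc_combine.
Qed.
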